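(* Let $d\ge 2$ be an integer and let $c=(c_n)_{n\in\mathbb{N}^\star}\in l^2(\mathbb{N}^\star)$ be a sequence for which there exist two constants $0<\alpha_1\le\alpha_2$ such that, for every $n\in\mathbb{N}^\star$, $$\frac{\alpha_1}{n}\le c_n\le\frac{\alpha_2}{n}.$$ Let $(g_n)_{n\in\mathbb{N}^\star}$ be a sequence of independent $\mathcal{N}_{\mathbb{C}}(0,1)$ Gaussian random variables on a probability space $(\Omega,\mathcal{A},P)$, and let $$F_c(\omega,r)=\sum_{n\in\mathbb{N}^\star}g_n(\omega)\,c_n\,e_{n,d}(r),$$ where $(e_{n,d})_{n\in\mathbb{N}^\star}$ is the orthonormal basis of $L^2([0,1],\mathcal{B}([0,1]),r^{d-1}dr)$ of normalized radial Dirichlet eigenfunctions defined in the context. Then the critical exponent $$p_{cr}(c)=\sup\Big\{p\ge 2:\ \|F_c(\omega,\cdot)\|_{L^p([0,1],\mathcal{B}([0,1]),r^{d-1}dr)}<\infty\ \text{a.s.}\Big\}$$ is given by $$p_{cr}(c)=\frac{2d}{d-2},$$ where $\frac{2d}{d-2}$ is understood as $+\infty$ when $d=2$.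
   Context: $\mathbb{N}^\star=\{1,2,3,\dots\}$; $\mathcal{B}([0,1])$ is the Borel $\sigma$-algebra of $[0,1]$. In the definition of $p_{cr}(c)$, $p$ ranges over finite real numbers and the supremum is taken in $[2,\infty]$. For $\nu\ge 0$ and $r>0$, the Bessel function is $J_\nu(r)=(r/2)^\nu\sum_{k=0}^\infty\frac{(-1)^k(r/2)^{2k}}{k!\,\Gamma(k+\nu+1)}$. Let $(z_{n,d})_{n\in\mathbb{N}^\star}$ be the increasing sequence of the (simple) zeros of $J_{\frac{d-2}{2}}$ on $(0,\infty)$, let $\beta_{n,d}=\left(\int_0^1|J_{\frac{d-2}{2}}(z_{n,d}r)|^2\,r\,dr\right)^{1/2}$, and define $e_{n,d}(r)=\beta_{n,d}^{-1}\,r^{-\frac{d-2}{2}}J_{\frac{d-2}{2}}(z_{n,d}\,r)$. The functions $e_{n,d}$, $n\in\mathbb{N}^\star$, form an orthonormal basis of $L^2([0,1],\mathcal{B}([0,1]),r^{d-1}dr)$ (complex-valued functions). An $\mathcal{N}_{\mathbb{C}}(0,\sigma^2)$ Gaussian random variable ($\sigma>0$) is a complex-valued random variable with density $\frac{1}{2\pi\sigma^2}e^{-|z|^2/(2\sigma^2)}$ on $\mathbb{C}$ (so $\mathbb{E}|X|^2=2\sigma^2$). The series $F_c$ is the limit in $L^2(\Omega\times[0,1],P\otimes r^{d-1}dr)$ of its partial sums; for $P$-almost every $\omega$, $F_c(\omega,\cdot)\in L^2([0,1],r^{d-1}dr)$ with coordinates $g_n(\omega)c_n$ in the basis $(e_{n,d})$.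 The $L^p$ norm of a function takes the value $\infty$ if the function is not in $L^p$. *)

(* Defs.v *)
From HB Require Import structures.
From mathcomp Require Import all_boot all_order all_algebra finmap.
From mathcomp Require Import complex.
From mathcomp Require Import all_classical all_reals all_analysis measurable_realfun.

Set Implicit Arguments.
Unset Strict Implicit.
Unset Printing Implicit Defensive.
Import Order.TTheory GRing.Theory Num.Theory.
Import numFieldNormedType.Exports.

Local Open Scope classical_set_scope.
Local Open Scope ring_scope.

(* Sequences indexed by {1, 2, 3, ...} in the mathematics are indexed by nat
   here, the value at n standing for the (n+1)-st term. *)

(* The Borel sigma-algebra of C, obtained by identifying C with R * R. *)
Section complex_measurable.
Variable R : realType.

Definition complex_pair (z : R[i]) : R * R := (complex.Re z, complex.Im z).

Definition complex_measurable : set (set R[i]) :=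
  preimage_set_system setT complex_pair measurable.

Let complex_sigma_algebra : sigma_algebra setT complex_measurable.
Proof.
by apply: sigma_algebra_preimage; exact: sigma_algebra_measurable.
Qed.

Let cmeasurable0 : complex_measurable set0.
Proof. by case: complex_sigma_algebra. Qed.

Let cmeasurableC A : complex_measurable A -> complex_measurable (~` A).
Proof. by case: complex_sigma_algebra => _ + _ => /[apply]; rewrite setTD. Qed.

Let cmeasurable_bigcup (A : (set R[i])^nat) :
  (forall i, complex_measurable (A i)) -> complex_measurable (\bigcup_i A i).
Proof. by case: complex_sigma_algebra => _ _; exact. Qed.

HB.instance Definition _ := isPointed.Build R[i] 0.
HB.instance Definition _ := isMeasurable.Build default_measure_display R[i]
  cmeasurable0 cmeasurableC cmeasurable_bigcup.

End complex_measurable.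

Definition modulus {R : realType} (z : R[i]) : R := ComplexField.Normc.normc z.

Section complex_random_variables.
Context {dO : measure_display} {Omega : measurableType dO} {R : realType}.
Variable P : probability Omega R.

(* N_C(0, s^2): here s^2 is the variance of each of the real and imaginary
   parts, so that E|X|^2 = 2 s^2. *)
Definition complex_normal_pdf (s : R) (z : R[i]) : R :=
  (2 * pi * s ^+ 2)^-1 * expR (- (modulus z ^+ 2 / (2 * s ^+ 2))).

Definition complex_normal (s : R) (X : {RV P >-> R[i]}) : Prop :=
  forall B : set R[i], measurable B ->
    distribution P X B =
    (\int[lebesgue_measure \x lebesgue_measure]_(u in
        [set u : R * R | B (u.1 +i* u.2)%C])
      (complex_normal_pdf s (u.1 +i* u.2)%C)%:E)%E.

Definition independent_RVs (X : nat -> {RV P >-> R[i]}) : Prop :=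
  forall (J : {fset nat}) (B : nat -> set R[i]),
    (forall n, measurable (B n)) ->
    P (\bigcap_(n in [set` J]) X n @^-1` B n) =
    (\prod_(n <- J) P (X n @^-1` B n))%E.

End complex_random_variables.

Section bessel.
Context {R : realType}.
Local Notation mu := (@lebesgue_measure R).

Definition Gamma (x : R) : R :=
  \int[mu]_(t in `]0, +oo[) (t `^ (x - 1) * expR (- t)).

Definition besselJ (nu r : R) : R :=
  (r / 2) `^ nu *
  limn (series (fun k : nat =>
    (-1) ^+ k * (r / 2) ^+ (2 * k)%N / (k`!%:R * Gamma (k%:R + nu + 1)))).

(* The zeros of J_nu on (0, +oo) are isolated and unbounded, so each infimum
   below is attained: it is the least zero greater than the previous one. *)
Fixpoint besselJ_zero (nu : R) (n : nat) : R :=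
  inf [set x | (if n is m.+1 then besselJ_zero nu m else 0) < x
               /\ besselJ nu x = 0].

Definition bessel_order (d : nat) : R := (d%:R - 2) / 2.

Definition bessel_norm (d n : nat) : R :=
  let nu := bessel_order d in
  Num.sqrt (\int[mu]_(r in `[0, 1])
    (`|besselJ nu (besselJ_zero nu n * r)| ^+ 2 * r)).

Definition eigenfun (d n : nat) (r : R) : R :=
  let nu := bessel_order d in
  (bessel_norm d n)^-1 * r `^ (- nu) * besselJ nu (besselJ_zero nu n * r).

End bessel.

(* The measure r^(d-1) dr on [0, 1], seen as a measure on R that vanishes
   outside [0, 1]. *)
Definition radial_measure {R : realType} (d : nat) (A : set R) : \bar R :=
  (\int[lebesgue_measure]_(r in A `&` `[0%R, 1%R]) (r ^+ d.-1)%:E)%E.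

Section radial_measure.
Variables (R : realType) (d : nat).
Local Notation mu := (@lebesgue_measure R).
Local Notation rad := (@radial_measure R d).
Local Open Scope ereal_scope.

Let density_ge0 (A : set R) (r : R) :
  (A `&` `[0%R, 1%R]) r -> 0 <= (r ^+ d.-1)%:E.
Proof. by move=> [_]/=; rewrite in_itv/= lee_fin => /andP[r0 _]; rewrite exprn_ge0. Qed.

Let radial0 : rad set0 = 0.
Proof. by rewrite /radial_measure set0I integral_set0. Qed.

Let radial_ge0 A : 0 <= rad A.
Proof. by apply: integral_ge0 => r; exact: density_ge0. Qed.

Let density_measurable (A : set R) :
  measurable_fun A (fun r : R => (r ^+ d.-1)%:E).
Proof. by apply/measurable_EFinP; exact: measurable_funX. Qed.

Let radial_semi_sigma_additive : semi_sigma_additive rad.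
Proof.
move=> /= A mA tA mUA; rewrite /radial_measure setI_bigcupl.
rewrite ge0_integral_bigcup /=; last 4 first.
- by move=> k; apply: measurableI => //; exact: mA.
- exact: density_measurable.
- by move=> r [i _]; exact: density_ge0.
- exact: trivIset_setIr.
by apply: is_cvg_ereal_nneg_natsum_cond => n _ _; exact: radial_ge0.
Qed.

HB.instance Definition _ := isMeasure.Build _ _ _ rad
  radial0 radial_ge0 radial_semi_sigma_additive.

Let radial_fin : fin_num_fun rad.
Proof.
move=> A mA; rewrite ge0_fin_numE ?radial_ge0//.
have mA01 : measurable (A `&` `[0%R, 1%R]).
  by apply: measurableI => //; exact: mA.
apply: (@le_lt_trans _ _ (\int[mu]_(r in A `&` `[0%R, 1%R]) (cst 1 r))).
  apply: ge0_le_integral => //=.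
  - by move=> r; exact: density_ge0.
  - exact: density_measurable.
  - move=> r [_]/=; rewrite in_itv/= lee_fin => /andP[r0 r1].
    exact: exprn_ile1.
rewrite integral_cst// mul1e (@le_lt_trans _ _ (mu `[0%R, 1%R]))//.
  by rewrite le_measure ?inE//; exact: measurable_itv.
by rewrite lebesgue_measure_itv/= lte01 EFinN sube0 ltry.
Qed.

HB.instance Definition _ := Measure_isFinite.Build _ _ _ rad radial_fin.

End radial_measure.

Section random_series.
Context {dO : measure_display} {Omega : measurableType dO} {R : realType}.
Variables (P : probability Omega R) (d : nat).

Definition partial_sum (g : nat -> Omega -> R[i]) (c : nat -> R) (N : nat)
    (w : Omega) (r : R) : R[i] :=
  \sum_(n < N) g n w * real_complex R (c n * eigenfun d n r).

(* F is a jointly measurable representative of the L^2(P x r^(d-1) dr) class of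
   the sum of the g_n c_n e_(n,d). *)
Definition is_random_series (g : nat -> Omega -> R[i]) (c : nat -> R)
    (F : Omega * R -> R[i]) : Prop :=
  measurable_fun setT F /\
  (fun N => Lnorm (P \x @radial_measure R d)%E 2%:E (fun u =>
     (modulus (F u - partial_sum g c N u.1 u.2))%:E)) @ \oo --> 0%E.

(* The set below always contains 2 when F is the random series of a square
   summable sequence, so the supremum is not affected by sup set0 = -oo. *)
Definition critical_exponent (F : Omega * R -> R[i]) : \bar R :=
  ereal_sup [set p%:E | p in [set p : R | 2 <= p /\
    {ae P, forall w,
      (Lnorm (@radial_measure R d) p%:E (fun r => (modulus (F (w, r)))%:E)
       < +oo)%E}]].

End random_series.

(* Main.v *)
Require Import Defs.
From mathcomp Require Import all_boot all_order all_algebra finmap.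
From mathcomp Require Import complex.
From mathcomp Require Import all_classical all_reals all_analysis measurable_realfun.
From mathcomp Require Import ring lra.

Set Implicit Arguments.
Unset Strict Implicit.
Unset Printing Implicit Defensive.
Import Order.TTheory GRing.Theory Num.Theory.
Import numFieldNormedType.Exports.

Local Open Scope classical_set_scope.
Local Open Scope ring_scope.

(** Write m = d - 2.  Since J_nu (r) = (r/2)^nu phi (r) / Gamma (nu + 1) for the
    normalized radial solution phi of - Delta phi = phi, each eigenfunction is
    e_n (r) = kappa_n phi (z_n r), and everything needed about Bessel functions
    is read off the differential equation of phi: by energy arguments, |phi| <= 1
    and phi >= 1/2 on [0, 1] ([radial_le1], [radial_ge_half]), consecutive zeros
    are at distance at least 1 and at most a constant ([radial_zero_gap],
    [radial_zero_exists]), and r^(d-1) phi^2 is bounded if d >= 3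
    ([radial_decay]).

    Finiteness below 2d/(d-2).  The functions kappa_n phi' (z_n r) are again
    orthonormal for r^(d-1) dr.  As e_n (r) / z_n is minus the integral of
    kappa_n phi' (z_n s) over [r, 1], Bessel's inequality gives
    sum_n (e_n (r) / z_n)^2 <= int_r^1 s^(1-d) ds, and z_n is of order n, so
    sum_n c_n^2 e_n (r)^2 <= C r^(-a) with a arbitrarily close to d - 2
    ([eigenfun_sum_le]).  For fixed r the series is Gaussian with this variance,
    so the expectation of the p-th power of the L^p norm of F is at most
    C int_0^1 r^(-ap/2 + d-1) dr, which is finite if p < 2d/(d-2)
    ([gaussian_series_Lp], [random_series_Lp_lty]).

    Divergence above 2d/(d-2).  Near 0 the eigenfunctions are positive and large:
    on [0, delta] with delta = 1 / z_N, all e_n with n <= N satisfy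
    e_n >= kappa_n / 2, and kappa_n^2 >= c n^(d-1) ([eigenfun_ge_near0]).  If V is
    the mass of [0, delta], of order N^(-d), the integral of the series over
    [0, delta] is a Gaussian variable of standard deviation at least
    sigma = c N^((d-2)/2) V.  On the other hand,
    int_[0, delta] |f| <= lambda V + lambda^(1-p) int |f|^p for every lambda > 0;
    with lambda of order N^((d-2)/2), an a.s. finite L^p norm would confine this
    Gaussian variable to a small multiple of sigma with high probability as soon
    as lambda^p V -> oo, that is p (d-2) / 2 > d.  This contradicts
    [gaussian_sum_anticoncentration] ([gaussian_series_not_Lp],
    [random_series_not_Lp]).

    Gaussian variables enter only through the moment generating functions of
    finite linear combinations ([iid_gaussian]), applied to the real and to the
    imaginary parts; these follow from independence by
    [expectation_prod_independent]. *)

(** * Differentiation and integration on intervals *)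

Section calculus.
Context {R : realType}.
Implicit Types (f df : R -> R) (a b x : R).
Local Notation mu := (@lebesgue_measure R).

(** The derivation rules for functions given as abstractions over a variable:
    [derive_step] selects a rule by matching the body of the abstraction. *)
Lemma is_derive_lam_cst (c x : R) : is_derive x 1 (fun=> c) 0.
Proof. exact: is_derive_cst. Qed.
Lemma is_derive_lam_id (x : R) : is_derive x 1 (fun t => t) 1.
Proof. exact: is_derive_id. Qed.
Lemma is_derive_val_eq (f : R -> R) (x a b : R) : is_derive x 1 f a -> a = b -> is_derive x 1 f b.
Proof. by move=> fa <-. Qed.
Lemma is_derive_lamD (f g : R -> R) (x a b : R) : is_derive x 1 f a -> is_derive x 1 g b ->
  is_derive x 1 (fun t => f t + g t) (a + b).
Proof. by move=> fa gb; exact: is_deriveD. Qed.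
Lemma is_derive_lamN (f : R -> R) (x a : R) : is_derive x 1 f a ->
  is_derive x 1 (fun t => - f t) (- a).
Proof. by move=> fa; exact: is_deriveN. Qed.
Lemma is_derive_lamM (f g : R -> R) (x a b : R) : is_derive x 1 f a -> is_derive x 1 g b ->
  is_derive x 1 (fun t => f t * g t) (f x * b + g x * a).
Proof. by move=> fa gb; exact: is_deriveM. Qed.
Lemma is_derive_lamX (f : R -> R) n (x a : R) : is_derive x 1 f a ->
  is_derive x 1 (fun t => f t ^+ n) (n%:R * f x ^+ n.-1 * a).
Proof.
by move=> fa; have := @is_deriveX R R f n x 1 a fa; rewrite exprfctE.
Qed.
Lemma is_derive_lamV (f : R -> R) (x a : R) : f x != 0 -> is_derive x 1 f a ->
  is_derive x 1 (fun t => (f t)^-1) (- a / f x ^+ 2).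
Proof.
move=> fx fa; have := is_deriveV fx fa.
by rewrite /GRing.scale/= mulNr mulNr mulrC.
Qed.
Lemma is_derive_lam_comp (f g : R -> R) (x a b : R) : is_derive x 1 f a ->
  is_derive (f x) 1 g b -> is_derive x 1 (fun t => g (f t)) (b * a).
Proof. by move=> fa gb; exact: is_derive1_comp. Qed.

Lemma is_derive_continuous f (x a : R) : is_derive x 1 f a ->
  {for x, continuous f}.
Proof. by case=> fx _; apply/differentiable_continuous/derivable1_diffP. Qed.

Lemma is_derive_within_continuous f df a b :
  (forall x, a <= x <= b -> is_derive x 1 f (df x)) ->
  {within `[a, b], continuous f}.
Proof.
move=> fd; apply: derivable_within_continuous => x; rewrite in_itv/= => xab.
by have [] := fd _ xab.
Qed.

Lemma is_derive_ge0_le f df a b : a <= b ->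
  (forall x, a <= x <= b -> is_derive x 1 f (df x)) ->
  (forall x, a <= x <= b -> 0 <= df x) -> f a <= f b.
Proof.
move=> ab fd df0.
have [||c cab E] := @MVT_segment R f df a b ab.
- by move=> x; rewrite in_itv/= => /andP[ax xb]; apply: fd; rewrite !ltW.
- exact: is_derive_within_continuous fd.
by rewrite -subr_ge0 E mulr_ge0 ?subr_ge0// df0// -in_itv.
Qed.

Lemma is_derive_le0_ge f df a b : a <= b ->
  (forall x, a <= x <= b -> is_derive x 1 f (df x)) ->
  (forall x, a <= x <= b -> df x <= 0) -> f b <= f a.
Proof.
move=> ab fd df0; rewrite -lerN2.
apply: (@is_derive_ge0_le (fun x => - f x) (fun x => - df x)) => // x xab.
  by apply: is_deriveN; exact: fd.
by rewrite oppr_ge0 df0.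
Qed.

Lemma continuous_itv_integrable f a b : {within `[a, b], continuous f} ->
  mu.-integrable `[a, b] (EFin \o f).
Proof. by move=> cf; apply: continuous_compact_integrable => //; exact: segment_compact. Qed.

(** The case a = b and one-sided limits at the end points are dealt with here once and
    for all: F is differentiable on both sides of a and b. *)
Lemma Rintegral_FTC2 F f a b : a <= b ->
  (forall x, a <= x <= b -> is_derive x 1 F (f x)) ->
  {within `[a, b], continuous f} ->
  (\int[mu]_(x in `[a, b]) f x)%R = F b - F a.
Proof.
rewrite le_eqVlt => /predU1P[<-|ab] Fd cf.
  by rewrite set_itv1 Rintegral_set1 subrr.
rewrite /Rintegral (@continuous_FTC2 R f F)//.
  split=> /=.
  - by move=> x; rewrite in_itv/= => /andP[ax xb]; have [] := Fd x; rewrite ?ltW.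
  - by have /continuous_within_itvP[] := is_derive_within_continuous Fd.
  - by have /continuous_within_itvP[] := is_derive_within_continuous Fd.
move=> x; rewrite in_itv/= => /andP[ax xb].
have /Fd Fdx : a <= x <= b by rewrite !ltW.
by rewrite derive1E derive_val.
Qed.

Lemma Rintegral_linear a b f g (c e : R) :
  {within `[a, b], continuous f} -> {within `[a, b], continuous g} ->
  (\int[mu]_(x in `[a, b]) (c * f x + e * g x) =
   c * \int[mu]_(x in `[a, b]) f x + e * \int[mu]_(x in `[a, b]) g x)%R.
Proof.
move=> cf cg; have iF := continuous_itv_integrable cf.
have iG := continuous_itv_integrable cg.
rewrite RintegralD//; [|by apply: continuous_itv_integrable => x; apply: cvgMr; exact: cf|by
    apply: continuous_itv_integrable => x; apply: cvgMr; exact: cg].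
by rewrite !RintegralZl.
Qed.

Lemma continuous_sum (I : Type) (s : seq I) (f : I -> R -> R) :
  (forall i, continuous (f i)) -> continuous (fun x => \sum_(i <- s) f i x).
Proof.
move=> cf; elim: s => [|i s IH] x.
  by under eq_fun do rewrite big_nil; exact: cvg_cst.
rewrite (_ : (fun x => _) = (fun x => f i x + \sum_(j <- s) f j x)); last first.
  by apply/funext => y; rewrite big_cons.
by apply: cvgD; [exact: cf|exact: IH].
Qed.

Lemma Rintegral_sum (I : Type) (s : seq I) (f : I -> R -> R) (c : I -> R) a b :
  (forall i, continuous (f i)) ->
  (\int[mu]_(x in `[a, b]) (\sum_(i <- s) c i * f i x) =
   \sum_(i <- s) c i * \int[mu]_(x in `[a, b]) f i x)%R.
Proof.
move=> cf; elim: s => [|i s IH].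
  rewrite big_nil; under eq_Rintegral do rewrite big_nil.
  by rewrite Rintegral_cst// mul0r.
rewrite big_cons; under eq_Rintegral do rewrite big_cons -[X in _ + X]mul1r.
rewrite Rintegral_linear ?IH ?mul1r//; first exact/continuous_subspaceT/cf.
apply: continuous_subspaceT; apply: continuous_sum => j x.
by apply: cvgMr; exact: cf.
Qed.

End calculus.

(** The derivatives of the atomic functions are taken from the context, so they are
    introduced by [have] before each use. *)
Ltac derive_step := match goal with
  | |- _ => eassumption
  | |- is_derive _ _ (fun t => ?c) _ => eapply is_derive_lam_cst
  | |- is_derive _ _ (fun t => t) _ => eapply is_derive_lam_id
  | |- is_derive _ _ (fun t => @?f t + @?g t) _ => eapply (@is_derive_lamD _ f g)
  | |- is_derive _ _ (fun t => - @?f t) _ => eapply (@is_derive_lamN _ f)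
  | |- is_derive _ _ (fun t => @?f t * @?g t) _ => eapply (@is_derive_lamM _ f g)
  | |- is_derive _ _ (fun t => @?f t ^+ ?n) _ => eapply (@is_derive_lamX _ f n)
  | |- is_derive _ _ (fun t => (@?f t)^-1) _ => eapply (@is_derive_lamV _ f)
  | |- is_derive _ _ (fun t => expR (@?f t)) _ =>
       eapply (@is_derive_lam_comp _ f expR); [|eapply is_derive_expR]
  end.
Ltac derive_rules := eapply is_derive_val_eq; [repeat derive_step|cbv beta].

Ltac derive_continuous := eapply is_derive_continuous; repeat derive_step.

(** * The recurrence of the Gamma function *)

Section gamma.
Context {R : realType}.
Implicit Types (x t : R).
Local Notation mu := (@lebesgue_measure R).

Lemma expRN_half_cvg : expR (- (t / 2)) @[t --> +oo] --> (0 : R).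
Proof.
apply: (@cvg_comp _ _ _ (fun t : R => t / 2) (fun t => expR (- t)) _ +oo) => /=.
  by apply: gt0_cvgMly => //; rewrite ?invr_gt0.
exact: cvgr_expR.
Qed.

(** For t >= 1 a single term of the exponential series, of degree above a, suffices. *)
Lemma powR_le_expR (a : R) : 0 <= a ->
  exists2 K : R, 0 < K & forall t, 0 <= t -> t `^ a <= K * expR (t / 2).
Proof.
move=> a0; pose n := Num.bound a.
have an : a <= n%:R by rewrite ltW// archi_boundP.
exists (1 + 2 ^+ n.+1 * n.+1`!%:R) => [|t t0].
  by rewrite ltr_pwDl// mulr_ge0// exprn_ge0.
have e1 : 1 <= expR (t / 2) by rewrite -expR0 ler_expR divr_ge0.
have [t1|t1] := leP t 1.
  rewrite (@le_trans _ _ 1)//.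
    by rewrite -(congr1 (@^~ a) (@powR1 R)) ge0_ler_powR// nnegrE.
  rewrite mulrDl mul1r (le_trans e1)// lerDl.
  by apply: mulr_ge0; [apply: mulr_ge0|exact: expR_ge0]; rewrite ?exprn_ge0.
have := @expR_ge1Dxn R (t / 2) n; rewrite divr_ge0// => /(_ isT) H.
rewrite (@le_trans _ _ (t ^+ n.+1))//.
  rewrite -powR_mulrn// ler_powR ?ltW//.
  by rewrite (lt_le_trans (archi_boundP a0))// ler_nat.
rewrite mulrDl ler_wpDl ?mul1r ?expR_ge0//.
rewrite -mulrA -ler_pdivrMl ?exprn_gt0// mulrC.
rewrite -exprVn -exprMn -ler_pdivrMl ?ltr0n ?fact_gt0// mulrC.
by rewrite (le_trans _ H)// lerDr.
Qed.

Lemma powR_cvg_at_right0 (a : R) : 0 <= a ->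
  t `^ a @[t --> 0^'+] --> (0 : R) `^ a.
Proof.
rewrite le_eqVlt => /predU1P[<-|a0].
  rewrite powRr0; under eq_fun do rewrite powRr0; exact: cvg_cst.
by rewrite powR0 ?gt_eqF//; exact: powR_cvg0.
Qed.

Lemma measurable_gamma_fun (a : R) D : measurable D ->
  measurable_fun D (fun t : R => (t `^ a * expR (- t))%:E).
Proof.
move=> mD; apply/measurable_EFinP; apply: measurable_funM.
  by apply: measurable_funTS; exact: measurable_powR.
apply: measurable_funTS; apply: (measurableT_comp (@measurable_expR R)).
exact: oppr_measurable.
Qed.

Lemma measurable_expRN_half (K : R) D : measurable D ->
  measurable_fun D (fun t : R => (K * expR (- (t / 2)))%:E).
Proof.
move=> mD; apply/measurable_EFinP; apply: measurable_funM => //.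
apply: measurable_funTS; apply: (measurableT_comp (@measurable_expR R)).
apply: (measurableT_comp (@oppr_measurable R setT)).
by apply: measurable_funM.
Qed.

Lemma integral_expRN_half (K : R) : 0 <= K ->
  (\int[mu]_(t in `[0%R, +oo[) (K * expR (- (t / 2)))%:E = (2 * K)%:E)%E.
Proof.
move=> K0; pose F t := - (2 * K * expR (- (t / 2))) : R.
have Fd t : is_derive t 1 F (K * expR (- (t / 2))) by rewrite ?/F; derive_rules; field.
have Fc : continuous F.
  by move=> t; apply/differentiable_continuous/derivable1_diffP; case: (Fd t).
have fc : continuous (fun t => K * expR (- (t / 2))).
  move=> t; apply/differentiable_continuous/derivable1_diffP.
  have [] : is_derive t (1 : R) (fun t => K * expR (- (t / 2)))
    (- (K * expR (- (t / 2))) / 2) by rewrite ?/F; derive_rules; field.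
  by [].
rewrite (@ge0_continuous_FTC2y R _ F 0 0).
- by rewrite /F mul0r oppr0 expR0 mulr1 -EFinB opprK add0r.
- by move=> t _; rewrite mulr_ge0// expR_ge0.
- by apply: continuous_subspaceT; exact: fc.
- rewrite /F -[X in _ --> X]oppr0; apply: cvgN.
  by rewrite -[X in _ --> X](mulr0 (2 * K)); apply: cvgMr; exact: expRN_half_cvg.
- by move=> t _; case: (Fd t).
- by apply: cvg_at_right_filter; exact: Fc.
- by move=> t _; rewrite derive1E; have := Fd t => FD; rewrite derive_val.
Qed.

Lemma gamma_integral_lty (a : R) : 0 <= a ->
  (\int[mu]_(t in `[0%R, +oo[) (t `^ a * expR (- t))%:E < +oo)%E.
Proof.
move=> a0; have [K K0 HK] := powR_le_expR a0.
apply: (@le_lt_trans _ _ (\int[mu]_(t in `[0%R, +oo[) (K * expR (- (t / 2)))%:E)%E); last first.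
  by rewrite integral_expRN_half ?ltry// ltW.
apply: ge0_le_integral => //.
- by move=> t _; rewrite lee_fin mulr_ge0 ?powR_ge0 ?expR_ge0.
- exact: measurable_gamma_fun.
- exact: measurable_expRN_half.
- move=> t /=; rewrite in_itv/= andbT => t0; rewrite lee_fin.
  rewrite (_ : - (t / 2) = t / 2 - t); last by field.
  by rewrite expRD mulrA ler_wpM2r ?expR_ge0// HK.
Qed.

Lemma Gamma_itv_cbnd (x : R) : Gamma x = fine (\int[mu]_(t in `[0%R, +oo[) (t `^ (x - 1) * expR
    (- t))%:E).
Proof.
rewrite /Gamma /Rintegral integral_itv_obnd_cbnd//.
exact: measurable_gamma_fun.
Qed.

Lemma Gamma_gt0 (x : R) : 1 <= x -> 0 < Gamma x.
Proof.
rewrite -subr_ge0 => x1; rewrite Gamma_itv_cbnd fine_gt0//.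
rewrite gamma_integral_lty// andbT.
apply: (@lt_le_trans _ _ (\int[mu]_(t in `[1%R, 2%R]) (cst (expR (-2))%:E t))%E).
  rewrite integral_cst//= lebesgue_measure_itv/= lte_fin ltr1n.
  by rewrite -EFinB -EFinM lte_fin mulr_gt0 ?expR_gt0// subr_gt0 ltr1n.
apply: (@le_trans _ _ (\int[mu]_(t in `[1%R, 2%R]) (t `^ (x - 1) * expR (- t))%:E)%E).
  apply: ge0_le_integral => //.
  - by move=> t _; rewrite lee_fin expR_ge0.
  - exact: measurable_gamma_fun.
  - move=> t /=; rewrite in_itv/= => /andP[t1 t2]; rewrite lee_fin.
    rewrite -[leLHS]mul1r; apply: ler_pM; rewrite ?expR_ge0//.
      by rewrite -[leLHS](powRr0 t) ler_powR.
    by rewrite ler_expR lerN2.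
apply: ge0_subset_integral => //.
- exact: measurable_gamma_fun.
- by move=> t _; rewrite lee_fin mulr_ge0 ?powR_ge0 ?expR_ge0.
- by move=> t /=; rewrite !in_itv/= andbT => /andP[t1 _]; rewrite (le_trans _ t1).
Qed.

(** The derivative of t^x e^-t has no constant sign on (0, +oo); adding K e^(-t/2), where
    K comes from [powR_le_expR], makes every integrand nonnegative, so that improper
    integrals reduce to Lebesgue integrals. *)
Lemma Gamma_rec (x : R) : 1 <= x -> Gamma (x + 1) = x * Gamma x.
Proof.
move=> x1; have x0 : 0 < x by exact: lt_le_trans x1.
have x10 : 0 <= x - 1 by rewrite subr_ge0.
have [K K0 HK] := powR_le_expR x10.
have HK' t : 0 <= t -> x * (t `^ (x - 1) * expR (- t)) <= x * K * expR (- (t / 2)).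
  move=> t0; rewrite -mulrA; apply: ler_wpM2l; first exact: ltW.
  rewrite (_ : - (t / 2) = t / 2 - t); last by field.
  by rewrite expRD mulrA ler_wpM2r ?expR_ge0// HK.
pose f t := t `^ x * expR (- t) + x * K * expR (- (t / 2))
  - x * (t `^ (x - 1) * expR (- t)).
pose F t := - (t `^ x * expR (- t)) - 2 * (x * K) * expR (- (t / 2)).
have Fd t : 0 < t -> is_derive t 1 F (f t).
  move=> t0; have pd := @is_derive1_powR R x t t0.
  by rewrite /F /f; derive_rules; field.
have fd t : 0 < t -> {for t, continuous f}.
  move=> t0; apply/differentiable_continuous/derivable1_diffP.
  have pd := @is_derive1_powR R x t t0.
  have pd' := @is_derive1_powR R (x - 1) t t0.
  suff [] : is_derive t (1 : R) f (t `^ x * (expR (- t) * -1) +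
    x * K * (expR (- (t / 2)) * (- 2^-1)) +
    expR (- t) * (x * t `^ (x - 1)) - x * (t `^ (x - 1) * (expR (- t) * -1) +
     expR (- t) * ((x - 1) * t `^ (x - 1 - 1)))) by [].
  by rewrite /f; derive_rules; field.
have rexp (c : R) : expR (- (c * t)) @[t --> 0^'+] --> (expR (- (c * 0)) : R).
  apply: cvg_at_right_filter.
  apply: (@is_derive_continuous _ (fun t => expR (- (c * t))) 0 (- c)).
  by derive_rules; rewrite mulr0 oppr0 expR0; ring.
have rexp1 : expR (- t) @[t --> 0^'+] --> (expR (- 0) : R).
  by have := rexp 1; rewrite mul1r; under eq_fun do rewrite mul1r.
have rexp2 : expR (- (t / 2)) @[t --> 0^'+] --> (expR (- (0 / 2)) : R).
  by have := rexp 2^-1; rewrite mulrC; under eq_fun do rewrite mulrC.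
have Iff : (\int[mu]_(t in `[0%R, +oo[) (f t)%:E = (2 * (x * K))%:E)%E.
  rewrite (@ge0_continuous_FTC2y R f F 0 0).
  - rewrite -EFinB /F powR0 ?gt_eqF// !mul0r !oppr0 expR0 mulr1; congr _%:E; ring.
  - move=> t t0; rewrite /f subr_ge0; apply: le_trans (HK' _ t0) _.
    by rewrite lerDr mulr_ge0 ?powR_ge0 ?expR_ge0.
  - apply/continuous_within_itvcyP; split.
      by move=> t; rewrite in_itv/= andbT; exact: fd.
    apply: cvgB; first apply: cvgD.
    + by apply: cvgM; [exact: powR_cvg_at_right0 (ltW x0)|exact: rexp1].
    + by apply: cvgMr; exact: rexp2.
    + apply: cvgMr; apply: cvgM; [exact: powR_cvg_at_right0 x10|exact: rexp1].
  - rewrite /F (_ : 0 = - 0 - (2 * (x * K)) * 0); last by rewrite mulr0 subr0 oppr0.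
    apply: cvgB; last by apply: cvgMr; exact: expRN_half_cvg.
    apply: cvgN; have [K' K'0 HK2] := powR_le_expR (ltW x0).
    apply: (@squeeze_cvgr _ _ _ _ (cst 0) (fun t => K' * expR (- (t / 2)))).
    + near=> t; rewrite mulr_ge0 ?powR_ge0 ?expR_ge0//=.
      rewrite (_ : - (t / 2) = t / 2 - t); last by field.
      by rewrite expRD mulrA ler_wpM2r ?expR_ge0// HK2.
    + exact: cvg_cst.
    + by rewrite -[X in _ --> X](mulr0 K'); apply: cvgMr; exact: expRN_half_cvg.
  - by move=> t t0; have [] := Fd _ t0.
  - apply: cvgB; first apply: cvgN.
    + by apply: cvgM; [exact: powR_cvg_at_right0 (ltW x0)|exact: rexp1].
    + by apply: cvgMr; exact: rexp2.
  - move=> t; rewrite in_itv/= andbT => t0; have Fdt := Fd _ t0.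
    by rewrite derive1E derive_val.
have f_ge0 t : 0 <= t -> 0 <= f t.
  move=> t0; rewrite /f subr_ge0; apply: le_trans (HK' _ t0) _.
  by rewrite lerDr mulr_ge0 ?powR_ge0 ?expR_ge0.
have mf0 : measurable_fun (`[0%R, +oo[ : set R) (fun t : R => (t `^ (x - 1) * expR (- t))%:E).
  exact: measurable_gamma_fun.
have mf1 : measurable_fun (`[0%R, +oo[ : set R) (fun t : R => (t `^ x * expR (- t))%:E).
  exact: measurable_gamma_fun.
have mf2 : measurable_fun (`[0%R, +oo[ : set R) (fun t : R => (x * K * expR (- (t / 2)))%:E).
  exact: measurable_expRN_half.
have mf3 : measurable_fun (`[0%R, +oo[ : set R) (fun t : R => (x * (t `^ (x - 1) * expR (- t)))%:E).
  by apply/measurable_EFinP; apply: measurable_funM => //; exact/measurable_EFinP.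
have mff : measurable_fun (`[0%R, +oo[ : set R) (fun t : R => (f t)%:E).
  apply/measurable_EFinP; rewrite /f.
  apply: measurable_funB; last exact/measurable_EFinP.
  by apply: measurable_funD; exact/measurable_EFinP.
have E : (\int[mu]_(t in `[0%R, +oo[) ((t `^ x * expR (- t))%:E + (x * K * expR (- (t / 2)))%:E)
   = \int[mu]_(t in `[0%R, +oo[) ((f t)%:E + (x * (t `^ (x - 1) * expR (- t)))%:E))%E.
  by apply: eq_integral => t _; rewrite -!EFinD /f subrK.
move: E; rewrite ge0_integralD//; last 2 first.
- by move=> t _; rewrite lee_fin mulr_ge0 ?powR_ge0 ?expR_ge0.
- by move=> t _; rewrite lee_fin !mulr_ge0 ?expR_ge0// ltW.
rewrite ge0_integralD//; last 2 first.
- by move=> t; rewrite /= in_itv/= andbT lee_fin; exact: f_ge0.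
- by move=> t _; rewrite lee_fin !mulr_ge0 ?powR_ge0 ?expR_ge0// ltW.
rewrite Iff integral_expRN_half; last by rewrite mulr_ge0// ltW.
under [in X in _ = X -> _]eq_integral do rewrite EFinM.
rewrite ge0_integralZl//; last 2 first.
- by move=> t _; rewrite lee_fin !mulr_ge0 ?powR_ge0 ?expR_ge0.
- by rewrite lee_fin ltW.
rewrite !Gamma_itv_cbnd addrK.
have fin1 : (\int[mu]_(t in `[0%R, +oo[) (t `^ x * expR (- t))%:E)%E \is a fin_num.
  rewrite ge0_fin_numE; first exact: (gamma_integral_lty (ltW x0)).
  by apply: integral_ge0 => t _; rewrite lee_fin mulr_ge0 ?powR_ge0 ?expR_ge0.
have fin0 : (\int[mu]_(t in `[0%R, +oo[) (t `^ (x - 1) * expR (- t))%:E)%E \is a fin_num.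
  rewrite ge0_fin_numE; first exact: (gamma_integral_lty x10).
  by apply: integral_ge0 => t _; rewrite lee_fin mulr_ge0 ?powR_ge0 ?expR_ge0.
rewrite -(fineK fin1) -(fineK fin0) -!EFinM -!EFinD => -[] E.
by rewrite !fineK//; lra.
Unshelve. all: by end_near. Qed.

End gamma.

(** * The Bessel series and the radial Helmholtz equation *)

(** phi is the normalized radial solution of - Delta phi = phi in dimension d,
    and chi stands for - phi' / r, so that no division by r occurs at 0. *)
Definition radial_solution {R : realType} (d : nat) (phi chi : R -> R) :=
  [/\ phi 0 = 1,
      forall r : R, is_derive r (1 : R) phi (- (r * chi r)) &
      forall r : R, is_derive r (1 : R) (fun r => r * chi r)
        (phi r - d.-1%:R * chi r)].

Section bessel_power_series.
Context {R : realType}.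
Implicit Types (nu x y r : R).

(** The coefficients of (r/2)^(-nu) J_nu (r) as a power series in y = r^2. *)
Definition bessel_coef nu (k : nat) : R :=
  (-1) ^+ k / (4 ^+ k * k`!%:R * Gamma (k%:R + nu + 1)).

Definition bessel_series nu y : R := limn (pseries (bessel_coef nu) y).

Lemma Gamma_step (k : nat) nu : 0 <= nu ->
  Gamma (k.+1%:R + nu + 1) = (k%:R + nu + 1) * Gamma (k%:R + nu + 1).
Proof.
move=> nu0; rewrite -Gamma_rec.
  by congr Gamma; rewrite -natr1; ring.
by rewrite lerDr addr_ge0.
Qed.

Lemma Gamma_nat_gt0 (k : nat) nu : 0 <= nu -> 0 < Gamma (k%:R + nu + 1) :> R.
Proof. by move=> nu0; rewrite Gamma_gt0// lerDr addr_ge0. Qed.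

Lemma Gamma_nat_ge (k : nat) nu : 0 <= nu -> Gamma (nu + 1) <= Gamma (k%:R + nu + 1) :> R.
Proof.
move=> nu0; elim: k => [|k IH]; first by rewrite add0r.
rewrite Gamma_step// (le_trans IH)// ler_peMl//.
  by rewrite ltW// Gamma_nat_gt0.
by rewrite lerDr addr_ge0.
Qed.

Lemma bessel_coef_cvg nu y : 0 <= nu -> cvgn (pseries (bessel_coef nu) y).
Proof.
move=> nu0; apply: normed_cvg.
pose G : R := Gamma (nu + 1); have G0 : 0 < G.
  by rewrite /G -[nu]add0r; exact: (Gamma_nat_gt0 0).
apply: (@series_le_cvg _ _ (fun k => G^-1 * exp_coeff (`|y|) k)).
- by move=> k; exact: normr_ge0.
- by move=> k; rewrite mulr_ge0 ?invr_ge0 ?(ltW G0)// /exp_coeff divr_ge0 ?exprn_ge0.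
- move=> k; rewrite /bessel_coef /exp_coeff /= !normrM normfV normrX normrN1 expr1n mul1r normrX.
  have D0 : 0 < 4 ^+ k * k`!%:R * Gamma (k%:R + nu + 1) :> R.
    by rewrite !mulr_gt0 ?exprn_gt0 ?ltr0n ?fact_gt0 ?Gamma_nat_gt0.
  rewrite (gtr0_norm D0).
  rewrite mulrC [leRHS]mulrCA; apply: ler_wpM2l; first exact: exprn_ge0.
  have f0 : 0 < k`!%:R :> R by rewrite ltr0n fact_gt0.
  rewrite -invfM lef_pV2 ?posrE ?(mulr_gt0 G0 f0)// [leLHS]mulrC.
  have h : 1 <= 4 ^+ k :> R by apply: exprn_ege1; rewrite ler1n.
  rewrite -mulrA mulrCA; apply: ler_wpM2l; first exact: ltW.
  have := @Gamma_nat_ge k nu nu0; rewrite -/G; nra.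
- by apply: is_cvg_seriesZ; exact: is_cvg_series_exp_coeff.
Qed.

Lemma bessel_coef_diffs nu : 0 <= nu ->
  pseries_diffs (bessel_coef nu) = (fun k => - 4^-1 * bessel_coef (nu + 1) k).
Proof.
move=> nu0; apply/funext => k; rewrite /pseries_diffs /bessel_coef factS natrM !exprS.
rewrite (_ : k.+1%:R + nu + 1 = k%:R + (nu + 1) + 1); last by rewrite -natr1; ring.
have G := @Gamma_nat_gt0 k (nu + 1); have /G {}G : 0 <= nu + 1 by rewrite addr_ge0.
field.
by rewrite !gt_eqF ?exprn_gt0 ?ltr0n ?fact_gt0// lt0r.
Qed.

Lemma bessel_coef_shift nu k : 0 <= nu ->
  bessel_coef nu k = k%:R * bessel_coef (nu + 1) k + (nu + 1) * bessel_coef (nu + 1) k.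
Proof.
move=> nu0; rewrite /bessel_coef.
have -> : k%:R + (nu + 1) + 1 = k.+1%:R + nu + 1 :> R by rewrite -natr1; ring.
rewrite Gamma_step//; have G := @Gamma_nat_gt0 k nu nu0.
field; rewrite !gt_eqF ?exprn_gt0 ?ltr0n ?fact_gt0//.
by rewrite ltr_wpDl// addr_ge0.
Qed.

Lemma bessel_series_diffs nu y : 0 <= nu ->
  limn (pseries (pseries_diffs (bessel_coef nu)) y) = - 4^-1 * bessel_series (nu + 1) y.
Proof.
move=> nu0; rewrite bessel_coef_diffs// /bessel_series; apply/cvg_lim => //.
rewrite (_ : pseries _ _ = (fun n => - 4^-1 * pseries (bessel_coef (nu + 1)) y n)).
  by apply: cvgMr; apply: bessel_coef_cvg; rewrite addr_ge0.
by apply/funext => n; rewrite /pseries /series/= mulr_sumr; apply: eq_bigr => k _; ring.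
Qed.

Lemma bessel_coef_diffs_cvg nu y : 0 <= nu ->
  cvgn (pseries (pseries_diffs (bessel_coef nu)) y).
Proof.
move=> nu0; rewrite bessel_coef_diffs//.
rewrite (_ : pseries _ _ = (fun n => - 4^-1 * pseries (bessel_coef (nu + 1)) y n)).
  by apply: is_cvgMr; apply: bessel_coef_cvg; rewrite addr_ge0.
by apply/funext => n; rewrite /pseries /series/= mulr_sumr; apply: eq_bigr => k _; ring.
Qed.

Lemma bessel_series_derive nu y : 0 <= nu ->
  is_derive y (1 : R) (bessel_series nu) (- 4^-1 * bessel_series (nu + 1) y).
Proof.
move=> nu0; rewrite -bessel_series_diffs//.
apply: (@pseries_snd_diffs _ _ (`|y| + 1)).
- exact: bessel_coef_cvg.
- exact: bessel_coef_diffs_cvg.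
- rewrite bessel_coef_diffs//.
  rewrite (_ : pseries _ _ = (fun n => - 4^-1 * pseries (pseries_diffs (bessel_coef (nu + 1)))
      (`|y| + 1) n)).
    by apply: is_cvgMr; apply: bessel_coef_diffs_cvg; rewrite addr_ge0.
  apply/funext => n; rewrite /pseries /series/= mulr_sumr; apply: eq_bigr => k _.
  by rewrite /pseries_diffs; ring.
- by rewrite [ltRHS]ger0_norm ?addr_ge0// ltrDl.
Qed.

(** Together with [bessel_series_derive] this is the identity
    (y^(nu+1) B_(nu+1))' = y^nu B_nu, which holds term by term and turns into the
    equation of the flux r^(d-1) phi'. *)
Lemma bessel_series_rec nu y : 0 <= nu ->
  bessel_series nu y = y * (- 4^-1 * bessel_series (nu + 1 + 1) y) + (nu + 1) * bessel_series (nu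
      + 1) y.
Proof.
move=> nu0; have nu1 : 0 <= nu + 1 by rewrite addr_ge0.
rewrite -bessel_series_diffs// {1}/bessel_series; apply/cvg_lim => //.
rewrite (_ : pseries _ _ = (fun n => y * series (fun k => k%:R * bessel_coef (nu + 1) k * y ^+
    k.-1) n
   + (nu + 1) * pseries (bessel_coef (nu + 1)) y n)).
  apply: cvgD; apply: cvgMr; last exact: bessel_coef_cvg.
  by apply: pseries_diffs_equiv; exact: bessel_coef_diffs_cvg.
apply/funext => n; rewrite /pseries /series/= !mulr_sumr -big_split/=.
apply: eq_bigr => k _; rewrite (bessel_coef_shift _ nu0).
case: k => [|k]; first by rewrite !mul0r !mulr0 !add0r mulrA.
by rewrite exprS /=; ring.
Qed.

Lemma besselJE nu r : 0 <= nu -> besselJ nu r = (r / 2) `^ nu * bessel_series nu (r ^+ 2).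
Proof.
move=> nu0; rewrite /besselJ /bessel_series.
rewrite (_ : series _ = pseries (bessel_coef nu) (r ^+ 2))//.
apply/funext => n; rewrite /pseries /series/=; apply: eq_bigr => k _.
have -> : (r / 2) ^+ (2 * k) = (r ^+ 2) ^+ k * (4 ^+ k)^-1.
  by rewrite exprM !expr_div_n (_ : 2 ^+ 2 = 4 :> R)// -natrX.
by rewrite /bessel_coef -mulrA invfM; rewrite [in RHS]invfM [in RHS]invfM; ring.
Qed.

(** The function phi is the Bessel series multiplied by Gamma (nu + 1), chi is half of
    the series of index nu + 1 with the same factor, and K = 1 / Gamma (nu + 1). *)
Lemma besselJ_radial (d : nat) : (2 <= d)%N ->
  exists phi chi (K : R), [/\ radial_solution d phi chi, 0 < K &
    forall r, besselJ (bessel_order d) r = (r / 2) `^ (bessel_order d) * (K * phi r)].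
Proof.
move=> d2; have : 0 <= bessel_order d :> R.
  by rewrite /bessel_order divr_ge0// subr_ge0 ler_nat.
have : d.-1%:R = 2 * bessel_order d + 1 :> R.
  rewrite /bessel_order -subn1 natrB; last by rewrite (leq_trans _ d2).
  by field.
move: (bessel_order d) => nu dE nu0.
have nu1 : 0 <= nu + 1 by rewrite addr_ge0.
have [G GE] : exists G : R, G = Gamma (nu + 1) by exists (Gamma (nu + 1)).
have G0 : 0 < G by rewrite GE -[nu]add0r; exact: (Gamma_nat_gt0 0).
exists (fun r => G * bessel_series nu (r ^+ 2)), (fun r => G / 2 * bessel_series (nu + 1) (r ^+
    2)), G^-1.
have B (n : R) r : 0 <= n -> is_derive r (1 : R) (fun t => bessel_series n (t ^+ 2))
    (- 4^-1 * bessel_series (n + 1) (r ^+ 2) * (2 * r)).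
  move=> n0; eapply (@is_derive_lam_comp _ (fun t => t ^+ 2) (bessel_series n)).
    by derive_rules; rewrite expr1; ring.
  exact: bessel_series_derive.
split; last 2 first.
- by rewrite invr_gt0.
- by move=> r; rewrite besselJE// mulKf// gt_eqF.
split.
- rewrite expr0n/= /bessel_series (_ : limn _ = G^-1) ?divff ?gt_eqF//.
  apply/cvg_lim => //; apply: cvg_near_cst; near=> n.
  have n0 : (0 < n)%N by near: n; exists 1%N.
  rewrite /pseries /series/= -(prednK n0) big_nat_recl// big1 ?addr0.
    by rewrite /bessel_coef !expr0 add0r -GE (_ : (0%N)`! = 1%N)// !mul1r mulr1.
  by move=> k _; rewrite exprS mul0r mulr0.
- move=> r; have Br := B nu r nu0; derive_rules.
  by move: (bessel_series nu _) (bessel_series (nu + 1) _) => u v; field.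
- move=> r; have Br := B (nu + 1) r nu1; derive_rules; rewrite dE (@bessel_series_rec nu (r ^+
    2))//.
  by move: (bessel_series (nu + 1) _) (bessel_series (nu + 1 + 1) _) => u v; field.
Unshelve. all: by end_near. Qed.

End bessel_power_series.

(** * Zeros and decay of radial solutions *)

Section radial_solution.
Context {R : realType}.
Variables (m : nat) (phi chi : R -> R).
Hypothesis sol : radial_solution m.+2 phi chi.

Let phi0 : phi 0 = 1. Proof. by case: sol. Qed.
Let dphi (r : R) : is_derive r (1 : R) phi (- (r * chi r)).
Proof. by case: sol. Qed.
Let dpsi (r : R) : is_derive r (1 : R) (fun r => r * chi r) (phi r - m.+1%:R * chi r).
Proof. by case: sol. Qed.

(** The term (d - 1) phi' / r of the equation acts as a friction, so the energy
    phi^2 + phi'^2 does not increase. *)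
Lemma radial_energy_le1 (r : R) : 0 <= r -> phi r ^+ 2 + (r * chi r) ^+ 2 <= 1.
Proof.
move=> r0; have -> : 1 = phi 0 ^+ 2 + (0 * chi 0) ^+ 2 :> R.
  by rewrite phi0 mul0r expr1n expr0n addr0.
apply: (@is_derive_le0_ge _ (fun t => phi t ^+ 2 + (t * chi t) ^+ 2)
  (fun t => - (2 * m.+1%:R * t * chi t ^+ 2))) => // t.
  move=> _; have d1 := dphi t; have d2 := dpsi t.
  eapply is_derive_val_eq; first by eapply is_derive_lamD; eapply is_derive_lamX; eassumption.
  by rewrite !expr1; ring.
by move=> /andP[t0 _]; rewrite oppr_le0; apply: mulr_ge0; rewrite ?sqr_ge0// !mulr_ge0.
Qed.

Lemma radial_sqr_le1 (r : R) : 0 <= r -> phi r ^+ 2 <= 1.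
Proof. by move=> /radial_energy_le1; apply: le_trans; rewrite lerDl sqr_ge0. Qed.

Lemma radial_le1 (r : R) : 0 <= r -> phi r <= 1.
Proof. by move=> /radial_sqr_le1; rewrite -ler_sqrt// ?sqrtr1 ?sqrtr_sqr//; apply: le_trans;
    exact: ler_norm. Qed.

(** Since phi <= 1, integrating (r^(d-1) phi')' = - r^(d-1) phi gives - phi' <= r. *)
Lemma radial_flux_le (r : R) : 0 < r -> r * chi r <= r.
Proof.
move=> r0; rewrite -(@ler_pM2l _ (r ^+ m.+1)) ?exprn_gt0// -subr_ge0.
have := @is_derive_ge0_le _ (fun t => t ^+ m.+1 * t - t ^+ m.+1 * (t * chi t))
  (fun t => t ^+ m.+1 * (1 - phi t) + m.+1%:R * t ^+ m.+1) 0 r (ltW r0).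
rewrite !mul0r !mulr0 subr0; apply.
  move=> t _; have d2 := dpsi t; derive_rules.
  by rewrite exprS; ring.
move=> t /andP[t0 _].
by rewrite addr_ge0// mulr_ge0 ?exprn_ge0// subr_ge0 radial_le1.
Qed.

Lemma radial_ge (r : R) : 0 <= r -> 1 - r ^+ 2 / 2 <= phi r.
Proof.
move=> r0; rewrite lerBlDr.
have := @is_derive_ge0_le _ (fun t => phi t + t ^+ 2 / 2)
  (fun t => t - t * chi t) 0 r r0.
rewrite phi0 expr0n mul0r addr0; apply.
  by move=> t _; have d1 := dphi t; derive_rules; rewrite expr1; field.
move=> t /andP[+ _]; rewrite le_eqVlt => /predU1P[<-|t0].
  by rewrite mul0r subr0.
by rewrite subr_ge0 radial_flux_le.
Qed.

Lemma radial_ge_half (r : R) : 0 <= r <= 1 -> 2^-1 <= phi r.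
Proof.
move=> /andP[r0 r1]; apply: le_trans (radial_ge r0).
have h : r ^+ 2 <= 1 by rewrite expr_le1.
lra.
Qed.

Lemma radial_zero_ge1 (r : R) : 0 < r -> phi r = 0 -> 1 <= r.
Proof.
move=> r0 z; rewrite leNgt; apply/negP => r1.
have h : 0 <= r <= 1 by rewrite !ltW.
have := radial_ge_half h; rewrite z; lra.
Qed.

(** The friction cannot decrease the energy faster than r^(-2(d-1)), so phi and its
    derivative do not vanish together. *)
Lemma radial_energy_gt0 (r : R) : 1 <= r -> 0 < phi r ^+ 2 + (r * chi r) ^+ 2.
Proof.
move=> r1; have r0 : 0 < r by exact: lt_le_trans r1.
pose f (t : R) := t ^+ (m.*2.+2) * (phi t ^+ 2 + (t * chi t) ^+ 2).
have h : f 1 <= f r.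
  apply: (@is_derive_ge0_le _ f (fun t => 2 * m.+1%:R * t ^+ (m.*2.+1) * phi t ^+ 2)) => // t
      /andP[t1 _].
    have d1 := dphi t; have d2 := dpsi t; rewrite /f.
    eapply is_derive_val_eq; first by eapply is_derive_lamM; [derive_step; eapply
        is_derive_lam_id|eapply is_derive_lamD; eapply is_derive_lamX; eassumption].
    have -> : (m.*2.+2)%:R = 2 * m.+1%:R :> R by rewrite -doubleS -mul2n natrM.
    by rewrite !expr1 exprS /=; ring.
  by apply: mulr_ge0; rewrite ?sqr_ge0// mulr_ge0// exprn_ge0// (le_trans _ t1).
have f1 : 0 < f 1.
  rewrite /f expr1n mul1r ltr_pwDl ?sqr_ge0// exprn_gt0//.
  by rewrite (lt_le_trans _ (@radial_ge_half 1 _))// ler01 lexx.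
by have := lt_le_trans f1 h; rewrite /f pmulr_rgt0// exprn_gt0.
Qed.

(** Let p be a maximum point of |phi| between the zeros.  Since phi' (p) = 0 and
    |phi| <= |phi (p)|, the equation keeps phi (p) phi (r) above
    phi (p)^2 (1 - (r - p)^2 / 2) for r >= p, so the second zero lies at distance at
    least sqrt 2 from p. *)
Lemma radial_zero_gap (a b : R) : 0 < a -> a < b -> phi a = 0 -> phi b = 0 -> a + 1 <= b.
Proof.
move=> a0 ab pa pb; have a1 := radial_zero_ge1 a0 pa.
have dsq t : is_derive t (1 : R) (fun t => phi t ^+ 2) (2 * phi t * - (t * chi t)).
  have d1 := dphi t; eapply is_derive_val_eq; first by eapply is_derive_lamX; exact: d1.
  by rewrite expr1.
have [p pab pmax] := @EVT_max R (fun t => phi t ^+ 2) a b (ltW ab)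
  (@is_derive_within_continuous _ _ _ _ _ (fun t _ => dsq t)).
have [|||c cab dc] := @Rolle R phi a b ab.
- by move=> x _; have [] := dphi x.
- exact: (@is_derive_within_continuous _ _ _ _ _ (fun t _ => dphi t)).
- by rewrite pa pb.
have cc : c * chi c = 0.
  have /(@derive_val _ _ _ _ _ _ _) e1 := dphi c.
  have /(@derive_val _ _ _ _ _ _ _) e2 := dc.
  by apply/eqP; rewrite -oppr_eq0 -e1 e2.
have [ac cb] : a < c /\ c < b by move: cab; rewrite in_itv/= => /andP.
have pc : 0 < phi c ^+ 2.
  by have := @radial_energy_gt0 c; rewrite cc expr0n addr0; apply; rewrite (le_trans a1)// ltW.
have pp : 0 < phi p ^+ 2.
  by apply: lt_le_trans pc _; apply: pmax; rewrite in_itv/= !ltW.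
have pN0 : phi p != 0 by rewrite -sqrf_eq0 gt_eqF.
have [pa' pb'] : a < p /\ p < b.
  move: pab; rewrite in_itv/= => /andP[ap pb'].
  split; rewrite lt_neqAle ?ap ?pb' andbT; apply/eqP => e.
    by move: pN0; rewrite -e pa eqxx.
  by move: pN0; rewrite e pb eqxx.
have p0 : 0 < p by exact: lt_trans pa'.
have pchi : p * chi p = 0.
  have dp : is_derive p (1 : R) (fun t => phi t ^+ 2) 0.
    apply: (@derive1_at_max _ _ a b p (ltW ab)).
    - by move=> t _; have [] := dsq t.
    - by rewrite in_itv/= pa' pb'.
    - by move=> t; rewrite in_itv/= => /andP[t1 t2]; apply: pmax; rewrite in_itv/= !ltW.
  have /(@derive_val _ _ _ _ _ _ _) e1 := dsq p.
  have /(@derive_val _ _ _ _ _ _ _) e2 := dp.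
  have h : 2 * phi p != 0 by rewrite mulf_neq0.
  by apply/eqP; rewrite -oppr_eq0 -(mulrI_eq0 _ (mulfI h)) -e1 e2.
have [M ME] : exists M, M = phi p ^+ 2 by exists (phi p ^+ 2).
rewrite -ME in pp.
have psi_le r : p <= r <= b -> phi p * (r * chi r) <= M * (r - p).
  move=> /andP[pr rb].
  have r0 : 0 < r by exact: lt_le_trans pr.
  rewrite -(@ler_pM2l _ (r ^+ m.+1)) ?exprn_gt0// -subr_ge0.
  have := @is_derive_ge0_le _ (fun t => t ^+ m.+1 * (M * (t - p)) - t ^+ m.+1 * (phi p * (t * chi
      t)))
    (fun t => t ^+ m.+1 * (M - phi p * phi t) + m.+1%:R * t ^+ m * (M * (t - p))) p r pr.
  rewrite pchi subrr !mulr0 subrr; apply.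
    move=> t _; have d2 := dpsi t; derive_rules.
    by rewrite exprS; ring.
  move=> t /andP[pt tr]; have t0 : 0 <= t by rewrite (le_trans (ltW p0)).
  have M0 : 0 <= M by exact: ltW.
  apply: addr_ge0; last first.
    by apply: mulr_ge0; apply: mulr_ge0; rewrite ?exprn_ge0 ?subr_ge0.
  apply: mulr_ge0; first exact: exprn_ge0.
  have : phi t ^+ 2 <= M.
    by rewrite ME; apply: pmax; rewrite in_itv/= (le_trans tr rb) (le_trans (ltW pa') pt).
  by move: M0; rewrite ME; nra.
have : M - M * (b - p) ^+ 2 / 2 <= phi p * phi b.
  rewrite lerBlDr.
  have := @is_derive_ge0_le _ (fun t => phi p * phi t + M * (t - p) ^+ 2 / 2)
    (fun t => M * (t - p) - phi p * (t * chi t)) p b (ltW pb').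
  rewrite subrr expr0n mulr0 mul0r addr0 -expr2 -ME; apply.
    move=> u _; have d1 := dphi u; derive_rules.
    by rewrite expr1; field.
  by move=> u upb; rewrite subr_ge0 psi_le.
rewrite pb mulr0 => h.
have : 2 <= (b - p) ^+ 2.
  by rewrite -(@ler_pM2l _ M)//; lra.
by move=> h2; rewrite leNgt; apply/negP => h3; nra.
Qed.

(** Write k = (d - 1) / 2.  The function w = r^k phi satisfies
    w'' + (1 - k (k - 1) / r^2) w = 0, and its logarithmic derivative rho = w' / w
    satisfies a Riccati equation which makes atan (2 rho) decrease at rate at least 1/2
    for r >= d wherever phi does not vanish.  On an interval of length 2 pi it would
    decrease by pi, the length of the open range of atan. *)
Lemma radial_zero_exists (a : R) : m.+2%:R <= a ->
  exists2 z, a <= z <= a + 2 * pi & phi z = 0.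
Proof.
move=> ma; apply: contrapT => nz.
have pN0 t : a <= t <= a + 2 * pi -> phi t != 0.
  by move=> ta; apply/eqP => pt; apply: nz; exists t.
have a0 : 0 < a by apply: lt_le_trans ma.
have pi0 : 0 < pi :> R by exact: pi_gt0.
pose k : R := m.+1%:R / 2.
pose rho (t : R) := - (t * chi t) * (phi t)^-1 + k * t^-1.
have drho t : a <= t <= a + 2 * pi ->
    is_derive t (1 : R) rho (- 1 - rho t ^+ 2 + (k ^+ 2 - k) / t ^+ 2).
  move=> ta; have pt := pN0 _ ta; have t0 : t != 0.
    by move: ta => /andP[/(lt_le_trans a0)]; rewrite lt0r => /andP[].
  have d1 := dphi t; have d2 := dpsi t; rewrite /rho; derive_rules => //.
  by rewrite /k; field; rewrite t0 pt.
pose T (t : R) := atan (2 * rho t) + t / 2.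
have : T (a + 2 * pi) <= T a.
  apply: (@is_derive_le0_ge _ T (fun t => (1 + (2 * rho t) ^+ 2)^-1 *
    (2 * (- 1 - rho t ^+ 2 + (k ^+ 2 - k) / t ^+ 2)) + 2^-1)).
  - by rewrite lerDl mulr_ge0// ltW.
  - move=> t ta; have dr := drho _ ta; rewrite /T.
    eapply is_derive_val_eq.
      eapply is_derive_lamD; last by derive_step; [derive_step|derive_step].
      eapply (@is_derive_lam_comp _ (fun t => 2 * rho t) atan); last exact: is_derive1_atan.
      by eapply is_derive_lamM; [exact: is_derive_lam_cst|exact: dr].
    by rewrite !mulr0; ring.
  - move=> t ta; have at0 : a <= t by case/andP: ta.
    have t0 : 0 < t by exact: lt_le_trans at0.
    have q : (k ^+ 2 - k) / t ^+ 2 <= 4^-1.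
      rewrite ler_pdivrMr ?exprn_gt0//.
      have : m.+1%:R <= t by rewrite (le_trans _ at0)// (le_trans _ ma)// ler_nat.
      by have : 0 <= m.+1%:R :> R by []; rewrite /k; nra.
    have D0 : 0 < 1 + (2 * rho t) ^+ 2 by rewrite ltr_pwDl// sqr_ge0.
    rewrite addrC -lerBrDl sub0r mulrC ler_pdivrMr//.
    by move: (_ / t ^+ 2) q (rho t) => w q u; nra.
move=> h; have := atan_gtNpi2 (2 * rho (a + 2 * pi)).
have := atan_ltpi2 (2 * rho a); move: h; rewrite /T; lra.
Qed.

(** With k = (d - 1) / 2, the energy w^2 + w'^2 of w = r^k phi is bounded because the
    perturbation k (k - 1) / r^2 of the equation of w is integrable at infinity;
    exp (k (k - 1) / r) is the corresponding integrating factor. *)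
Lemma radial_decay : (0 < m)%N -> exists2 C : R, 0 < C &
  forall r, 0 <= r -> r ^+ m.+1 * phi r ^+ 2 <= C.
Proof.
move=> m0; pose k : R := m.+1%:R / 2.
have k1 : 1 <= k by rewrite /k ler_pdivlMr// mul1r ler_nat.
pose mu := k ^+ 2 - k; have mu0 : 0 <= mu by rewrite /mu; nra.
pose v (t : R) := - (t * chi t) + k * t^-1 * phi t.
pose S (t : R) := t ^+ m.+1 * (phi t ^+ 2 + v t ^+ 2) * expR (mu * t^-1).
have S1 t : 1 <= t -> S t <= S 1.
  move=> t1; apply: (@is_derive_le0_ge _ S (fun t => - (t ^+ m.+1 * mu / t ^+ 2 *
     (phi t - v t) ^+ 2 * expR (mu * t^-1)))) => // {t t1}t /andP[t1' _].
    have t0 : t != 0 by rewrite gt_eqF// (lt_le_trans ltr01).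
    have d1 := dphi t; have d2 := dpsi t; rewrite /S /v; derive_rules => //.
    rewrite exprS /mu /k /= ; field.
    exact: t0.
  rewrite oppr_le0; apply: mulr_ge0; last exact: expR_ge0.
  apply: mulr_ge0; last exact: sqr_ge0.
  apply: divr_ge0; last exact: sqr_ge0.
  by apply: mulr_ge0 => //; rewrite exprn_ge0// (le_trans ler01).
have S10 : 0 <= S 1.
  by rewrite /S expr1n mul1r mulr_ge0 ?expR_ge0// addr_ge0// sqr_ge0.
exists (1 + S 1) => [|r r0]; first by rewrite ltr_pwDl.
have [r1|r1] := leP r 1.
  rewrite (@le_trans _ _ 1)//; last by rewrite lerDl.
  rewrite -[leRHS]mulr1; apply: ler_pM; [exact: exprn_ge0|exact: sqr_ge0| |].
    exact: exprn_ile1.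
  exact: radial_sqr_le1.
rewrite (@le_trans _ _ (S r))//; last by rewrite ler_wpDl// S1// ltW.
rewrite /S -[leLHS]mulr1; apply: ler_pM => //.
- by apply: mulr_ge0; [exact: exprn_ge0|exact: sqr_ge0].
- by apply: ler_wpM2l; [exact: exprn_ge0|rewrite lerDl sqr_ge0].
- by rewrite -expR0 ler_expR divr_ge0.
Qed.

End radial_solution.

(** * Radial Dirichlet eigenfunctions *)

Section eigenfunctions.
Context {R : realType}.
Variables (m : nat) (phi chi : R -> R) (K : R).
Local Notation d := m.+2.
Local Notation mu := (@lebesgue_measure R).
Local Notation nu := (@bessel_order R d).
Local Notation z := (besselJ_zero nu).
Hypothesis sol : radial_solution d phi chi.
Hypothesis K0 : 0 < K.
Hypothesis JE : forall r, besselJ nu r = (r / 2) `^ nu * (K * phi r).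

Let besselJ_eq0 (r : R) : 0 < r -> besselJ nu r = 0 -> phi r = 0.
Proof.
move=> r0; have r20 : 0 < r / 2 by rewrite divr_gt0.
by rewrite JE => /eqP; rewrite 2!mulf_eq0 (gt_eqF (powR_gt0 _ r20)) (gt_eqF K0) => /eqP.
Qed.

(** The zeros being at distance at least 1 from each other, the infimum that defines the
    next zero is attained. *)
Let next_zero (a : R) : 0 <= a -> (a = 0 \/ phi a = 0) ->
  let x := inf [set x | a < x /\ besselJ nu x = 0] in
  [/\ a < x, phi x = 0 & x <= Num.max a m.+2%:R + (2 * pi + 1)].
Proof.
move=> a0 aS; cbv zeta; set S := [set x | _].
have b0 : 0 <= Num.max a m.+2%:R by rewrite le_max a0.
have : m.+2%:R <= Num.max a m.+2%:R + 1 by rewrite ler_wpDr// le_max lexx orbT.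
move=> /(radial_zero_exists sol)[y /andP[y1 y2] py].
have ay : a < y.
  by apply: lt_le_trans y1; rewrite ltr_pwDr// le_max lexx.
have Sy : S y by split => //; rewrite JE py !mulr0.
have Slb : has_inf S.
  by split; [exists y|exists a => x [/ltW]].
have [x Sx xlt] := inf_adherent (@ltr01 R) Slb.
have xpos : 0 < x by case: Sx => ax _; exact: le_lt_trans ax.
have px : phi x = 0 by case: Sx => _; exact: besselJ_eq0.
have xmin y' : S y' -> x <= y'.
  move=> Sy'; rewrite leNgt; apply/negP => yx.
  have [ay' Jy'] := Sy'; have y'0 : 0 < y' by exact: le_lt_trans ay'.
  have := radial_zero_gap sol y'0 yx (besselJ_eq0 y'0 Jy') px.
  have := ge_inf (proj2 Slb) Sy'; lra.
have -> : inf S = x.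
  apply/eqP; rewrite eq_le (ge_inf (proj2 Slb) Sx)/=.
  by apply: lb_le_inf; [exists y|exact: xmin].
split => //; first by case: Sx.
by move: (xmin _ Sy) y2; lra.
Qed.

Lemma besselJ_zeroP (n : nat) :
  [/\ n.+1%:R <= z n, phi (z n) = 0 & z n <= m.+2%:R + (2 * pi + 1) * n.+1%:R].
Proof.
have pi0 : 0 < pi :> R by exact: pi_gt0.
elim: n => [|n [z1 z2 z3]].
  have [x0 px xle] := next_zero (lexx 0) (or_introl erefl).
  split => //; first exact: (radial_zero_ge1 sol x0 px).
  by rewrite mulr1; move: xle; rewrite (max_idPr _)//.
have z0 : 0 < z n by exact: lt_le_trans z1.
have [zz px xle] := next_zero (ltW z0) (or_intror z2).
split => //=.
  have := radial_zero_gap sol z0 zz z2 px.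
  by apply: le_trans; rewrite -natr1 lerD2r.
apply: le_trans xle _; rewrite -[n.+2%:R]natr1.
suff : Num.max (z n) m.+2%:R <= m.+2%:R + (2 * pi + 1) * n.+1%:R.
  by rewrite mulrDr; lra.
rewrite ge_max z3/= lerDl; apply: mulr_ge0 => //; lra.
Qed.

Lemma besselJ_zero_lt (n : nat) : z n < z n.+1.
Proof.
have [z1 z2 _] := besselJ_zeroP n; have z0 : 0 < z n by exact: lt_le_trans z1.
by have [] := next_zero (ltW z0) (or_intror z2).
Qed.

Let psi (r : R) := r * chi r.

Let dphis (a r : R) : is_derive r (1 : R) (fun t => phi (a * t)) (- a * psi (a * r)).
Proof.
have [_ dp _] := sol; eapply is_derive_val_eq.
  by eapply (@is_derive_lam_comp _ (fun t => a * t) phi); [repeat derive_step|exact: dp].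
by rewrite /psi /=; ring.
Qed.

Let dpsis (a r : R) : is_derive r (1 : R) (fun t => psi (a * t))
  (a * (phi (a * r) - m.+1%:R * chi (a * r))).
Proof.
have [_ _ dp] := sol; eapply is_derive_val_eq.
  by eapply (@is_derive_lam_comp _ (fun t => a * t) psi); [repeat derive_step|exact: dp].
by rewrite /=; ring.
Qed.

(** The inner products, for r^(d-1) dr, of phi (a r) and phi (b r) and, up to a factor,
    of their derivatives. *)
Let I (a b : R) := (\int[mu]_(r in `[0%R, 1%R]) (r ^+ m.+1 * (phi (a * r) * phi (b * r))))%R.
Let H (a b : R) := (\int[mu]_(r in `[0%R, 1%R]) (r ^+ m.+1 * (psi (a * r) * psi (b * r))))%R.

Let contI (a b : R) : continuous (fun r : R => r ^+ m.+1 * (phi (a * r) * phi (b * r))).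
Proof. by move=> r; have d1 := dphis a r; have d2 := dphis b r; derive_continuous. Qed.

Let contH (a b : R) : continuous (fun r : R => r ^+ m.+1 * (psi (a * r) * psi (b * r))).
Proof. by move=> r; have d1 := dpsis a r; have d2 := dpsis b r; derive_continuous. Qed.

(** Green's formula, obtained by integrating (r^(d-1) phi' (a r) phi (b r))'; its
    symmetric use in a and b gives the orthogonality of both families. *)
Let green (a b : R) : a * I a b - b * H a b = psi a * phi b.
Proof.
have <- : 1 ^+ m.+1 * (psi (a * 1) * phi (b * 1)) - 0 ^+ m.+1 * (psi (a * 0) * phi (b * 0)) = psi
    a * phi b.
  by rewrite !mulr1 expr1n expr0n/= mul0r subr0 mul1r.
rewrite -mulNr -Rintegral_linear;
    [|exact/continuous_subspaceT/contI|exact/continuous_subspaceT/contH].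
apply: (@Rintegral_FTC2 _ (fun r => r ^+ m.+1 * (psi (a * r) * phi (b * r)))) => //.
  move=> r _; have d1 := dpsis a r; have d2 := dphis b r; derive_rules.
  by rewrite /psi exprS /=; ring.
apply/continuous_subspaceT => r.
by have d1 := dphis a r; have d2 := dphis b r; have d3 := dpsis a r; have d4 := dpsis b r;
    derive_continuous.
Qed.

Let I_sym a b : I a b = I b a.
Proof. by apply: eq_Rintegral => r _; rewrite [phi _ * _]mulrC. Qed.

Let H_sym a b : H a b = H b a.
Proof. by apply: eq_Rintegral => r _; rewrite [psi _ * _]mulrC. Qed.

Let orthI a b : phi a = 0 -> phi b = 0 -> 0 < a -> 0 < b -> a != b -> I a b = 0 /\ H a b = 0.
Proof.
move=> pa pb a0 b0 ab.
have := green a b; have := green b a.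
rewrite pa pb !mulr0 (I_sym b a) (H_sym b a) => /subr0_eq e1 /subr0_eq e2.
have : (a ^+ 2 - b ^+ 2) * I a b = 0.
  by rewrite mulrBl !expr2 -!mulrA e2 e1; ring.
move=> /eqP; rewrite mulf_eq0 subr_sqr mulf_eq0 subr_eq0 (negPf ab) gt_eqF ?addr_gt0//=.
move=> /eqP I0; split=> //; apply/eqP.
by move: e2; rewrite I0 mulr0 => /esym/eqP; rewrite mulf_eq0 gt_eqF.
Qed.

Let diagI a : phi a = 0 -> 0 < a -> I a a = H a a.
Proof.
move=> pa a0; have := green a a; rewrite pa mulr0 => /subr0_eq.
by apply: mulfI; rewrite gt_eqF.
Qed.

(** The Pohozaev identity; by [radial_energy_gt0] it shows that the norm of an
    eigenfunction does not vanish. *)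
Let normI a : phi a = 0 -> 0 < a -> I a a = psi a ^+ 2 / 2.
Proof.
move=> pa a0.
pose G (r : R) := (r ^+ m.+2 * (phi (a * r) ^+ 2 + psi (a * r) ^+ 2) -
   m%:R * a^-1 * (r ^+ m.+1 * (phi (a * r) * psi (a * r)))) / 2.
have -> : psi a ^+ 2 / 2 = G 1 - G 0.
  by rewrite /G !mulr1 !expr1n !expr0n/= pa; field; rewrite gt_eqF.
apply: Rintegral_FTC2 => //.
  move=> r _; have d1 := dpsis a r; have d2 := dphis a r; rewrite /G; derive_rules.
  rewrite /psi !exprS /=.
  have -> : m.+2%:R = m%:R + 2 :> R by rewrite -addn2 natrD.
  have -> : m.+1%:R = m%:R + 1 :> R by rewrite -addn1 natrD.
  by field; rewrite gt_eqF.
exact/continuous_subspaceT/contI.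
Qed.

Let z_gt0 n : 0 < z n.
Proof. by have [zn _ _] := besselJ_zeroP n; apply: lt_le_trans zn. Qed.

Let phi_z n : phi (z n) = 0. Proof. by have [] := besselJ_zeroP n. Qed.

Let besselJ_zero_inj : injective z.
Proof.
have mono : {homo z : i j / (i < j)%N >-> i < j}.
  exact: (homo_ltn lt_trans besselJ_zero_lt).
move=> i j; case: (ltngtP i j) => // /mono; first by move=> + e; rewrite e ltxx.
by move=> + e; rewrite e ltxx.
Qed.

Let normI_gt0 n : 0 < I (z n) (z n).
Proof.
have z1 : 1 <= z n by have [zn _ _] := besselJ_zeroP n; apply: le_trans zn; rewrite ler1n.
rewrite normI// divr_gt0//.
by have := radial_energy_gt0 sol z1; rewrite phi_z expr0n add0r.
Qed.

Let kappa n := (Num.sqrt (I (z n) (z n)))^-1.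

Let kappa_gt0 n : 0 < kappa n.
Proof. by rewrite invr_gt0 sqrtr_gt0. Qed.

Let kappa_sqr n : kappa n ^+ 2 * I (z n) (z n) = 1.
Proof. by rewrite exprVn sqr_sqrtr ?mulVf ?gt_eqF// ltW. Qed.

Lemma bessel_order2 : nu * 2%:R = m%:R.
Proof.
by rewrite /bessel_order -mulrA mulVf ?mulr1// -addn2 natrD addrK.
Qed.

Lemma bessel_normE n : bessel_norm d n = (z n / 2) `^ nu * K * Num.sqrt (I (z n) (z n)) :> R.
Proof.
have z20 : 0 <= z n / 2 by rewrite divr_ge0// ltW.
rewrite /bessel_norm.
have -> : (\int[mu]_(r in `[0%R, 1%R]) (`|besselJ nu (z n * r)| ^+ 2 * r) =
   ((z n / 2) `^ nu * K) ^+ 2 * I (z n) (z n))%R.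
  rewrite -RintegralZl//; last exact/continuous_itv_integrable/continuous_subspaceT/contI.
  apply: eq_Rintegral => r; rewrite inE/= in_itv/= => /andP[r0 _].
  have -> : besselJ nu (z n * r) = (z n / 2) `^ nu * r `^ nu * (K * phi (z n * r)).
    by rewrite JE -powRM// mulrAC.
  rewrite real_normK ?num_real//.
  have e : (r `^ nu) ^+ 2 = r ^+ m.
    by rewrite -powR_mulrn ?powR_ge0// -powRrM bessel_order2 powR_mulrn.
  by rewrite !exprMn e (exprS r m); ring.
rewrite sqrtrM ?sqr_ge0// sqrtr_sqr ger0_norm// mulr_ge0 ?powR_ge0//.
exact: ltW.
Qed.

Lemma eigenfunE n (r : R) : 0 < r -> eigenfun d n r = kappa n * phi (z n * r).
Proof.
move=> r0; have z20 : 0 < z n / 2 by rewrite divr_gt0.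
have Jr : besselJ nu (z n * r) = (z n / 2) `^ nu * r `^ nu * (K * phi (z n * r)).
  by rewrite JE -powRM ?ltW// mulrAC.
rewrite /eigenfun bessel_normE Jr powRN /kappa.
have p1 : (z n / 2) `^ nu != 0 by rewrite gt_eqF// powR_gt0.
have p2 : r `^ nu != 0 by rewrite gt_eqF// powR_gt0.
have p3 : Num.sqrt (I (z n) (z n)) != 0 by rewrite gt_eqF// sqrtr_gt0.
have p4 : K != 0 by rewrite gt_eqF.
by move: (_ `^ nu) (_ `^ nu) (Num.sqrt _) p1 p2 p3 => A B D p1 p2 p3; field; rewrite p1 p2 p3 p4.
Qed.

(** Bessel's inequality for the orthonormal functions h_n (s) = - kappa_n phi' (z_n s) and
    the function s^(1-d) on [r, 1], whose coefficients are the
    c_n = kappa_n phi (z_n r) / z_n because phi (z_n) = 0.  For H = sum_n c_n h_n both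
    int_r^1 H and int_0^1 s^(d-1) H^2 are equal to sum_n c_n^2, and
    H <= (s^(d-1) H^2 + s^(1-d)) / 2.  The exponent 1 - d is lowered to - a - 1 so
    that d = 2 is treated like the other dimensions. *)
Let eigenfun_sqr_sum (N : nat) (r a : R) : 0 < r <= 1 -> 0 < a -> m%:R <= a ->
  \sum_(n < N) (kappa n * phi (z n * r) / z n) ^+ 2 <= r `^ (- a) / a.
Proof.
move=> /andP[r0 r1] a0 ma.
pose c n := kappa n * phi (z n * r) / z n.
pose h n (s : R) := kappa n * psi (z n * s).
have hc n : continuous (h n).
  by move=> s; have d1 := dpsis (z n) s; rewrite /h; derive_continuous.
pose Hs (s : R) := \sum_(n < N) c n * h n s.
have Hc : continuous Hs.
  by apply: continuous_sum => n s; apply: cvgMr; exact: hc.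
pose A := \sum_(n < N) c n ^+ 2.
have h2c n k : continuous (fun s : R => s ^+ m.+1 * (h n s * h k s)).
  by move=> s; have d1 := dpsis (z n) s; have d2 := dpsis (z k) s; rewrite /h; derive_continuous.
have hH n : continuous (fun s : R => s ^+ m.+1 * (h n s * Hs s)).
  move=> s; apply: cvgM; first exact: exprn_continuous.
  by apply: cvgM; [exact: hc|exact: Hc].
have orth n k : (\int[mu]_(s in `[0%R, 1%R]) (s ^+ m.+1 * (h n s * h k s)))%R = (n == k)%:R.
  have -> : (\int[mu]_(s in `[0%R, 1%R]) (s ^+ m.+1 * (h n s * h k s)) =
     kappa n * kappa k * H (z n) (z k))%R.
    rewrite -RintegralZl//; last exact/continuous_itv_integrable/continuous_subspaceT/contH.
    by apply: eq_Rintegral => s _; rewrite /h; ring.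
  case: eqVneq => [->|nk].
    by rewrite -diagI// -expr2 kappa_sqr.
  have [||//|//||_ ->] := @orthI (z n) (z k); rewrite ?mulr0//.
  by apply/eqP => /besselJ_zero_inj; apply/eqP.
have intH : (\int[mu]_(s in `[0%R, 1%R]) (s ^+ m.+1 * (Hs s * Hs s)) = A)%R.
  transitivity (\int[mu]_(s in `[0%R, 1%R]) (\sum_(n < N) c n * (s ^+ m.+1 * (h n s * Hs s))))%R.
    apply: eq_Rintegral => s _; rewrite {1}/Hs mulr_suml mulr_sumr.
    by apply: eq_bigr => n _; ring.
  rewrite Rintegral_sum//; apply: eq_bigr => n _; rewrite expr2; congr (_ * _).
  transitivity (\int[mu]_(s in `[0%R, 1%R]) (\sum_(k < N) c k * (s ^+ m.+1 * (h n s * h k s))))%R.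
    apply: eq_Rintegral => s _; rewrite {1}/Hs !mulr_sumr.
    by apply: eq_bigr => k _; ring.
  rewrite Rintegral_sum// (bigD1 n)//= orth eqxx mulr1 big1 ?addr0// => k kn.
  by rewrite orth (_ : (n == k :> nat) = false) ?mulr0// eq_sym; exact: negPf kn.
have intc n : (\int[mu]_(s in `[r, 1%R]) h n s)%R = c n.
  pose F s := - (kappa n * phi (z n * s) / z n).
  have -> : c n = F 1 - F r by rewrite /F mulr1 phi_z /c; ring.
  apply: Rintegral_FTC2; [exact: r1| |exact/continuous_subspaceT/hc].
  move=> s _; have d1 := dphis (z n) s; rewrite /F /h; derive_rules.
  by field; rewrite gt_eqF.
have AE : A = (\int[mu]_(s in `[r, 1%R]) Hs s)%R.
  rewrite Rintegral_sum//; apply: eq_bigr => n _.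
  by rewrite intc -expr2.
pose w (s : R) := s `^ (- a - 1).
have wc : {within `[r, 1], continuous w}.
  apply: (@is_derive_within_continuous _ w (fun s => (- a - 1) * s `^ (- a - 1 - 1))).
  by move=> s /andP[rs _]; apply: is_derive1_powR; exact: lt_le_trans rs.
have wint : (\int[mu]_(s in `[r, 1%R]) w s)%R <= r `^ (- a) / a.
  pose F s := - (a^-1 * s `^ (- a)).
  have -> : (\int[mu]_(s in `[r, 1%R]) w s)%R = F 1 - F r.
    apply: Rintegral_FTC2; [exact: r1| |exact: wc].
    move=> s /andP[rs _]; have s0 : 0 < s by exact: lt_le_trans rs.
    have d1 := @is_derive1_powR R (- a) s s0; rewrite /F; derive_rules.
    by rewrite /w; field; rewrite gt_eqF.
  rewrite /F (_ : 1 `^ (- a) = 1); last by rewrite powRN powR1 invr1.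
  by rewrite opprK mulr1 mulrC addrC lerBlDr lerDl invr_ge0 ltW.
have HHc : continuous (fun s : R => s ^+ m.+1 * (Hs s * Hs s)).
  move=> s; apply: cvgM; first exact: exprn_continuous.
  by apply: cvgM; exact: Hc.
have : A <= 2^-1 * (\int[mu]_(s in `[r, 1%R]) (s ^+ m.+1 * (Hs s * Hs s)))%R
  + 2^-1 * (\int[mu]_(s in `[r, 1%R]) w s)%R.
  rewrite AE -Rintegral_linear//; last exact/continuous_subspaceT.
  apply: le_Rintegral => //.
  - exact/continuous_itv_integrable/continuous_subspaceT.
  - apply: continuous_itv_integrable => s; apply: cvgD; apply: cvgMr; last exact: wc.
    exact: (continuous_subspaceT HHc).
  - move=> s; rewrite /= in_itv/= => /andP[rs s1].
    have s0 : 0 < s by exact: lt_le_trans rs.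
    have ws : (s ^+ m.+1)^-1 <= w s.
      have /ger_powR h01 : 0 < s <= 1 by rewrite s0.
      rewrite /w -powR_invn ?(ltW s0)//; apply: h01.
      by rewrite -natr1; lra.
    have p0 : 0 < s ^+ m.+1 by rewrite exprn_gt0.
    have pq : s ^+ m.+1 * (s ^+ m.+1)^-1 = 1 by rewrite divff// gt_eqF.
    have := mulr_ge0 (ltW p0) (sqr_ge0 (Hs s - (s ^+ m.+1)^-1)).
    move: ((s ^+ m.+1)^-1) ws pq => q; move: (s ^+ m.+1) p0 (Hs s) (w s) => p p0 u v qv pq.
    have -> : p * (u - q) ^+ 2 = p * (u * u) - 2 * (p * q) * u + (p * q) * q by ring.
    by rewrite pq; lra.
have : (\int[mu]_(s in `[r, 1%R]) (s ^+ m.+1 * (Hs s * Hs s)) <= A)%R.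
  have ii : mu.-integrable `[0%R, 1%R] (EFin \o (fun s : R => s ^+ m.+1 * (Hs s * Hs s))).
    exact/continuous_itv_integrable/continuous_subspaceT.
  rewrite -intH -[leRHS](subrK (\int[mu]_(s in `[0%R, r]) (s ^+ m.+1 * (Hs s * Hs s)))%R).
  rewrite Rintegral_itvB ?bnd_simp ?(ltW r0)//.
  rewrite Rintegral_itv_obnd_cbnd; last first.
    apply: integrableS ii => // s; rewrite /= !in_itv/= => /andP[rs ->].
    by rewrite (le_trans (ltW r0))// ltW.
  rewrite lerDl; apply: Rintegral_ge0 => s; rewrite /= in_itv/= => /andP[s0 _].
  by rewrite mulr_ge0 ?exprn_ge0// -expr2 sqr_ge0.
by move: wint; rewrite -/A; lra.
Qed.

Let Cz : R := m.+2%:R + (2 * pi + 1).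

Let Cz_gt0 : 0 < Cz.
Proof. by have := @pi_gt0 R; have : 0 <= m.+2%:R :> R by []; rewrite /Cz; lra. Qed.

Let z_le n : z n <= Cz * n.+1%:R.
Proof.
have [_ _ h] := besselJ_zeroP n; apply: le_trans h _.
by rewrite /Cz [leRHS]mulrDl lerD2r ler_peMr// ler1n.
Qed.

Lemma eigenfun_sum_le : exists2 C : R, 0 < C & forall a, 0 < a -> m%:R <= a ->
  forall N r, 0 < r <= 1 ->
  \sum_(n < N) (eigenfun d n r / n.+1%:R) ^+ 2 <= C * (r `^ (- a) / a).
Proof.
exists (Cz ^+ 2) => [|a a0 ma N r r01]; first by rewrite exprn_gt0.
have Cz2 : 0 <= Cz ^+ 2 by exact: sqr_ge0.
apply: le_trans (ler_wpM2l Cz2 (eigenfun_sqr_sum N r01 a0 ma)).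
rewrite mulr_sumr; apply: ler_sum => n _.
have /andP[r0 _] := r01; rewrite eigenfunE//.
have zn := z_gt0 n; have n0 : 0 < n.+1%:R :> R by [].
have -> : kappa n * phi (z n * r) / n.+1%:R =
    (kappa n * phi (z n * r) / z n) * (z n / n.+1%:R).
  by field; rewrite !gt_eqF.
rewrite [leLHS]exprMn mulrC; apply: ler_wpM2r; first exact: sqr_ge0.
rewrite lerXn2r ?nnegrE ?divr_ge0 ?(ltW zn) ?(ltW Cz_gt0)//.
by rewrite ler_pdivrMr.
Qed.

(** If z_N r <= 1 then z_n r <= 1 for all n <= N, and phi >= 1/2 on [0, 1]; the size
    of kappa_n comes from [radial_decay]. *)
Lemma eigenfun_ge_near0 : (0 < m)%N -> exists c C : R, [/\ 0 < c, 0 < C & forall N : nat,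
  exists delta : R, [/\ 0 < delta, delta * N.+1%:R <= 1, 1 <= C * (delta * N.+1%:R) &
  forall n, (n <= N)%N -> exists q : R, [/\ 0 <= q, c * n.+1%:R ^+ m.+1 <= q ^+ 2 &
  forall r, 0 < r <= delta -> q <= eigenfun d n r]]].
Proof.
move=> m0; have [C C0 decay] := radial_decay sol m0.
exists (4^-1 / C), Cz; split => //; first by rewrite divr_gt0.
move=> N; have zN := z_gt0 N; exists (z N)^-1; split.
- by rewrite invr_gt0.
- by rewrite mulrC ler_pdivrMr// mul1r; have [] := besselJ_zeroP N.
- by rewrite mulrCA mulrC ler_pdivlMr// mul1r z_le.
- move=> n nN; exists (kappa n / 2); split.
  + by rewrite divr_ge0// ltW.
  + have zn := z_gt0 n.
    have nz : n.+1%:R ^+ m.+1 <= z n ^+ m.+1.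
      by have [zn1 _ _] := besselJ_zeroP n; apply: lerXn2r; rewrite ?nnegrE ?(ltW zn).
    have IC : I (z n) (z n) * z n ^+ m.+1 <= C.
      rewrite mulrC -RintegralZl//; last exact/continuous_itv_integrable/continuous_subspaceT/contI.
      have -> : C = (\int[mu]_(r in `[0%R, 1%R]) C)%R.
        by rewrite Rintegral_cst//= lebesgue_measure_itv/= lte_fin ltr01 -EFinB subr0 mulr1.
      apply: le_Rintegral => //.
      - by apply: continuous_itv_integrable => r; apply: cvgMr; exact: (continuous_subspaceT
          (@contI _ _)).
      - by apply: continuous_itv_integrable => r; exact: cvg_cst.
      - move=> r; rewrite /= in_itv/= => /andP[r0 _].
        by rewrite mulrA -exprMn -expr2 decay// mulr_ge0// ltW.
    have kI := kappa_sqr n; have I0 := normI_gt0 n.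
    move: (I (z n) (z n)) (z n ^+ m.+1) (n.+1%:R ^+ m.+1) IC kI I0 nz => J Z Y JZ kJ J0 YZ.
    have kJ' : kappa n ^+ 2 = J^-1.
      by apply: (mulIf (lt0r_neq0 J0)); rewrite kJ mulVf// gt_eqF.
    have -> : (kappa n / 2) ^+ 2 = J^-1 / 4 by rewrite -kJ'; field.
    have h : Y / C <= J^-1.
      rewrite ler_pdivrMr// mulrC ler_pdivlMr//.
      by apply: le_trans JZ; rewrite mulrC ler_wpM2l// ltW.
    by rewrite mulrAC -mulrA mulrC; apply: ler_wpM2r.
  + move=> r /andP[r0 rd]; rewrite eigenfunE// ler_wpM2l//; first exact: ltW.
    apply: (radial_ge_half sol); rewrite mulr_ge0 ?(ltW r0) ?(ltW (z_gt0 n))//=.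
    have zn := z_gt0 n; have znN : z n <= z N.
      move: nN; rewrite leq_eqVlt => /predU1P[->//|].
      by move/(homo_ltn lt_trans besselJ_zero_lt)/ltW.
    have rz : r * z N <= 1 by rewrite -ler_pdivlMr// mul1r.
    by apply: le_trans rz; rewrite mulrC ler_wpM2l// ltW.
Qed.

Lemma eigenfun_bounded n : exists B : R, forall r, 0 < r -> `|eigenfun d n r| <= B.
Proof.
exists (kappa n) => r r0; rewrite eigenfunE// normrM gtr0_norm// ler_piMr//; first exact: ltW.
rewrite -(@ler_pXn2r _ 2)// ?nnegrE// expr1n real_normK ?num_real//.
by apply: (radial_sqr_le1 sol); rewrite mulr_ge0// ltW.
Qed.

Lemma measurable_eigenfun n : measurable_fun setT (@eigenfun R d n).
Proof.
rewrite /eigenfun; under eq_fun do rewrite JE.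
apply: measurable_funM; first by apply: measurable_funM => //; exact: measurable_powR.
apply: measurable_funM.
  apply: (measurableT_comp (measurable_powR _)).
  by apply: measurable_funM => //; exact: measurable_funM.
apply: measurable_funM => //; apply: continuous_measurable_fun => r.
by have d1 := dphis (z n) r; derive_continuous.
Qed.

End eigenfunctions.

(** * Image measures with a density *)

Section density.
Local Open Scope ereal_scope.
Context d1 d2 (T1 : measurableType d1) (T2 : measurableType d2) (R : realType).
Variables (m1 : {measure set T1 -> \bar R}) (m2 : {measure set T2 -> \bar R}).
Variables (X : T1 -> T2) (w : T1 -> R).
Hypotheses (mX : measurable_fun setT X) (mw : measurable_fun setT w).
Hypothesis w0 : forall x, (0 <= w x)%R.
Hypothesis m2E : forall B, measurable B -> m2 B = \int[m1]_(x in X @^-1` B) (w x)%:E.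

Import HBNNSimple.

Let ge0_integral_density_nnsfun (g : {nnsfun T2 >-> R}) :
  \int[m2]_y (g y)%:E = \int[m1]_x (g (X x) * w x)%:E.
Proof.
have mXB B : measurable B -> measurable (X @^-1` B).
  by move=> mB; rewrite -[_ @^-1` _]setTI; exact: mX.
have mind k : measurable_fun setT (fun x => \1_(g @^-1` [set k]) (X x) : R).
  by apply: measurableT_comp => //.
transitivity (\sum_(k \in range g) \int[m2]_y (k * \1_(g @^-1` [set k]) y)%:E).
  under eq_integral do rewrite fimfunE -fsumEFin//.
  rewrite ge0_integral_fsum//.
  - by move=> r; exact/measurable_EFinP/measurable_funM.
  - by move=> r y _; rewrite EFinM nnfun_muleindic_ge0.
transitivity (\sum_(k \in range g) \int[m1]_x (k * \1_(g @^-1` [set k]) (X x) * w x)%:E).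
  apply: eq_fsbigr => k; rewrite inE => -[y _ <-{k}].
  under eq_integral do rewrite EFinM.
  rewrite ge0_integralZl//; last 2 first.
  - exact/measurable_EFinP.
  - by rewrite lee_fin; exact: fun_ge0.
  rewrite integral_indic// setIT m2E//.
  under [RHS]eq_integral do rewrite -mulrA EFinM.
  rewrite ge0_integralZl//; last 3 first.
  - by apply/measurable_EFinP/measurable_funM.
  - by move=> x _; rewrite lee_fin mulr_ge0.
  - by rewrite lee_fin; exact: fun_ge0.
  congr (_ * _); rewrite integral_mkcond; apply: eq_integral => x _.
  rewrite patchE indicE; case: ifPn => xg.
    by rewrite mem_set ?mul1r//; rewrite inE in xg.
  by rewrite memNset ?mul0r//; rewrite notin_setE in xg.
rewrite -ge0_integral_fsum//.
- apply: eq_integral => x _; under eq_fsbigr do rewrite EFinM.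
  rewrite -ge0_mule_fsuml; last by move=> k; rewrite EFinM nnfun_muleindic_ge0.
  by rewrite fsumEFin// -fimfunE EFinM.
- by move=> r; apply/measurable_EFinP/measurable_funM => //; exact: measurable_funM.
- move=> r x _; rewrite EFinM mule_ge0 ?lee_fin//.
  by rewrite -lee_fin EFinM nnfun_muleindic_ge0.
Qed.

(** It covers measures on the line with a density (X is the identity), the Gaussian law
    on C, and the law of a variable weighted by another random variable. *)
Lemma ge0_integral_density (f : T2 -> \bar R) : measurable_fun setT f ->
  (forall y, 0 <= f y) -> \int[m2]_y f y = \int[m1]_x (f (X x) * (w x)%:E).
Proof.
move=> mf f0; pose g := nnsfun_approx measurableT mf.
have gf y : (g n y)%:E @[n --> \oo] --> f y.
  by apply: cvg_nnsfun_approx => // *; exact: f0.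
transitivity (limn (fun n => \int[m2]_y (g n y)%:E)).
  rewrite -monotone_convergence//.
  - by apply: eq_integral => y _; apply/esym/cvg_lim => //; exact: gf.
  - by move=> n; exact/measurable_EFinP.
  - by move=> n y _; rewrite lee_fin.
  - by move=> y _ a b ab; rewrite lee_fin; exact/lefP/nd_nnsfun_approx.
transitivity (limn (fun n => \int[m1]_x ((g n (X x) * w x)%:E))).
  by congr (limn _); apply/funext => n; exact: ge0_integral_density_nnsfun.
rewrite -monotone_convergence//.
- apply: eq_integral => x _; apply/cvg_lim => //.
  under eq_cvg do rewrite EFinM.
  by apply: cvgeZr => //; exact: gf.
- move=> n; apply/measurable_EFinP/measurable_funM => //.
  by apply: measurableT_comp.
- by move=> n x _; rewrite lee_fin mulr_ge0.
- by move=> x _ a b ab; rewrite lee_fin ler_wpM2r//; exact/lefP/nd_nnsfun_approx.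
Qed.

End density.

(** * Products of independent variables *)

Section independence.
Local Open Scope ereal_scope.
Context d (Omega : measurableType d) (R : realType) (P : probability Omega R).
Variable g : nat -> {RV P >-> R[i]}.
Hypothesis g_indep : independent_RVs g.

Let mg n : measurable_fun setT (g n : Omega -> R[i]).
Proof. exact: measurable_funP. Qed.

Let mgf n (f : R[i] -> R) : measurable_fun setT f -> measurable_fun setT (fun w => f (g n w)).
Proof. by move=> mf; apply: measurableT_comp. Qed.

Let indep_indic (K : nat) (f : nat -> R[i] -> R) (M : nat -> R) :
  (forall n, measurable_fun setT (f n)) ->
  (forall n, \int[P]_w (f n (g n w))%:E = (M n)%:E) ->
  (forall n z, (n < K)%N -> f n z = 0%R \/ f n z = 1%R) ->
  \int[P]_w (\prod_(n < K) f n (g n w))%:E = (\prod_(n < K) M n)%:E.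
Proof.
move=> mf fM f01; pose B n := f n @^-1` [set 1%R].
have mB n : measurable (B n) by rewrite -[B n]setTI; exact: mf.
have fE n z : (n < K)%N -> f n z = \1_(B n) z.
  move=> nK; rewrite indicE; have [fz|fz] := f01 n z nK.
    by rewrite fz memNset// /B/= fz; apply/eqP; rewrite eq_sym oner_eq0.
  by rewrite fz mem_set.
pose J : {fset nat} := [fset n in iota 0 K]%fset.
have MP n : (n < K)%N -> P (g n @^-1` B n) = (M n)%:E.
  move=> nK; rewrite -fM; under eq_integral do rewrite fE//.
  have mgB : measurable (g n @^-1` B n) by rewrite -[_ @^-1` _]setTI; exact: mg.
  by rewrite (integral_indic P measurableT mgB) setIT.
have := g_indep J mB.
have -> : \prod_(n <- J) P (g n @^-1` B n) = (\prod_(n < K) M n)%:E.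
  have /(perm_big _)-> : perm_eq J (index_iota 0 K).
    apply: uniq_perm; [exact: fset_uniq|exact: iota_uniq|].
    by move=> n; rewrite /J !inE mem_index_iota mem_iota.
  by rewrite big_mkord -prodEFin; apply: eq_bigr => n _; rewrite MP.
have JE n : (n \in J) = (n < K)%N by rewrite /J !inE mem_iota.
move=> <-.
have mC : measurable (\bigcap_(n in [set` J]) g n @^-1` B n).
  by apply: fin_bigcap_measurable => // n _; rewrite -[_ @^-1` _]setTI; exact: mg.
rewrite -[X in P X]setIT -integral_indic//; apply: eq_integral => w _; congr (_%:E).
rewrite indicE; have [wJ|wJ] := boolP (w \in _).
  rewrite big1// => n _; rewrite fE// indicE mem_set//.
  by rewrite inE in wJ; apply: wJ; rewrite /= JE.
have [n nK nB] : exists2 n, (n < K)%N & ~ (B n) (g n w).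
  apply: contrapT => h; rewrite notin_setE in wJ; apply: wJ => n /=; rewrite JE => nK.
  by apply: contrapT => nB; apply: h; exists n.
by rewrite (bigD1 (Ordinal nK))//= fE// indicE memNset// mul0r.
Qed.

(** The factors that are not indicators are introduced one at a time.  With indicators
    for f_N the formula says that the law of g_N, weighted by the product W of the other
    factors, is a multiple of the law of g_N; integrating f_N against both measures
    gives the formula for an arbitrary f_N. *)
Lemma expectation_prod_independent (K : nat) (f : nat -> R[i] -> R) (M : nat -> R) :
  (forall n, measurable_fun setT (f n)) -> (forall n z, (0 <= f n z)%R) ->
  (forall n, \int[P]_w (f n (g n w))%:E = (M n)%:E) ->
  \int[P]_w (\prod_(n < K) f n (g n w))%:E = (\prod_(n < K) M n)%:E.
Proof.
move=> mf f0 fM.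
suff H (N : nat) : (N <= K)%N -> forall (f : nat -> R[i] -> R) (M : nat -> R),
  (forall n, measurable_fun setT (f n)) -> (forall n z, (0 <= f n z)%R) ->
  (forall n, \int[P]_w (f n (g n w))%:E = (M n)%:E) ->
  (forall n z, (N <= n < K)%N -> f n z = 0%R \/ f n z = 1%R) ->
  \int[P]_w (\prod_(n < K) f n (g n w))%:E = (\prod_(n < K) M n)%:E.
  apply: (H K) => // n z /andP[Kn nK]; exfalso.
  by move: (leq_ltn_trans Kn nK); rewrite ltnn.
elim: N => [_|N IH NK] {mf f0 fM}f {}M mf f0 fM f01; first exact: indep_indic.
pose i := Ordinal NK.
pose W w := (\prod_(n < K | n != i) f n (g n w))%R.
pose c := (\prod_(n < K | n != i) M n)%R.
have M0 n : (0 <= M n)%R.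
  by rewrite -lee_fin -fM; apply: integral_ge0 => w _; rewrite lee_fin.
have c0 : (0 <= c)%R by apply: prodr_ge0.
have W0 w : (0 <= W w)%R by apply: prodr_ge0.
have mW : measurable_fun setT W.
  rewrite /W; under eq_fun do rewrite -big_filter.
  by apply: measurable_prod => n _; exact: mgf.
pose m2 := mscale (NngNum c0) (distribution P (g N)).
have m2E B : measurable B -> m2 B = \int[P]_(w in g N @^-1` B) (W w)%:E.
  move=> mB; have mgB : measurable (g N @^-1` B) by rewrite -[_ @^-1` _]setTI; exact: mg.
  pose f' n := if n == N then \1_B : R[i] -> R else f n.
  pose M' n := if n == N then fine (P (g N @^-1` B)) else M n.
  have := IH (ltnW NK) f' M'.
  have -> : (\prod_(n < K) M' n)%:E = m2 B.
    rewrite (bigD1 i)//= /M' eqxx EFinM fineK ?fin_num_measure//.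
    rewrite muleC /m2 /mscale/= /distribution /pushforward; congr (_%:E * _).
    by apply: eq_bigr => n /negPf ni; rewrite (_ : (n == N :> nat) = false).
  move=> <-.
  - rewrite [RHS]integral_mkcond; apply: eq_integral => w _.
    rewrite (bigD1 i)//= /f' eqxx patchE indicE.
    have -> : (\prod_(j < K | j != i) (if j == N :> nat then \1_B : R[i] -> R else f j) (g j w) =
        W w)%R.
      by apply: eq_bigr => n /negPf ni; rewrite (_ : (n == N :> nat) = false).
    case: ifPn => wB; first by rewrite mem_set ?mul1r//; rewrite inE in wB.
    by rewrite memNset ?mul0r//; rewrite notin_setE in wB.
  - by move=> n; rewrite /f'; case: ifP.
  - by move=> n z; rewrite /f'; case: ifP => // _; rewrite indicE.
  - move=> n; rewrite /f' /M'; case: eqP => [->|//].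
    by rewrite (integral_indic P measurableT mgB) setIT fineK// fin_num_measure.
  - move=> n z /andP[Nn nK]; rewrite /f'; case: eqP => [_|/eqP nN].
      by rewrite indicE; case: (_ \in _); [right|left].
    by apply: f01; rewrite nK andbT ltn_neqAle eq_sym nN.
have mfN : measurable_fun setT (EFin \o f N) by exact/measurable_EFinP.
have fN0 z : 0 <= (EFin \o f N) z by rewrite lee_fin.
have := ge0_integral_density (mg N) mW W0 m2E mfN fN0.
rewrite ge0_integral_mscale// ge0_integral_distribution//= fM => H.
rewrite (bigD1 i)//= EFinM muleC H.
by apply: eq_integral => w _; rewrite (bigD1 i).
Qed.

End independence.

(** * Gaussian variables *)

Section complex_borel.
Context {R : realType}.

Lemma measurable_complex_pair : measurable_fun setT (@complex_pair R).
Proof. by move=> _ B mB; exists B. Qed.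

Lemma measurable_Re : measurable_fun setT (fun z : R[i] => complex.Re z).
Proof. exact: (measurableT_comp measurable_fst measurable_complex_pair). Qed.

Lemma measurable_Im : measurable_fun setT (fun z : R[i] => complex.Im z).
Proof. exact: (measurableT_comp measurable_snd measurable_complex_pair). Qed.

Lemma measurable_mkcomplex : measurable_fun setT (fun u : R * R => (u.1 +i* u.2)%C).
Proof.
move=> _ _ [B mB <-]; rewrite setTI.
rewrite (_ : _ @^-1` _ = B)//; apply/seteqP; split => -[x y]//= [].
by [].
Qed.

End complex_borel.

Section gaussian.
Local Open Scope ereal_scope.
Context d (Omega : measurableType d) (R : realType) (P : probability Omega R).
Local Notation mu := (@lebesgue_measure R).
Local Notation gauss := (@normal_pdf R 0 1).

Let normal_pdf1E (m x : R) : normal_pdf m 1 x = (normal_peak 1 * normal_fun m 1 x)%R.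
Proof. by rewrite /normal_pdf oner_eq0. Qed.

Lemma complex_normal_pdf1E (x y : R) :
  complex_normal_pdf 1 (x +i* y)%C = (gauss x * gauss y)%R.
Proof.
rewrite /complex_normal_pdf !normal_pdf1E /normal_fun /normal_peak.
rewrite !subr0 expr1n !mulr1 mul1r mulrACA -expRD; congr (_ * expR _)%R.
  have pi2 : (0 <= (pi : R) *+ 2)%R by rewrite mulrn_wge0// pi_ge0.
  rewrite -invfM; congr (_^-1)%R.
  by rewrite -expr2 (sqr_sqrtr pi2) mulr_natl.
rewrite /modulus/= sqr_sqrtr ?addr_ge0 ?sqr_ge0//.
by rewrite -mulNr opprD mulrDl.
Qed.

(** Completing the square turns e^(t x) times the standard density into a multiple of the
    density centred at t. *)
Lemma integral_expR_gauss (t : R) :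
  \int[mu]_x (expR (t * x) * gauss x)%:E = (expR (t ^+ 2 / 2))%:E.
Proof.
transitivity (\int[mu]_x ((expR (t ^+ 2 / 2))%:E * (normal_pdf t 1 x)%:E)).
  apply: eq_integral => x _; rewrite -EFinM; congr (_%:E).
  rewrite !normal_pdf1E /normal_fun.
  rewrite mulrCA [RHS]mulrCA -!expRD; congr (_ * expR _)%R.
  by field.
rewrite ge0_integralZl//.
- by rewrite integral_normal_pdf mule1.
- by apply/measurable_EFinP; exact: measurable_normal_pdf.
- by move=> x _; rewrite lee_fin normal_pdf_ge0.
Qed.

Lemma complex_normal_expectation (X : {RV P >-> R[i]}) (f : R[i] -> R) :
  complex_normal 1 X -> measurable_fun setT f -> (forall z, (0 <= f z)%R) ->
  \int[P]_w (f (X w))%:E =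
  \int[mu]_x \int[mu]_y (f (x +i* y)%C * (gauss x * gauss y))%:E.
Proof.
move=> gX mf f0.
have mf' : measurable_fun setT (EFin \o f) by exact/measurable_EFinP.
have f0' z : 0 <= (EFin \o f) z by rewrite lee_fin.
rewrite -[LHS](ge0_integral_distribution X mf')//.
have mpdf : measurable_fun setT (fun u : R * R => gauss u.1 * gauss u.2)%R.
  apply: measurable_funM.
    by apply: (measurableT_comp (measurable_normal_pdf _ _)).
  by apply: (measurableT_comp (measurable_normal_pdf _ _)).
have pdf0 (u : R * R) : (0 <= gauss u.1 * gauss u.2)%R.
  by rewrite mulr_ge0// normal_pdf_ge0.
have mE B : measurable B -> distribution P X B =
  \int[mu \x mu]_(u in (fun u : R * R => (u.1 +i* u.2)%C) @^-1` B) (gauss u.1 * gauss u.2)%:E.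
  by move=> /gX ->; apply: eq_integral => u _; rewrite complex_normal_pdf1E.
rewrite (@ge0_integral_density _ _ _ _ R ((mu \x mu)%E : {measure set (measurableTypeR R *
    measurableTypeR R) -> \bar R})
  _ _ _ measurable_mkcomplex mpdf pdf0 mE _ mf' f0').
rewrite fubini_tonelli1//.
- by apply: emeasurable_funM; [apply: measurableT_comp => //; exact:
    measurable_mkcomplex|exact/measurable_EFinP].
- by move=> u; rewrite /= lee_fin mulr_ge0.
Qed.

Lemma complex_normal_mgf_Re (X : {RV P >-> R[i]}) (t : R) : complex_normal 1 X ->
  \int[P]_w (expR (t * complex.Re (X w)))%:E = (expR (t ^+ 2 / 2))%:E.
Proof.
move=> gX; pose f (z : R[i]) : R := expR (t * complex.Re z).
have mf : measurable_fun setT f.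
  apply: (measurableT_comp (@measurable_expR R)); apply: measurable_funM => //.
  exact: measurable_Re.
have f0 z : (0 <= f z)%R by exact: expR_ge0.
rewrite (complex_normal_expectation gX mf f0) /f.
rewrite -integral_expR_gauss; apply: eq_integral => x _ /=.
under eq_integral do rewrite mulrA EFinM.
rewrite ge0_integralZl//; last 3 first.
- by apply/measurable_EFinP; exact: measurable_normal_pdf.
- by move=> y _; rewrite lee_fin normal_pdf_ge0.
- by rewrite lee_fin mulr_ge0 ?expR_ge0 ?normal_pdf_ge0.
by rewrite integral_normal_pdf mule1.
Qed.

Lemma complex_normal_mgf_Im (X : {RV P >-> R[i]}) (t : R) : complex_normal 1 X ->
  \int[P]_w (expR (t * complex.Im (X w)))%:E = (expR (t ^+ 2 / 2))%:E.
Proof.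
move=> gX; pose f (z : R[i]) : R := expR (t * complex.Im z).
have mf : measurable_fun setT f.
  apply: (measurableT_comp (@measurable_expR R)); apply: measurable_funM => //.
  exact: measurable_Im.
have f0 z : (0 <= f z)%R by exact: expR_ge0.
rewrite (complex_normal_expectation gX mf f0) /f.
transitivity (\int[mu]_x ((expR (t ^+ 2 / 2))%:E * (gauss x)%:E)); last first.
  rewrite ge0_integralZl//.
  - by rewrite integral_normal_pdf mule1.
  - by apply/measurable_EFinP; exact: measurable_normal_pdf.
  - by move=> y _; rewrite lee_fin normal_pdf_ge0.
apply: eq_integral => x _ /=.
under eq_integral do rewrite mulrCA EFinM.
rewrite ge0_integralZl//; last 3 first.
- apply/measurable_EFinP; apply: measurable_funM; last exact: measurable_normal_pdf.
  by apply: (measurableT_comp (@measurable_expR R)); exact: measurable_funM.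
- by move=> y _; rewrite lee_fin mulr_ge0 ?expR_ge0 ?normal_pdf_ge0.
- by rewrite lee_fin normal_pdf_ge0.
by rewrite integral_expR_gauss muleC.
Qed.

(** The moment generating functions of finite linear combinations carry both the
    independence and the Gaussian law, in the only form used below. *)
Definition iid_gaussian (x : nat -> Omega -> R) :=
  (forall n, measurable_fun setT (x n)) /\
  forall N (t : nat -> R), \int[P]_w (expR (\sum_(n < N) t n * x n w))%:E =
    (expR ((\sum_(n < N) t n ^+ 2) / 2))%:E.

Variable g : nat -> {RV P >-> R[i]}.
Hypotheses (g_gauss : forall n, complex_normal 1 (g n)) (g_indep : independent_RVs g).

Let iid_gaussian_part (part : R[i] -> R) : measurable_fun setT part ->
  (forall n t, \int[P]_w (expR (t * part (g n w)))%:E = (expR (t ^+ 2 / 2))%:E) ->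
  iid_gaussian (fun n w => part (g n w)).
Proof.
move=> mpart mgf; split => [n|N t]; first by apply: measurableT_comp.
under eq_integral do rewrite expR_sum.
have := @expectation_prod_independent _ _ _ P g g_indep N (fun n z => expR (t n * part z))
  (fun n => expR (t n ^+ 2 / 2)).
rewrite -expR_sum -mulr_suml; apply.
- by move=> n; apply: measurableT_comp => //; apply: measurable_funM.
- by move=> n z; exact: expR_ge0.
- by move=> n; exact: mgf.
Qed.

Lemma iid_gaussian_Re : iid_gaussian (fun n w => complex.Re (g n w)).
Proof. by apply: iid_gaussian_part => [|n t]; [exact: measurable_Re|exact:
    complex_normal_mgf_Re]. Qed.

Lemma iid_gaussian_Im : iid_gaussian (fun n w => complex.Im (g n w)).
Proof. by apply: iid_gaussian_part => [|n t]; [exact: measurable_Im|exact: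
    complex_normal_mgf_Im]. Qed.

End gaussian.

(** * Integrability of Gaussian series *)

Section gaussian_sums.
Local Open Scope ereal_scope.
Context d (Omega : measurableType d) (R : realType) (P : probability Omega R).
Variable x : nat -> Omega -> R.
Hypothesis gx : iid_gaussian P x.

Let mx n : measurable_fun setT (x n). Proof. by case: gx. Qed.

Lemma measurable_gaussian_sum N (t : nat -> R) :
  measurable_fun setT (fun w => \sum_(n < N) t n * x n w)%R.
Proof. by apply: measurable_sum => n; exact: measurable_funM. Qed.

Lemma measurable_expR_gaussian_sum N (t : nat -> R) :
  measurable_fun setT (fun w => expR (\sum_(n < N) t n * x n w)).
Proof. by apply: (measurableT_comp (@measurable_expR R)); exact: measurable_gaussian_sum. Qed.

(** The bound |y|^p <= K (e^y + e^(-y)) reduces moments to the moment generating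
    function. *)
Lemma gaussian_sum_moment_le (p : R) : (0 <= p)%R -> exists2 C : R, (0 < C)%R &
  forall N (t : nat -> R) (s : R), (0 < s)%R -> (\sum_(n < N) t n ^+ 2 <= s ^+ 2)%R ->
  \int[P]_w (`|\sum_(n < N) t n * x n w| `^ p)%:E <= (C * s `^ p)%:E.
Proof.
move=> p0; have [K K0 HK] := powR_le_expR p0.
exists (K * (2 * expR 2^-1))%R => [|N t s s0 ts].
  by rewrite !mulr_gt0 ?expR_gt0.
pose a n := (t n / s)%R.
have as1 : (\sum_(n < N) a n ^+ 2 <= 1)%R.
  under eq_bigr do rewrite /a expr_div_n.
  by rewrite -mulr_suml ler_pdivrMr ?exprn_gt0// mul1r.
have sum_a w : (\sum_(n < N) t n * x n w = s * \sum_(n < N) a n * x n w)%R.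
  rewrite mulr_sumr; apply: eq_bigr => n _; rewrite /a mulrA mulrCA divff ?gt_eqF//.
  by rewrite mulr1.
have sum_aN w : (- \sum_(n < N) a n * x n w = \sum_(n < N) (- a n) * x n w)%R.
  by rewrite -sumrN; apply: eq_bigr => n _; rewrite mulNr.
pose Kp : R := (K * s `^ p)%R.
have Kp0 : (0 <= Kp)%R by rewrite mulr_ge0 ?powR_ge0// ltW.
have b w : (`|\sum_(n < N) t n * x n w| `^ p <=
    Kp * (expR (\sum_(n < N) a n * x n w) + expR (\sum_(n < N) (- a n) * x n w)))%R.
  rewrite sum_a -sum_aN normrM (gtr0_norm s0).
  move: (\sum_(n < N) a n * x n w)%R => y.
  rewrite powRM ?(ltW s0)// mulrC /Kp mulrAC; apply: ler_wpM2r; first exact: powR_ge0.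
  apply: le_trans (HK _ (normr_ge0 y)) _; apply: ler_wpM2l; first exact: ltW.
  apply: (@le_trans _ _ (expR `|y|)).
    by rewrite ler_expR ler_pdivrMr// ler_peMr// ler1n.
  by case: (leP 0%R y) => y0; [rewrite ger0_norm// lerDl|rewrite ltr0_norm// lerDr]; exact:
      expR_ge0.
have ge1 : \int[P]_w (expR (\sum_(n < N) a n * x n w))%:E <= (expR 2^-1)%:E.
  by rewrite gx.2 lee_fin ler_expR ler_pdivrMr// mulVf.
have ge2 : \int[P]_w (expR (\sum_(n < N) (- a n) * x n w))%:E <= (expR 2^-1)%:E.
  rewrite (gx.2 N (fun n => - a n)%R) lee_fin ler_expR ler_pdivrMr// mulVf//.
  by under eq_bigr do rewrite sqrrN.
have mE1 := measurable_expR_gaussian_sum N a.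
have mE2 := measurable_expR_gaussian_sum N (fun n => - a n)%R.
apply: (@le_trans _ _ (\int[P]_w (Kp%:E * ((expR (\sum_(n < N) a n * x n w))%:E +
   (expR (\sum_(n < N) (- a n) * x n w))%:E)))).
  apply: ge0_le_integral => //.
  - apply/measurable_EFinP; apply: (measurableT_comp (measurable_powR p)).
    by apply: measurableT_comp => //; exact: measurable_gaussian_sum.
  - apply: measurable_funeM; apply: emeasurable_funD; exact/measurable_EFinP.
  - by move=> w _; rewrite -EFinD -EFinM lee_fin.
have EE0 w : 0 <= (expR (\sum_(n < N) a n * x n w))%:E + (expR (\sum_(n < N) (- a n) * x n w))%:E.
  by rewrite -EFinD lee_fin addr_ge0 ?expR_ge0.
rewrite ge0_integralZl//; last by apply: emeasurable_funD; exact/measurable_EFinP.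
rewrite ge0_integralD//; [|exact/measurable_EFinP|exact/measurable_EFinP].
rewrite (_ : (K * (2 * expR 2^-1) * s `^ p)%:E = Kp%:E * ((expR 2^-1)%:E + (expR 2^-1)%:E)); last
    first.
  by rewrite -EFinD -EFinM /Kp; congr (_%:E); ring.
by apply: lee_wpmul2l; [rewrite lee_fin; exact: Kp0|exact: (leeD ge1 ge2)].
Qed.

End gaussian_sums.

Section gaussian_series.
Local Open Scope ereal_scope.
Context dO dT (Omega : measurableType dO) (T : measurableType dT) (R : realType).
Variables (P : probability Omega R) (nu : {finite_measure set T -> \bar R}).
Variable x : nat -> Omega -> R.
Hypothesis gx : iid_gaussian P x.
Variable e : nat -> T -> R.
Hypothesis me : forall n, measurable_fun setT (e n).
Variable f : Omega * T -> R.
Hypothesis mf : measurable_fun setT f.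

Definition gaussian_partial_sum N (u : Omega * T) : R := (\sum_(n < N) e n u.2 * x n u.1)%R.

Hypothesis f_lim :
  (fun N => \int[P \x nu]_u ((f u - gaussian_partial_sum N u) ^+ 2)%:E) @ \oo --> 0.

Lemma measurable_gaussian_partial_sum N : measurable_fun setT (gaussian_partial_sum N).
Proof.
apply: measurable_sum => n; apply: measurable_funM.
  exact: (measurableT_comp (me n) measurable_snd).
exact: (measurableT_comp (gx.1 n) measurable_fst).
Qed.

Let prodT_lty : (P \x nu) setT < +oo.
Proof.
rewrite -setXTT product_measure1E//= probability_setT mul1e.
by have := fin_num_measure nu setT measurableT; rewrite ge0_fin_numE.
Qed.

(** By [gaussian_sum_moment_le] at each point, the partial sums are bounded in
    L^p (P x nu).  The bound passes to f through the truncations min (|f|, K): where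
    f is at distance at most 1 of the N-th partial sum they are controlled by the latter,
    elsewhere by K^p (f - S_N)^2.  First N tends to infinity with K fixed, then K. *)
Lemma gaussian_series_Lp (p : R) (s : T -> R) (D : set T) : (0 < p)%R ->
  measurable_fun setT s -> measurable D -> nu (~` D) = 0 ->
  (forall r, D r -> (0 < s r)%R) ->
  (forall N r, D r -> (\sum_(n < N) e n r ^+ 2 <= s r ^+ 2)%R) ->
  \int[nu]_r (s r `^ p)%:E < +oo ->
  \int[P \x nu]_u (`|f u| `^ p)%:E < +oo.
Proof.
move=> p0 ms mD D0 s0 es sp.
have [C C0 HC] := gaussian_sum_moment_le gx (ltW p0).
have mSp N : measurable_fun setT (fun u => (`|gaussian_partial_sum N u| `^ p)%:E).
  apply/measurable_EFinP; apply: (measurableT_comp (measurable_powR p)).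
  by apply: measurableT_comp => //; exact: measurable_gaussian_partial_sum.
pose A := C%:E * \int[nu]_r (s r `^ p)%:E.
have A0 : 0 <= A.
  apply: mule_ge0; first by rewrite lee_fin ltW.
  by apply: integral_ge0 => r _; rewrite lee_fin powR_ge0.
have Ay : A < +oo by apply: lte_mul_pinfty => //; rewrite lee_fin ltW.
have SA N : \int[P \x nu]_u (`|gaussian_partial_sum N u| `^ p)%:E <= A.
  rewrite fubini_tonelli2//.
  have ms' : measurable_fun setT (fun r => (s r `^ p)%:E).
    by apply/measurable_EFinP; exact: (measurableT_comp (measurable_powR p)).
  have C0' : 0 <= C%:E by rewrite lee_fin ltW.
  rewrite /A -ge0_integralZl//; last by move=> r _; rewrite lee_fin powR_ge0.
  apply: ae_ge0_le_integral => //.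
  - by move=> r _; apply: integral_ge0 => w _; rewrite lee_fin powR_ge0.
  - exact: measurable_fun_fubini_tonelli_G.
  - by move=> r _; rewrite mule_ge0 ?lee_fin ?powR_ge0.
  - exact: measurable_funeM.
  - exists (~` D); split => //; first exact: measurableC.
    move=> r /= h Dr; apply: h => _; rewrite /fubini_G/=.
    rewrite -EFinM /gaussian_partial_sum /=; apply: (HC N (fun n => e n r)); [exact: s0|exact: es].
pose B := (2 `^ p)%:E * (A + (P \x nu) setT).
have By : B < +oo by rewrite lte_mul_pinfty ?lee_fin ?powR_ge0// lte_add_pinfty.
have mfp : measurable_fun setT (fun u => `|f u|%R) by exact: measurableT_comp.
pose h (K : nat) u : R := (Num.min `|f u| K%:R)%R.
have h0 K u : (0 <= h K u)%R by rewrite /h le_min normr_ge0/=.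
have mh K : measurable_fun setT (h K) by exact: measurable_minr.
have mhp K : measurable_fun setT (fun u => (h K u `^ p)%:E).
  by apply/measurable_EFinP; exact: (measurableT_comp (measurable_powR p)).
have hSf K N u : (h K u `^ p <= 2 `^ p * (`|gaussian_partial_sum N u| `^ p + 1) +
    K%:R `^ p * (f u - gaussian_partial_sum N u) ^+ 2)%R.
  have [fS|fS] := leP `|f u - gaussian_partial_sum N u|%R 1%R.
    apply: ler_wpDr; first by rewrite mulr_ge0 ?powR_ge0 ?sqr_ge0.
    have h1 : (h K u <= 2 * Num.max `|gaussian_partial_sum N u| 1)%R.
      rewrite /h ge_min; apply/orP; left; rewrite -[f u](subrK (gaussian_partial_sum N u)).
      apply: le_trans (ler_normD _ _) _; rewrite mulr_natl mulr2n.
      by apply: lerD; rewrite le_max ?fS ?orbT ?lexx.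
    apply: (@le_trans _ _ ((2 * Num.max `|gaussian_partial_sum N u| 1) `^ p)%R).
      by apply: ge0_ler_powR; rewrite ?nnegrE ?(ltW p0)// (le_trans _ h1).
    rewrite powRM ?le_max ?normr_ge0//; apply: ler_wpM2l; first exact: powR_ge0.
    rewrite maxEle; case: ifPn => _.
      by rewrite powR1 lerDr powR_ge0.
    by rewrite lerDl.
  apply: ler_wpDl; first by rewrite mulr_ge0 ?addr_ge0 ?powR_ge0.
  apply: (@le_trans _ _ (K%:R `^ p)%R).
    by apply: ge0_ler_powR; rewrite ?nnegrE ?(ltW p0)// /h ge_min lexx orbT.
  rewrite ler_peMr ?powR_ge0// -real_normK ?num_real//.
  by rewrite exprn_ege1// ltW.
have hB K : \int[P \x nu]_u (h K u `^ p)%:E <= B.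
  have mS2 N : measurable_fun setT (fun u => ((f u - gaussian_partial_sum N u) ^+ 2)%:E).
    apply/measurable_EFinP; apply: measurable_funX; apply: measurable_funB => //.
    exact: measurable_gaussian_partial_sum.
  have K0 : 0 <= (K%:R `^ p)%:E :> \bar R by rewrite lee_fin powR_ge0.
  have p20 : 0 <= (2 `^ p)%:E :> \bar R by rewrite lee_fin powR_ge0.
  have hN N : \int[P \x nu]_u (h K u `^ p)%:E <=
      B + (K%:R `^ p)%:E * \int[P \x nu]_u ((f u - gaussian_partial_sum N u) ^+ 2)%:E.
    have a0 u : setT u -> 0 <= (`|gaussian_partial_sum N u| `^ p)%:E by rewrite lee_fin powR_ge0.
    have b0 u : setT u -> 0 <= ((f u - gaussian_partial_sum N u) ^+ 2)%:E by rewrite lee_fin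
        sqr_ge0.
    have a10 u : setT u -> 0 <= (`|gaussian_partial_sum N u| `^ p)%:E + cst 1 u by move=> _;
        rewrite adde_ge0 ?lee_fin ?powR_ge0.
    have ma1 : measurable_fun setT (fun u => (`|gaussian_partial_sum N u| `^ p)%:E + cst 1 u) by
        exact: emeasurable_funD.
    have pa0 u : setT u -> 0 <= (2 `^ p)%:E * ((`|gaussian_partial_sum N u| `^ p)%:E + cst 1 u).
      by move=> /a10; exact: mule_ge0.
    have kb0 u : setT u -> 0 <= (K%:R `^ p)%:E * ((f u - gaussian_partial_sum N u) ^+ 2)%:E.
      by move=> /b0; exact: mule_ge0.
    have mpa := measurable_funeM (2 `^ p)%:E ma1.
    have mkb := measurable_funeM (K%:R `^ p)%:E (mS2 N).
    apply: (@le_trans _ _ (\int[P \x nu]_u ((2 `^ p)%:E * ((`|gaussian_partial_sum N u| `^ p)%:E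
        + cst 1 u) +
      (K%:R `^ p)%:E * ((f u - gaussian_partial_sum N u) ^+ 2)%:E))).
      apply: (ge0_le_integral _ measurableT) => [u _|||u _].
      - by rewrite lee_fin powR_ge0.
      - exact: mhp.
      - exact: emeasurable_funD.
      - by have := hSf K N u; rewrite -lee_fin.
    rewrite (ge0_integralD _ measurableT pa0 mpa kb0 mkb).
    rewrite (ge0_integralZl _ measurableT ma1 a10 p20) (ge0_integralZl _ measurableT (mS2 N) b0 K0).
    rewrite (ge0_integralD _ measurableT a0 (mSp N))//.
    rewrite integral_cst// mul1e /B.
    by apply: leeD2r; apply: lee_wpmul2l => //; apply: leeD2r; exact: SA.
  have cB : B + (K%:R `^ p)%:E * (\int[P \x nu]_u ((f u - gaussian_partial_sum N u) ^+ 2)%:E) @[N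
      --> \oo] --> B + (K%:R `^ p)%:E * 0.
    apply: cvgeD; [by rewrite mule0 fin_num_adde_defl|exact: cvg_cst|].
    by apply: cvgeZl.
  rewrite -[leRHS]adde0 -(mule0 (K%:R `^ p)%:E) -(cvg_lim _ cB)//.
  by apply: lime_ge; [apply/cvg_ex; exists (B + (K%:R `^ p)%:E * 0)|exact: nearW].
apply: le_lt_trans By.
have hp0 K u : setT u -> 0 <= (h K u `^ p)%:E by rewrite lee_fin powR_ge0.
have hm u : setT u -> {homo (fun K => (h K u `^ p)%:E) : a b / (a <= b)%N >-> a <= b}.
  move=> _ a b ab; rewrite lee_fin; apply: ge0_ler_powR; rewrite ?nnegrE ?(ltW p0)//.
  by rewrite /h le_min ge_min lexx/= ge_min ler_nat ab orbT.
have cv : \int[P \x nu]_u (h K u `^ p)%:E @[K --> \oo] -->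
    \int[P \x nu]_u limn (fun K => (h K u `^ p)%:E).
  exact: (cvg_monotone_convergence measurableT mhp hp0 hm).
have -> : \int[P \x nu]_u (`|f u| `^ p)%:E = \int[P \x nu]_u limn (fun K => (h K u `^ p)%:E).
  apply: eq_integral => u _; apply/esym/cvg_lim => //; apply: cvg_near_cst.
  near=> K; rewrite /h (min_idPl _)//.
  by rewrite ltW//; near: K; exact: nbhs_infty_gtr.
rewrite -(cvg_lim _ cv)//; apply: lime_le; last exact: nearW.
by apply/cvg_ex; eexists; exact: cv.
Unshelve. all: by end_near. Qed.

End gaussian_series.

(** * Anticoncentration of Gaussian sums *)

Section anticoncentration.
Local Open Scope ereal_scope.
Context d (Omega : measurableType d) (R : realType) (P : probability Omega R).
Variable x : nat -> Omega -> R.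
Hypothesis gx : iid_gaussian P x.

(* If |y| <= eta then e^y + e^(-y) <= 22/10, below 3 <= 2 e^(1/2), which bounds the
   expectation of e^X + e^(-X) for a standard Gaussian X; E2 is the expectation of
   (e^X + e^(-X))^2, and K is such that E2 / (2 K) = 1/10. *)
Let eta : R := (ln (11 / 10))%R.
Let E2 : R := (2 * expR 2 + 2)%R.
Let K : R := (5 * E2)%R.

Let eta_gt0 : (0 < eta)%R.
Proof. by apply: ln_gt0; lra. Qed.

Let E2_gt0 : (0 < E2)%R.
Proof. by rewrite addr_gt0// mulr_gt0// expR_gt0. Qed.

Let ch (y : R) : R := (expR y + expR (- y))%R.

Let ch_le (y : R) : (`|y| <= eta -> ch y <= 22 / 10)%R.
Proof.
move=> ye; have e1 : expR eta = (11 / 10)%R by rewrite lnK// posrE; lra.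
have h1 : (expR y <= 11 / 10)%R by rewrite -e1 ler_expR (le_trans (ler_norm _)).
have h2 : (expR (- y) <= 11 / 10)%R.
  by rewrite -e1 ler_expR (le_trans (ler_norm _))// normrN.
by rewrite /ch; lra.
Qed.

(** A Paley-Zygmund argument: cosh X has mean e^(1/2) > 1 and finite variance when X is a
    standard Gaussian variable, so it is not concentrated near 1.  The function W stands
    for the indicator of {|X| > eta sigma}; any function above 1 there is allowed, so
    that W may contain the quotient that bounds a probability in Markov's inequality. *)
Lemma gaussian_sum_anticoncentration : exists eta theta : R, [/\ (0 < eta)%R, (0 < theta)%R &
  forall N (a : nat -> R) (sigma : R) (W : Omega -> \bar R), (0 < sigma)%R ->
  (sigma ^+ 2 <= \sum_(n < N) a n ^+ 2)%R -> measurable_fun setT W ->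
  (forall w, 0 <= W w) ->
  (forall w, (`|\sum_(n < N) a n * x n w| <= eta * sigma)%R \/ 1 <= W w) ->
  theta%:E <= \int[P]_w W w].
Proof.
have K0 : (0 < K)%R by rewrite mulr_gt0.
exists eta, (K^-1)%R; split => //; first by rewrite invr_gt0.
move=> N a sigma W s0 sa mW W0 aW.
pose S : R := Num.sqrt (\sum_(n < N) a n ^+ 2)%R.
have sum0 : (0 <= \sum_(n < N) a n ^+ 2)%R by apply: sumr_ge0 => n _; exact: sqr_ge0.
have sS : (sigma <= S)%R by rewrite -(ger0_norm (ltW s0)) -sqrtr_sqr ler_sqrt.
have S0 : (0 < S)%R by exact: lt_le_trans sS.
pose y (k : R) w := (\sum_(n < N) (k * a n / S) * x n w)%R.
have yE k w : (y k w = k * y 1%R w)%R.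
  by rewrite /y mulr_sumr; apply: eq_bigr => n _; ring.
have y1 w : (y 1%R w = (\sum_(n < N) a n * x n w) / S)%R.
  by rewrite /y mulr_suml; apply: eq_bigr => n _; ring.
have my k : measurable_fun setT (fun w => (expR (y k w))%:E).
  by apply/measurable_EFinP; exact: (measurable_expR_gaussian_sum gx N (fun n => k * a n / S)%R).
have y0 k w : setT w -> 0 <= (expR (y k w))%:E by rewrite lee_fin expR_ge0.
have Iy (k : R) : \int[P]_w (expR (y k w))%:E = (expR (k ^+ 2 / 2))%:E.
  have S2 : (S ^+ 2 = \sum_(n < N) a n ^+ 2)%R by rewrite sqr_sqrtr.
  have -> : (k ^+ 2 = \sum_(n < N) (k * a n / S) ^+ 2)%R.
    under eq_bigr do rewrite expr_div_n exprMn.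
    by rewrite -mulr_suml -mulr_sumr -S2 mulfK// gt_eqF// exprn_gt0.
  exact: (gx.2 N (fun n => k * a n / S)%R).
have mD k l : measurable_fun setT (fun w => (expR (y k w))%:E + (expR (y l w))%:E).
  exact: emeasurable_funD.
have D0 k l w : setT w -> 0 <= (expR (y k w))%:E + (expR (y l w))%:E.
  by move=> _; rewrite adde_ge0// lee_fin expR_ge0.
have ID k l : \int[P]_w ((expR (y k w))%:E + (expR (y l w))%:E) =
    (expR (k ^+ 2 / 2))%:E + (expR (l ^+ 2 / 2))%:E.
  by rewrite (ge0_integralD _ measurableT (y0 k) (my k) (y0 l) (my l)) !Iy.
have c0 (c : R) : (0 <= c)%R -> forall w : Omega, setT w -> 0 <= cst c%:E w by move=> ? ? _;
    rewrite lee_fin.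
have mc (c : R) : measurable_fun setT (fun w : Omega => cst c%:E w) by exact: measurable_cst.
have Ic (c : R) : \int[P]_w (cst c%:E w) = c%:E by rewrite integral_cst//= probability_setT mule1.
pose Q w := (expR (y 2%R w))%:E + (expR (y (-2)%R w))%:E + cst 2%:E w.
have QE w : Q w = ((ch (y 1%R w)) ^+ 2)%:E.
  rewrite /Q (yE 2%R) (yE (-2)%R) /ch /= -!EFinD; congr (_%:E).
  rewrite mulNr sqrrD -!expRM_natl -expRD subrr expR0 mulrN.
  by rewrite addrAC.
have Q0 w : setT w -> 0 <= Q w by move=> _; rewrite QE lee_fin sqr_ge0.
have mQ : measurable_fun setT Q by exact: emeasurable_funD.
have IQ : \int[P]_w Q w = E2%:E.
  rewrite (ge0_integralD _ measurableT (D0 _ _) (mD _ _) (c0 2%R _) (mc _))// ID Ic.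
  by rewrite -!EFinD /E2 sqrrN; congr (_%:E); rewrite expr2 mulfK//; ring.
have K20 : 0 <= (K / 2)%:E :> \bar R by rewrite lee_fin divr_ge0// ltW.
have K20' : 0 <= ((2 * K)^-1)%:E :> \bar R by rewrite lee_fin invr_ge0 mulr_ge0// ltW.
have W0' w : setT w -> 0 <= W w by [].
have mKW := measurable_funeM (K / 2)%:E mW.
have mKQ := measurable_funeM ((2 * K)^-1)%:E mQ.
have KW0 w : setT w -> 0 <= (K / 2)%:E * W w by move=> _; exact: mule_ge0.
have KQ0 w : setT w -> 0 <= ((2 * K)^-1)%:E * Q w by move=> /Q0; exact: mule_ge0.
have mKWQ := emeasurable_funD mKW mKQ.
have KWQ0 w : setT w -> 0 <= (K / 2)%:E * W w + ((2 * K)^-1)%:E * Q w.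
  by move=> wT; rewrite adde_ge0 ?KW0 ?KQ0.
pose U w := cst (22 / 10)%:E w + ((K / 2)%:E * W w + ((2 * K)^-1)%:E * Q w).
have pt w : setT w -> (expR (y 1%R w))%:E + (expR (y (-1)%R w))%:E <= U w.
  move=> wT; have -> : (expR (y 1%R w))%:E + (expR (y (-1)%R w))%:E = (ch (y 1%R w))%:E.
    by rewrite /ch (yE (-1)%R) mulN1r.
  have [small|W1] := aW w.
    apply: (@le_trans _ _ (22 / 10)%:E); last by rewrite leeDl// KWQ0.
    rewrite lee_fin; apply: ch_le; rewrite y1 normrM normfV (gtr0_norm S0).
    rewrite ler_pdivrMr//; apply: le_trans small _.
    by rewrite ler_pM2l.
  apply: (@le_trans _ _ ((K / 2)%:E + ((2 * K)^-1)%:E * Q w)).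
    rewrite QE -EFinM -EFinD lee_fin.
    move: (ch _) K K0 => u k k0.
    rewrite -subr_ge0 (_ : (_ - _ = (2 * k)^-1 * (u - k) ^+ 2)%R).
      by rewrite mulr_ge0 ?sqr_ge0// invr_ge0 mulr_ge0// ltW.
    by field; rewrite gt_eqF.
  rewrite /U -[leLHS]add0e; apply: leeD; first by rewrite lee_fin divr_ge0.
  by apply: leeD2r; rewrite -[leLHS]mule1; exact: lee_wpmul2l.
have IU : \int[P]_w U w = (22 / 10)%:E + ((K / 2)%:E * \int[P]_w W w + ((2 * K)^-1)%:E * E2%:E).
  have h22 : (0 <= 22 / 10 :> R)%R by rewrite divr_ge0.
  rewrite (ge0_integralD _ measurableT (c0 _ h22) (mc _) KWQ0 mKWQ) Ic.
  rewrite (ge0_integralD _ measurableT KW0 mKW KQ0 mKQ).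
  by rewrite (ge0_integralZl _ measurableT mW W0' K20) (ge0_integralZl _ measurableT mQ Q0 K20') IQ.
have : 3%:E <= \int[P]_w U w.
  apply: (@le_trans _ _ (\int[P]_w ((expR (y 1%R w))%:E + (expR (y (-1)%R w))%:E))).
    rewrite ID -EFinD lee_fin sqrrN expr1n.
    have := @expR_ge1Dx R (1 / 2); lra.
  apply: (ge0_le_integral _ measurableT) => //; first exact: D0.
  by apply: emeasurable_funD => //; exact: mc.
rewrite IU; have := integral_ge0 P W0'.
case: (\int[P]_w W w) => [I I0|_ _|//]; last by rewrite leey.
rewrite -!EFinM -!EFinD !lee_fin => h.
have e : ((2 * K)^-1 * E2 = 1 / 10)%R by rewrite /K; field; rewrite gt_eqF.
rewrite e in h.
have : (1 <= K * I)%R by lra.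
by rewrite -ler_pdivrMl// mulr1.
Qed.

End anticoncentration.

(** * Non-integrability of Gaussian series *)

Section gaussian_series_divergence.
Local Open Scope ereal_scope.
Context dO dT (Omega : measurableType dO) (T : measurableType dT) (R : realType).
Variables (P : probability Omega R) (nu : {finite_measure set T -> \bar R}).
Variable x : nat -> Omega -> R.
Hypothesis gx : iid_gaussian P x.
Variable e : nat -> T -> R.
Hypothesis me : forall n, measurable_fun setT (e n).
Variable f : Omega * T -> R.
Hypothesis mf : measurable_fun setT f.
Hypothesis f_lim :
  (fun N => \int[P \x nu]_u ((f u - gaussian_partial_sum x e N u) ^+ 2)%:E) @ \oo --> 0.

Let mdiff N : measurable_fun setT (fun u => (`|f u - gaussian_partial_sum x e N u|)%:E).
Proof.
apply/measurable_EFinP; apply: measurableT_comp => //; apply: measurable_funB => //.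
exact: (measurable_gaussian_partial_sum gx me).
Qed.

(** Convergence in L^2 implies convergence in L^1 by |z| <= tau + z^2 / tau. *)
Let L1_lim (eps : R) (N0 : nat) : (0 < eps)%R -> exists2 N, (N0 <= N)%N &
  \int[P \x nu]_u (`|f u - gaussian_partial_sum x e N u|)%:E <= eps%:E.
Proof.
move=> eps0; pose V := fine ((P \x nu) setT).
have VE : (P \x nu) setT = V%:E.
  rewrite /V fineK// -setXTT product_measure1E//= probability_setT mul1e.
  by have := fin_num_measure nu setT measurableT.
have V0 : (0 <= V)%R by rewrite -lee_fin -VE.
pose tau : R := (eps / (2 * (V + 1)))%R.
have V10 : (0 < V + 1)%R by rewrite ltr_wpDl.
have tau0 : (0 < tau)%R by rewrite divr_gt0// mulr_gt0.
have delta0 : 0 < (tau * (eps / 2))%:E :> \bar R by rewrite lte_fin mulr_gt0// divr_gt0.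
have nearN : \forall N \near \oo, \int[P \x nu]_u ((f u - gaussian_partial_sum x e N u) ^+ 2)%:E
    < (tau * (eps / 2))%:E.
  exact: (f_lim (open_ereal_lt' delta0)).
have nearN0 : \forall N \near \oo, (N0 <= N)%N by exists N0.
have [N [N1 N2]] : exists N, (N0 <= N)%N /\ \int[P \x nu]_u ((f u - gaussian_partial_sum x e N u)
    ^+ 2)%:E < (tau * (eps / 2))%:E.
  near \oo => N; exists N; split; near: N; [exact: nearN0|exact: nearN].
exists N => //.
have mS2 : measurable_fun setT (fun u => ((f u - gaussian_partial_sum x e N u) ^+ 2)%:E).
  apply/measurable_EFinP; apply: measurable_funX; apply: measurable_funB => //.
  exact: (measurable_gaussian_partial_sum gx me).
have S20 u : setT u -> 0 <= ((f u - gaussian_partial_sum x e N u) ^+ 2)%:E by rewrite lee_fin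
    sqr_ge0.
have ti0 : 0 <= (tau^-1)%:E :> \bar R by rewrite lee_fin invr_ge0 ltW.
have mtS2 := measurable_funeM (tau^-1)%:E mS2.
have tS20 u : setT u -> 0 <= (tau^-1)%:E * ((f u - gaussian_partial_sum x e N u) ^+ 2)%:E.
  by move=> /S20; exact: mule_ge0.
have ct0 (u : Omega * T) : setT u -> 0 <= cst tau%:E u by rewrite lee_fin ltW.
have mct : measurable_fun setT (cst tau%:E : Omega * T -> \bar R) by exact: measurable_cst.
apply: (@le_trans _ _ (\int[P \x nu]_u (cst tau%:E u + (tau^-1)%:E * ((f u - gaussian_partial_sum
    x e N u) ^+ 2)%:E))).
  apply: (ge0_le_integral _ measurableT) => [u _|||u _] //.
  - exact: emeasurable_funD.
  - rewrite /= -EFinM -EFinD lee_fin; move: (f u - gaussian_partial_sum x e N u)%R => z.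
    have [zt|zt] := leP `|z|%R tau.
      by rewrite (le_trans zt)// lerDl mulr_ge0 ?sqr_ge0// invr_ge0 ltW.
    apply: ler_wpDl; first exact: ltW.
    by rewrite mulrC ler_pdivlMr// -real_normK ?num_real// expr2 ler_pM2l ?(lt_trans tau0)// ltW.
rewrite (ge0_integralD _ measurableT ct0 mct tS20 mtS2).
rewrite (ge0_integralZl _ measurableT mS2 S20 ti0) integral_cst//= [X in _ * X]VE.
apply: (@le_trans _ _ ((eps / 2)%:E + (eps / 2)%:E)); last first.
  by rewrite -EFinD lee_fin -splitr.
apply: leeD.
  rewrite -EFinM lee_fin (_ : (tau * V = eps / 2 * (V / (V + 1)))%R); last first.
    by rewrite /tau; field; rewrite gt_eqF.
  rewrite ler_piMr//; first by rewrite divr_ge0// ltW.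
  by rewrite ler_pdivrMr// mul1r lerDl.
apply: (@le_trans _ _ ((tau^-1)%:E * (tau * (eps / 2))%:E)).
  by apply: lee_wpmul2l => //; exact: ltW.
by rewrite -EFinM mulKf// gt_eqF.
Unshelve. all: by end_near. Qed.

Let Rintegral_gaussian_partial_sum (D : set T) N w : measurable D ->
  (forall n, nu.-integrable D (EFin \o e n)) ->
  nu.-integrable D (fun r => (gaussian_partial_sum x e N (w, r))%:E) /\
  (\int[nu]_(r in D) gaussian_partial_sum x e N (w, r) =
   \sum_(n < N) (\int[nu]_(r in D) e n r) * x n w)%R.
Proof.
move=> mD eD; elim: N => [|N [IH1 IH2]].
  split.
    by under eq_fun do rewrite /gaussian_partial_sum big_ord0; exact: integrable0.
  under eq_Rintegral do rewrite /gaussian_partial_sum big_ord0.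
  by rewrite Rintegral_cst// mul0r big_ord0.
have eN : nu.-integrable D (fun r => (e N r * x N w)%:E).
  have := integrableZr mD (x N w) (eD N).
  by apply: eq_integrable.
split.
  under eq_fun do rewrite /gaussian_partial_sum big_ord_recr EFinD.
  exact: integrableD.
rewrite big_ord_recr/= -IH2 -RintegralZr//.
under eq_Rintegral do rewrite /gaussian_partial_sum big_ord_recr.
by rewrite RintegralD.
Qed.

(** The integral X over D of a partial sum is Gaussian with standard deviation at least
    sigma.  If the p-th moments were a.s. finite, they would be at most M with probability
    close to 1 for some M, and then |f| <= lambda + lambda^(1-p) |f|^p bounds the
    integral of |f| over D by lambda nu (D) + lambda^(1-p) M.  When this is small with
    respect to sigma, so is X with high probability, against
    [gaussian_sum_anticoncentration]. *)
Lemma gaussian_series_not_Lp (p : R) : (1 <= p)%R ->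
  (forall M eta : R, (0 < M)%R -> (0 < eta)%R ->
   exists (D : set T) (N : nat) (sigma lambda : R),
   [/\ measurable D, forall n, nu.-integrable D (EFin \o e n),
     (0 < sigma)%R /\ (0 < lambda)%R,
     (sigma ^+ 2 <= \sum_(n < N) (\int[nu]_(r in D) e n r) ^+ 2)%R &
     (lambda * fine (nu D) + lambda `^ (1 - p) * M <= eta * sigma)%R]) ->
  ~ {ae P, forall w, \int[nu]_r (`|f (w, r)| `^ p)%:E < +oo}.
Proof.
move=> p1 test aeP.
have [eta [theta [eta0 theta0 anti]]] := gaussian_sum_anticoncentration gx.
have mfp : measurable_fun setT (fun u => (`|f u| `^ p)%:E).
  apply/measurable_EFinP; apply: (measurableT_comp (measurable_powR p)).
  exact: measurableT_comp.
have fp0 u : 0 <= (`|f u| `^ p)%:E by rewrite lee_fin powR_ge0.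
pose I w := \int[nu]_r (`|f (w, r)| `^ p)%:E.
have mI : measurable_fun setT I by exact: (measurable_fun_fubini_tonelli_F _ mfp).
pose B (M : nat) := [set w | M%:R%:E < I w].
have mB M : measurable (B M).
  by rewrite -[B M]setTI; exact: emeasurable_fun_o_infty.
have mcapB : measurable (\bigcap_M B M) by exact: bigcap_measurable.
have PB0 : P (\bigcap_M B M) = 0.
  apply/negligibleP => //; apply: negligibleS aeP => w Bw /= Iw.
  have [M IM] : exists M : nat, I w < M%:R%:E.
    have : 0 <= I w by exact: integral_ge0.
    move: Iw; rewrite -/(I w); case: (I w) => // r _; rewrite lee_fin => r0.
    by exists (Num.bound r); rewrite lte_fin archi_boundP.
  by have := Bw M Logic.I; rewrite /B/= ltNge (ltW IM).
have [M0 PBM] : exists M, P (B M) < (theta / 4)%:E.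
  have t0 : P (\bigcap_M B M) < (theta / 4)%:E by rewrite PB0 lte_fin divr_gt0.
  have cvB : (P \o B) M @[M --> \oo] --> P (\bigcap_M B M).
    apply: nonincreasing_cvg_mu => //.
      by rewrite (le_lt_trans (probability_le1 _ _))// ltry.
    move=> a b ab; rewrite subsetEset => w; rewrite /B/=; apply: le_lt_trans.
    by rewrite lee_fin ler_nat.
  have nearB : \forall M \near \oo, P (B M) < (theta / 4)%:E.
    exact: (cvB _ (open_ereal_lt' t0)).
  by near \oo => M; exists M; near: M.
have [D [N0 [sigma [lambda [mD eD [sigma0 lambda0] sigmaN lM]]]]] :=
  test (M0.+1%:R) (eta / 2)%R (ltr0Sn _ _) (divr_gt0 eta0 (ltr0Sn R 1)).
pose eps : R := (eta * sigma / 2 * (theta / 4))%R.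
have hs0 : (0 < eta * sigma / 2)%R by rewrite divr_gt0// mulr_gt0.
have eps0 : (0 < eps)%R by rewrite /eps mulr_gt0// divr_gt0.
have [N N0N L1N] := L1_lim N0 eps0.
pose Y w := \int[nu]_r (`|f (w, r) - gaussian_partial_sum x e N (w, r)|)%:E.
have mY : measurable_fun setT Y by exact: (measurable_fun_fubini_tonelli_F _ (mdiff N)).
have Y0 w : setT w -> 0 <= Y w by move=> _; exact: integral_ge0.
pose k : R := (eta * sigma / 2)^-1%R.
have k0 : 0 <= k%:E by rewrite lee_fin invr_ge0 ltW.
(* B M0 is the event where the p-th moment exceeds M0; elsewhere X can be large only
   if the L^1 distance Y of f to the partial sum is. *)
pose W w := (\1_(B M0) w)%:E + k%:E * Y w.
have mkY := measurable_funeM k%:E mY.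
have kY0 w : setT w -> 0 <= k%:E * Y w by move=> /Y0; exact: mule_ge0.
have mindic : measurable_fun setT (fun w => (\1_(B M0) w)%:E : \bar R).
  by apply/measurable_EFinP; exact: measurable_indic.
have indic0 w : setT w -> 0 <= (\1_(B M0) w)%:E :> \bar R by rewrite lee_fin.
have mW : measurable_fun setT W by exact: emeasurable_funD.
have W0 w : 0 <= W w by rewrite adde_ge0 ?indic0 ?kY0.
have EW : \int[P]_w W w < theta%:E.
  rewrite (ge0_integralD _ measurableT indic0 mindic kY0 mkY).
  rewrite (ge0_integralZl _ measurableT mY Y0 k0) integral_indic// setIT.
  have EY : \int[P]_w Y w <= eps%:E.
    by apply: le_trans L1N; rewrite fubini_tonelli1//.
  apply: (@le_lt_trans _ _ ((theta / 4)%:E + k%:E * eps%:E)).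
    by apply: leeD; [exact: ltW|exact: lee_wpmul2l].
  rewrite -EFinM -EFinD lte_fin /k /eps mulKf ?gt_eqF//; lra.
pose a n := (\int[nu]_(r in D) e n r)%R.
have sa : (sigma ^+ 2 <= \sum_(n < N) a n ^+ 2)%R.
  apply: le_trans sigmaN _; rewrite -!(big_mkord xpredT (fun n => a n ^+ 2)%R).
  rewrite [leRHS](big_cat_nat (n := N0))//= lerDl.
  by apply: sumr_ge0 => n _; exact: sqr_ge0.
suff aW w : (`|\sum_(n < N) a n * x n w| <= eta * sigma)%R \/ 1 <= W w.
  by have := anti N a sigma W sigma0 sa mW W0 aW; rewrite leNgt EW.
have [wB|wB] := pselect (B M0 w).
  by right; rewrite /W indicE mem_set// leeDl// kY0.
have IM : I w <= M0%:R%:E by rewrite leNgt; apply/negP.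
have [Ys|Ys] := leP (Y w) (eta * sigma / 2)%:E; last first.
  right; rewrite /W; apply: (@le_trans _ _ (k%:E * Y w)); last by rewrite leeDr// indic0.
  apply: (@le_trans _ _ (k%:E * (eta * sigma / 2)%:E)).
    by rewrite -EFinM /k mulVf// gt_eqF.
  by apply: lee_wpmul2l => //; exact: ltW.
left; have [iS SE] := Rintegral_gaussian_partial_sum N w mD eD; rewrite -SE -lee_fin.
have mfw : measurable_fun setT (fun r => f (w, r)) by exact: measurable_fun_pair2.
have mSw : measurable_fun setT (fun r => gaussian_partial_sum x e N (w, r)).
  exact: (measurable_fun_pair2 w (measurable_gaussian_partial_sum gx me N)).
have mA : measurable_fun D (fun r => (`|f (w, r)|)%:E).
  by apply: measurable_funTS; apply/measurable_EFinP; exact: measurableT_comp.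
have mC : measurable_fun setT (fun r => (`|f (w, r) - gaussian_partial_sum x e N (w, r)|)%:E).
  by apply/measurable_EFinP; apply: measurableT_comp => //; exact: measurable_funB.
have mCD : measurable_fun D (fun r => (`|f (w, r) - gaussian_partial_sum x e N (w, r)|)%:E).
  exact: measurable_funTS.
have mP : measurable_fun setT (fun r => (`|f (w, r)| `^ p)%:E).
  apply/measurable_EFinP; apply: (measurableT_comp (measurable_powR p)).
  exact: measurableT_comp.
have mPD : measurable_fun D (fun r => (`|f (w, r)| `^ p)%:E) by exact: measurable_funTS.
rewrite EFin_normr_Rintegral//.
apply: le_trans (le_abse_integral _ mD _) _; first by case/integrableP: iS.
apply: (@le_trans _ _ (\int[nu]_(r in D) ((`|f (w, r)|)%:E + (`|f (w, r) - gaussian_partial_sum x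
    e N (w, r)|)%:E))).
  apply: (ge0_le_integral _ mD) => [r _|||r _].
  - by [].
  - by apply: measurableT_comp => //; case/integrableP: iS.
  - exact: emeasurable_funD.
  - rewrite -EFinD lee_fin -[X in (`|X| <= _)%R](subKr (f (w, r))).
    exact: ler_normB.
rewrite (ge0_integralD _ mD)//.
have -> : (eta * sigma)%:E = (eta / 2 * sigma)%:E + (eta * sigma / 2)%:E.
  by rewrite -EFinD; congr (_%:E); field.
apply: leeD; last first.
  by apply: le_trans Ys; apply: ge0_subset_integral.
have lp0 : 0 <= (lambda `^ (1 - p))%:E :> \bar R by rewrite lee_fin powR_ge0.
have mlP := measurable_funeM (lambda `^ (1 - p))%:E mPD.
have pD0 r : D r -> 0 <= (`|f (w, r)| `^ p)%:E by rewrite lee_fin powR_ge0.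
have lP0 r : D r -> 0 <= (lambda `^ (1 - p))%:E * (`|f (w, r)| `^ p)%:E.
  by move=> /pD0; exact: mule_ge0.
have cl0 r : D r -> 0 <= cst lambda%:E r by rewrite lee_fin ltW.
have mcl : measurable_fun D (cst lambda%:E : T -> \bar R) by exact: measurable_cst.
apply: (@le_trans _ _ (\int[nu]_(r in D) (cst lambda%:E r + (lambda `^ (1 - p))%:E * (`|f (w, r)|
    `^ p)%:E))).
  apply: (ge0_le_integral _ mD) => [r _|||r _] //.
  - exact: emeasurable_funD.
  - rewrite /= -EFinM -EFinD lee_fin; move: `|f (w, r)|%R (normr_ge0 (f (w, r))) => z z0.
    have [zl|lz] := leP z lambda.
      by rewrite (le_trans zl)// lerDl mulr_ge0 ?powR_ge0.
    have z0' : (0 < z)%R by exact: lt_trans lz.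
    apply: ler_wpDl; first exact: ltW.
    have {1}-> : z = (z `^ (1 - p) * z `^ p)%R.
      by rewrite -powRD ?subrK ?powRr1// gt_eqF// implybT.
    apply: ler_wpM2r; first exact: powR_ge0.
    have -> : (1 - p = - (p - 1))%R by rewrite opprB.
    rewrite !powRN lef_pV2 ?posrE ?powR_gt0//.
    by apply: ge0_ler_powR; rewrite ?nnegrE ?subr_ge0 ?(ltW lambda0) ?(ltW lz).
rewrite (ge0_integralD _ mD cl0 mcl lP0 mlP) (ge0_integralZl _ mD mPD pD0 lp0) integral_cst//=.
rewrite -(@fineK _ (nu D)); last exact: fin_num_measure.
apply: (@le_trans _ _ (lambda%:E * (fine (nu D))%:E + (lambda `^ (1 - p))%:E * (M0.+1%:R)%:E));
    last first.
  by rewrite -!EFinM -EFinD lee_fin.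
apply: leeD2l; apply: lee_wpmul2l => //.
apply: (@le_trans _ _ (I w)); first by apply: ge0_subset_integral.
by apply: le_trans IM _; rewrite lee_fin ler_nat.
Unshelve. all: by end_near. Qed.

End gaussian_series_divergence.

(** * The radial measure *)

Section radial_measure.
Local Open Scope ereal_scope.
Context {R : realType}.
Variable m : nat.
Local Notation mu := (@lebesgue_measure R).
Local Notation rad := (@radial_measure R m.+1).

Lemma ge0_integral_radial (h : R -> \bar R) : measurable_fun setT h ->
  (forall r, 0 <= h r) ->
  \int[rad]_r h r = \int[mu]_(r in `[0%R, 1%R]) (h r * (r ^+ m)%:E).
Proof.
move=> mh h0; pose w (r : R) : R := (r ^+ m * \1_(`[0%R, 1%R] : set R) r)%R.
have mw : measurable_fun setT w by apply: measurable_funM => //; exact: measurable_indic.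
have w0 r : (0 <= w r)%R.
  rewrite /w indicE; have [|_] := boolP (r \in _); last by rewrite mulr0.
  by rewrite inE/= in_itv/= => /andP[r0 _]; rewrite mulr1 exprn_ge0.
have radE B : measurable B -> rad B = \int[mu]_(r in (@id R) @^-1` B) (w r)%:E.
  move=> mB; rewrite preimage_id /radial_measure/= integral_mkcondr.
  apply: eq_integral => r _; rewrite patchE /w indicE; case: ifPn => rI.
    by rewrite mulr1.
  by rewrite mulr0.
have := @ge0_integral_density _ _ _ _ R mu rad id w (@measurable_id _ _ setT) mw w0 radE _ mh h0.
move=> ->; rewrite [RHS]integral_mkcond; apply: eq_integral => r _.
rewrite patchE /w indicE; case: ifPn => rI; first by rewrite mulr1.
by rewrite mulr0 mule0.
Qed.

Lemma radial_measure_itv (delta : R) : (0 <= delta <= 1)%R ->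
  rad `]0%R, delta]%classic = (delta ^+ m.+1 / m.+1%:R)%:E.
Proof.
move=> /andP[d0 d1]; rewrite /radial_measure.
have -> : `]0%R, delta]%classic `&` `[0%R, 1%R]%classic = `]0%R, delta]%classic :> set R.
  apply/seteqP; split => r /=; rewrite !in_itv/=; first by case.
  by move=> /andP[r0 rd]; rewrite r0 rd ltW//= (le_trans rd).
rewrite integral_itv_obnd_cbnd; last first.
  by apply/measurable_EFinP; apply: measurable_funTS; exact: measurable_funX.
have cX : {within `[0%R, delta], continuous (fun r : R => r ^+ m)%R}.
  by apply: continuous_subspaceT => r; exact: exprn_continuous.
rewrite -[LHS]fineK; last first.
  by apply: integrable_fin_num => //; exact: (continuous_itv_integrable cX).
congr EFin; pose G (r : R) : R := (r ^+ m.+1 / m.+1%:R)%R.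
transitivity (G delta - G 0)%R.
  apply: Rintegral_FTC2 => // r _; rewrite /G; derive_rules; field.
  by rewrite nat1r pnatr_eq0.
by rewrite /G expr0n mul0r subr0.
Qed.

Lemma radial_measure_setC : rad (~` `]0%R, 1%R]%classic) = 0.
Proof.
have radT : rad setT = (m.+1%:R^-1)%:E.
  rewrite /radial_measure setTI.
  have := @radial_measure_itv 1%R; rewrite ler01 lexx => /(_ isT).
  rewrite expr1n mul1r => <-; rewrite /radial_measure.
  rewrite (_ : _ `&` _ = `]0%R, 1%R]%classic); last first.
    apply/seteqP; split => r /=; rewrite !in_itv/=; first by case.
    by move=> /andP[r0 rd]; rewrite r0 rd ltW.
  rewrite integral_itv_obnd_cbnd//.
  by apply/measurable_EFinP; apply: measurable_funTS; exact: measurable_funX.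
have h1 := @radial_measure_itv 1%R; rewrite ler01 lexx expr1n mul1r in h1.
have mI : measurable (`]0%R, 1%R]%classic : set R) by [].
have E : rad setT = rad `]0%R, 1%R]%classic + rad (~` `]0%R, 1%R]%classic).
  by rewrite -(setUv `]0%R, 1%R]%classic) measureU//; [exact: measurableC|rewrite setICr].
have fC : rad (~` `]0%R, 1%R]%classic) \is a fin_num.
  by apply: fin_num_measure; exact: measurableC.
move: E fC; rewrite radT h1//; case: (rad _) => //= r.
by move: (_^-1)%R => v; rewrite -EFinD => h _; have := EFin_inj h => hv; congr EFin; move: hv;
    clear; lra.
Qed.

(** On [1 / (n + 1), 1] the integral is at most 1 / b, by the primitive r^b / b. *)
Lemma integral_powR_lty (b : R) : (0 < b)%R ->
  \int[mu]_(r in `]0%R, 1%R]) (r `^ (b - 1))%:E < +oo.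
Proof.
move=> b0; pose F (n : nat) : set R := `[(n.+1%:R^-1)%R, 1%R]%classic.
have -> : `]0%R, 1%R]%classic = \bigcup_n F n.
  apply/seteqP; split => r.
    rewrite /= in_itv/= => /andP[r0 r1]; exists (Num.bound (r^-1)%R) => //.
    rewrite /F/= in_itv/= r1 andbT invf_ple ?posrE//.
    have := archi_boundP (ltW (etrans (invr_gt0 r) r0)) => /ltW h.
    by apply: le_trans h _; rewrite ler_nat.
  by move=> [n _]; rewrite /F/= !in_itv/= => /andP[h ->]; rewrite andbT (lt_le_trans _ h)//
      invr_gt0.
have mf n : measurable_fun (F n) (fun r : R => (r `^ (b - 1))%:E).
  by apply: measurable_funTS; apply/measurable_EFinP; exact: measurable_powR.
have ndF : nondecreasing_seq F.
  move=> n k nk; rewrite subsetEset => r; rewrite /F/= !in_itv/= => /andP[h ->].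
  rewrite andbT; apply: le_trans h.
  by rewrite lef_pV2 ?posrE// ler_nat.
have mF n : measurable (F n) by rewrite /F; exact: measurable_itv.
have f0 n r : F n r -> 0 <= (r `^ (b - 1))%:E by rewrite lee_fin powR_ge0.
have cv := @ge0_nondecreasing_set_cvg_integral _ (measurableTypeR R) R F _ (@lebesgue_measure R)
    ndF mF mf f0.
apply: (@le_lt_trans _ _ (b^-1)%:E); last exact: ltry.
rewrite -(cvg_lim _ cv)//; apply: lime_le; first by apply/cvg_ex; eexists; exact: cv.
apply: nearW => n.
have n0 : (0 < n.+1%:R^-1 :> R)%R by rewrite invr_gt0.
have n1 : (n.+1%:R^-1 <= 1 :> R)%R by rewrite invf_le1// ler1n.
have D (a r : R) : (0 < r)%R -> is_derive r (1%R : R) (fun r : R => r `^ a)%R (a * r `^ (a - 1))%R.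
  by move=> r0; exact: is_derive1_powR.
have cX : {within `[n.+1%:R^-1%R, 1%R], continuous (fun r : R => r `^ (b - 1))%R}.
  apply: is_derive_within_continuous => r /andP[r0 _].
  exact: D (lt_le_trans n0 r0).
have iX : mu.-integrable (F n) (fun r : R => (r `^ (b - 1))%:E).
  exact: (continuous_itv_integrable cX).
have fX : \int[mu]_(r in F n) (r `^ (b - 1))%:E \is a fin_num.
  by apply: integrable_fin_num; [exact: measurable_itv|exact: iX].
rewrite -[leLHS]fineK//.
rewrite lee_fin; pose G (r : R) : R := (r `^ b / b)%R.
have -> : (fine (\int[mu]_(r in F n) (r `^ (b - 1))%:E) = G 1 - G n.+1%:R^-1)%R.
  apply: Rintegral_FTC2 => // r /andP[r0 _]; rewrite /G.
  have Db := D b r (lt_le_trans n0 r0).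
  by derive_rules; field; rewrite gt_eqF.
rewrite /G powR1 mul1r gerBl; apply: mulr_ge0; first exact: powR_ge0.
by rewrite invr_ge0 ltW.
Qed.

End radial_measure.

(** * Real and imaginary parts of the random series *)

Section modulus.
Context {R : realType}.
Implicit Types z : R[i].

Lemma modulus_ge0 z : 0 <= modulus z.
Proof. by case: z => a b; exact: sqrtr_ge0. Qed.

Lemma modulus_sqr z : modulus z ^+ 2 = complex.Re z ^+ 2 + complex.Im z ^+ 2.
Proof. by case: z => a b /=; rewrite /modulus/= sqr_sqrtr// addr_ge0// sqr_ge0. Qed.

Lemma modulusE z : modulus z = Num.sqrt (complex.Re z ^+ 2 + complex.Im z ^+ 2).
Proof. by case: z. Qed.

Lemma normr_Re_le_modulus z : `|complex.Re z| <= modulus z.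
Proof.
rewrite -ler_sqr ?nnegrE ?modulus_ge0// real_normK ?num_real// modulus_sqr.
by rewrite lerDl sqr_ge0.
Qed.

Lemma modulus_le_ReIm z : modulus z <= `|complex.Re z| + `|complex.Im z|.
Proof.
rewrite -ler_sqr ?nnegrE ?modulus_ge0 ?addr_ge0// modulus_sqr sqrrD.
rewrite !real_normK ?num_real// lerD2r lerDl mulrn_wge0// mulr_ge0//.
Qed.

Lemma powR_modulus_le z (p : R) : 0 < p ->
  modulus z `^ p <= 2 `^ p * (`|complex.Re z| `^ p + `|complex.Im z| `^ p).
Proof.
move=> p0; set a := `|_|; set b := `|complex.Im z|.
have a0 : 0 <= a by exact: normr_ge0.
have b0 : 0 <= b by exact: normr_ge0.
have H c : 0 <= c -> modulus z <= 2 * c -> modulus z `^ p <= 2 `^ p * c `^ p.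
  move=> c0 zc; rewrite -powRM//; apply: ge0_ler_powR => //.
  - exact: ltW.
  - by rewrite nnegrE modulus_ge0.
  - by rewrite nnegrE mulr_ge0.
have zab : modulus z <= a + b := modulus_le_ReIm z.
have [ab|/ltW ba] := leP a b.
- apply: le_trans (H b b0 _) _; first by move: zab ab; clear; lra.
  by rewrite ler_wpM2l ?powR_ge0// lerDr powR_ge0.
- apply: le_trans (H a a0 _) _; first by move: zab ba; clear; lra.
  by rewrite ler_wpM2l ?powR_ge0// lerDl powR_ge0.
Qed.

Lemma measurable_modulus : measurable_fun setT (@modulus R).
Proof.
rewrite (_ : @modulus R = fun z => Num.sqrt (complex.Re z ^+ 2 + complex.Im z ^+ 2)); last first.
  by apply/funext => z; exact: modulusE.
have msqrt : measurable_fun [set: R] (@Num.sqrt R).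
  exact: continuous_measurable_fun (@sqrt_continuous R).
apply: (measurableT_comp msqrt); apply: measurable_funD; apply: measurable_funX.
  exact: measurable_Re.
exact: measurable_Im.
Qed.

End modulus.

Section Lnorm_modulus.
Context d (T : measurableType d) (R : realType).
Variables (nu : {measure set T -> \bar R}) (h : T -> R[i]) (p : R).
Hypothesis p0 : 0 < p.

Lemma poweR_Lnorm_modulus :
  (Lnorm nu p%:E (fun r => (modulus (h r))%:E) `^ p =
   \int[nu]_r (modulus (h r) `^ p)%:E)%E.
Proof.
rewrite (poweR_Lnorm nu _ (lt0r_neq0 p0)); apply: eq_integral => r _.
by rewrite abse_EFin ger0_norm ?modulus_ge0// poweR_EFin.
Qed.

Lemma Lnorm_modulus_lty :
  (Lnorm nu p%:E (fun r => (modulus (h r))%:E) < +oo)%E <->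
  (\int[nu]_r (modulus (h r) `^ p)%:E < +oo)%E.
Proof.
rewrite -poweR_Lnorm_modulus; split; first exact: poweR_lty.
by apply: lty_poweRy; rewrite gt_eqF.
Qed.

End Lnorm_modulus.

Lemma ge0_poweR2 (R : realType) (x : \bar R) : (0 <= x)%E -> (x `^ 2 = x * x)%E.
Proof.
case: x => [x| |]; rewrite ?lee_fin//.
- by move=> x0; rewrite poweR_EFin powR_mulrn// -EFinM expr2.
- by rewrite poweRyr ?gt_eqF// mulyy.
Qed.

(** The results on Gaussian series concern real functions; they are applied to the real
    and to the imaginary part of F, which are the sums of the series of the real and of
    the imaginary parts of the g_n. *)
Section real_and_imaginary_parts.
Context dO (Omega : measurableType dO) (R : realType).
Variables (P : probability Omega R) (d : nat).
Local Notation rad := (@radial_measure R d).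
Variables (g : nat -> {RV P >-> R[i]}) (c : nat -> R) (F : Omega * R -> R[i]).
Hypothesis FS : is_random_series P d (fun n => g n) c F.
Hypothesis me : forall n, measurable_fun setT (@eigenfun R d n).
Local Notation S := (partial_sum d (fun n => g n) c).
Let e n r := c n * @eigenfun R d n r.

Lemma Re_partial_sum N w r : complex.Re (S N w r) =
  gaussian_partial_sum (fun n w => complex.Re (g n w)) e N (w, r).
Proof.
rewrite /partial_sum /gaussian_partial_sum; elim: N => [|N IH]; first by rewrite !big_ord0.
rewrite !big_ord_recr/= -IH; move: (\sum_(_ < _) _) => z.
by case: z (g N w) => a b [a' b']/=; rewrite mulr0 subr0 [in RHS]mulrC.
Qed.

Lemma Im_partial_sum N w r : complex.Im (S N w r) =
  gaussian_partial_sum (fun n w => complex.Im (g n w)) e N (w, r).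
Proof.
rewrite /partial_sum /gaussian_partial_sum; elim: N => [|N IH]; first by rewrite !big_ord0.
rewrite !big_ord_recr/= -IH; move: (\sum_(_ < _) _) => z.
by case: z (g N w) => a b [a' b']/=; rewrite mulr0 add0r [in RHS]mulrC.
Qed.

Let mg_Re n : measurable_fun setT (fun w => complex.Re (g n w)).
Proof. by apply: measurableT_comp; [exact: measurable_Re|exact: measurable_funP]. Qed.

Let mg_Im n : measurable_fun setT (fun w => complex.Im (g n w)).
Proof. by apply: measurableT_comp; [exact: measurable_Im|exact: measurable_funP]. Qed.

Let measurable_partial_sum (x : nat -> Omega -> R) N :
  (forall n, measurable_fun setT (x n)) ->
  measurable_fun setT (gaussian_partial_sum x e N : Omega * R -> R).
Proof.
move=> mx; rewrite /gaussian_partial_sum; apply: measurable_sum => n.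
apply: measurable_funM.
  apply: measurable_funM => //.
  by apply: measurableT_comp; [exact: me|exact: measurable_snd].
by apply: measurableT_comp; [exact: mx|exact: measurable_fst].
Qed.

Lemma measurable_Re_series : measurable_fun setT (fun u => complex.Re (F u)).
Proof. by apply: measurableT_comp; [exact: measurable_Re|exact: FS.1]. Qed.

Lemma measurable_Im_series : measurable_fun setT (fun u => complex.Im (F u)).
Proof. by apply: measurableT_comp; [exact: measurable_Im|exact: FS.1]. Qed.

Let ReB a b : complex.Re (a - b) = complex.Re a - complex.Re b :> R.
Proof. by case: a b => a a' [b b']. Qed.

Let ImB a b : complex.Im (a - b) = complex.Im a - complex.Im b :> R.
Proof. by case: a b => a a' [b b']. Qed.

Let modulus_sqrE N u : modulus (F u - S N u.1 u.2) ^+ 2 =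
  (complex.Re (F u) - gaussian_partial_sum (fun n w => complex.Re (g n w)) e N u) ^+ 2 +
  (complex.Im (F u) - gaussian_partial_sum (fun n w => complex.Im (g n w)) e N u) ^+ 2.
Proof.
case: u => w r; rewrite modulus_sqr ReB ImB Re_partial_sum Im_partial_sum.
by [].
Qed.

Let measurable_ReB N : measurable_fun setT (fun u =>
  (complex.Re (F u) - gaussian_partial_sum (fun n w => complex.Re (g n w)) e N u) ^+ 2).
Proof.
apply: measurable_funX; apply: measurable_funB; first exact: measurable_Re_series.
exact: measurable_partial_sum.
Qed.

Let measurable_ImB N : measurable_fun setT (fun u =>
  (complex.Im (F u) - gaussian_partial_sum (fun n w => complex.Im (g n w)) e N u) ^+ 2).
Proof.
apply: measurable_funX; apply: measurable_funB; first exact: measurable_Im_series.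
exact: measurable_partial_sum.
Qed.

Let sqr_lim : (fun N => \int[P \x rad]_u
  (modulus (F u - S N u.1 u.2) ^+ 2)%:E)%E @ \oo --> 0%E.
Proof.
have lim := FS.2.
have def00 : ((0 : \bar R) *? 0)%E by rewrite mule_def_fin.
have lim2 := cvgeM def00 lim lim; rewrite mule0 in lim2.
pose L N := Lnorm (P \x rad)%E 2%:E (fun u => (modulus (F u - S N u.1 u.2))%:E).
rewrite (_ : (fun N => _) = (fun N => L N * L N)%E); first exact: lim2.
apply/funext => N; rewrite /L.
rewrite -ge0_poweR2 ?Lnorm_ge0// (poweR_Lnorm_modulus _ _ (ltr0n _ 2)).
by apply: eq_integral => u _; rewrite powR_mulrn ?modulus_ge0.
Qed.

Let measurable_modulus_sqr N :
  measurable_fun setT (fun u => (modulus (F u - S N u.1 u.2) ^+ 2)%:E).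
Proof.
apply/measurable_EFinP; have := measurable_funD (measurable_ReB N) (measurable_ImB N).
by apply: eq_measurable_fun => u _; rewrite /= modulus_sqrE.
Qed.

Lemma Re_series_lim :
  (fun N => \int[P \x rad]_u
     ((complex.Re (F u) - gaussian_partial_sum (fun n w => complex.Re (g n w)) e N u) ^+ 2)%:E)%E
  @ \oo --> 0%E.
Proof.
apply: (squeeze_cvge _ (cvg_cst 0%E) sqr_lim); apply: nearW => N.
rewrite integral_ge0/=; last by move=> u _; rewrite lee_fin sqr_ge0.
apply: (ge0_le_integral _ measurableT) => [u _|||u _].
- by rewrite lee_fin sqr_ge0.
- by apply/measurable_EFinP; exact: measurable_ReB.
- exact: measurable_modulus_sqr.
- by rewrite lee_fin modulus_sqrE lerDl sqr_ge0.
Qed.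

Lemma Im_series_lim :
  (fun N => \int[P \x rad]_u
     ((complex.Im (F u) - gaussian_partial_sum (fun n w => complex.Im (g n w)) e N u) ^+ 2)%:E)%E
  @ \oo --> 0%E.
Proof.
apply: (squeeze_cvge _ (cvg_cst 0%E) sqr_lim); apply: nearW => N.
rewrite integral_ge0/=; last by move=> u _; rewrite lee_fin sqr_ge0.
apply: (ge0_le_integral _ measurableT) => [u _|||u _].
- by rewrite lee_fin sqr_ge0.
- by apply/measurable_EFinP; exact: measurable_ImB.
- exact: measurable_modulus_sqr.
- by rewrite lee_fin modulus_sqrE lerDr sqr_ge0.
Qed.

End real_and_imaginary_parts.

(** * Subcritical exponents *)

Lemma ae_Lp_section dO dT (Omega : measurableType dO) (T : measurableType dT)
    (R : realType) (P : probability Omega R)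
    (nu : {finite_measure set T -> \bar R}) (f : Omega * T -> R) (p : R) :
  measurable_fun setT f ->
  (\int[P \x nu]_u (`|f u| `^ p)%:E < +oo)%E ->
  {ae P, forall w, (\int[nu]_r (`|f (w, r)| `^ p)%:E < +oo)%E}.
Proof.
move=> mf foo.
have mfp : measurable_fun setT (fun u => (`|f u| `^ p)%:E).
  apply/measurable_EFinP; apply: (measurableT_comp (measurable_powR p)).
  exact: measurableT_comp.
have : (P \x nu)%E.-integrable setT (fun u => (`|f u| `^ p)%:E).
  apply/integrableP; split => //; rewrite (_ : (\int[_]_(_ in _) _)%E = (\int[P \x nu]_u (`|f u|
      `^ p)%:E)%E)//.
  apply: eq_integral => u _.
  by rewrite abse_EFin ger0_norm ?powR_ge0.
move=> /ae_integrable1; apply: filterS => w /integrableP[_].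
rewrite (_ : (\int[_]_(_ in _) _)%E = (\int[nu]_r (`|f (w, r)| `^ p)%:E)%E)//.
apply: eq_integral => r _.
by rewrite abse_EFin ger0_norm ?powR_ge0.
Qed.

Section random_series_norms.
Context dO (Omega : measurableType dO) (R : realType) (P : probability Omega R).
Variable m : nat.
Local Notation d := m.+2.
Local Notation rad := (@radial_measure R d).
Variables (g : nat -> {RV P >-> R[i]}) (c : nat -> R) (F : Omega * R -> R[i]).
Hypothesis g_gaussian : forall n, complex_normal 1 (g n).
Hypothesis g_indep : independent_RVs g.
Hypothesis FS : is_random_series P d (fun n => g n) c F.
Hypothesis me : forall n, measurable_fun setT (@eigenfun R d n).
Let e n r := c n * @eigenfun R d n r.

Let mce n : measurable_fun setT (e n).
Proof. exact: measurable_funM. Qed.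

(** The standard deviation of the series at r is at most A r^(-a/2), and r^(-ap/2) is
    integrable for r^(d-1) dr as soon as a p < 2 d. *)
Lemma random_series_Lp_lty (alpha C p : R) : 0 < alpha -> 0 < C ->
  (forall n, `|c n| <= alpha / n.+1%:R) ->
  (forall a, 0 < a -> m%:R <= a -> forall N (r : R), 0 < r <= 1 ->
    \sum_(n < N) (eigenfun d n r / n.+1%:R) ^+ 2 <= C * (r `^ (- a) / a)) ->
  0 < p -> p * m%:R < 2 * d%:R ->
  {ae P, forall w, (Lnorm rad p%:E (fun r => (modulus (F (w, r)))%:E) < +oo)%E}.
Proof.
move=> alpha0 C0 cn Cb p0 pm.
(* The midpoint of d - 2 and 2 d / p, which is positive also when d = 2. *)
pose a : R := (m%:R + 2 * d%:R / p) / 2.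
have am0 : m%:R < 2 * d%:R / p by rewrite ltr_pdivlMr// mulrC.
have am : m%:R < a by move: am0; rewrite /a; move: (_ / p) => u; lra.
have a0 : 0 < a by apply: le_lt_trans am; exact: ler0n.
have ap : a * p / 2 < d%:R.
  have -> : a * p / 2 = (p * m%:R + 2 * d%:R) / 4 by rewrite /a; field; rewrite gt_eqF.
  by move: pm; move: (p * _) d%:R => u v; lra.
pose A : R := alpha * Num.sqrt (C / a).
have A0 : 0 < A by rewrite mulr_gt0// sqrtr_gt0 divr_gt0.
pose s (r : R) := A * r `^ (- a / 2).
pose D : set R := `]0, 1]%classic.
have ms : measurable_fun setT s.
  by apply: measurable_funM => //; exact: measurable_powR.
have mD : measurable D by exact: measurable_itv.
have s0 r : D r -> 0 < s r.
  by rewrite /D/= in_itv/= => /andP[r0 _]; rewrite mulr_gt0// powR_gt0.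
have es N r : D r -> \sum_(n < N) e n r ^+ 2 <= s r ^+ 2.
  move=> Dr; have r0 : 0 < r <= 1 by move: Dr; rewrite /D/= in_itv.
  have -> : s r ^+ 2 = alpha ^+ 2 * (C * (r `^ (- a) / a)).
    rewrite /s /A 2!exprMn sqr_sqrtr; last by rewrite ltW// divr_gt0.
    rewrite -(powR_mulrn 2 (powR_ge0 _ _)) -powRrM divfK//.
    by move: (_ `^ _) => u; field; rewrite gt_eqF.
  apply: le_trans (ler_wpM2l (sqr_ge0 alpha) (Cb a a0 (ltW am) N r r0)).
  rewrite mulr_sumr; apply: ler_sum => n _.
  rewrite -exprMn -[_ ^+ 2]real_normK ?num_real// -[leRHS]real_normK ?num_real//.
  rewrite ler_sqr ?nnegrE//.
  rewrite /e [alpha * _]mulrA [alpha * _]mulrC -mulrA normrM [leRHS]normrM mulrC.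
  apply: ler_wpM2l => //; rewrite [leRHS]ger0_norm; last first.
    by rewrite divr_ge0// ltW.
  exact: cn.
have sfin : (\int[rad]_r (s r `^ p)%:E < +oo)%E.
  pose b : R := d%:R - a * p / 2.
  have b0 : 0 < b by rewrite subr_gt0.
  have msp : measurable_fun setT (fun r => s r `^ p).
    exact: (measurableT_comp (measurable_powR p) ms).
  rewrite ge0_integral_radial; first last.
  - by move=> r; rewrite lee_fin powR_ge0.
  - exact/measurable_EFinP.
  rewrite -integral_itv_obnd_cbnd; last first.
    apply: measurable_funTS; apply: emeasurable_funM; apply/measurable_EFinP => //; exact:
        measurable_funX.
  have E r : r \in (`]0, 1]%classic : set R) ->
      ((s r `^ p)%:E * (r ^+ m.+1)%:E)%E = ((A `^ p)%:E * (r `^ (b - 1))%:E)%E.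
    rewrite inE/= in_itv/= => /andP[r0 _].
    rewrite -!EFinM /s powRM ?powR_ge0 ?(ltW A0)// -mulrA; congr (_ * _)%:E.
    rewrite -powRrM -powR_mulrn ?(ltW r0)// -powRD ?(gt_eqF r0) ?implybT//.
    by congr (_ `^ _); rewrite /b -[d%:R]natr1 -[m.+1%:R]natr1; ring.
  under eq_integral => r rI do rewrite (E r rI).
  rewrite ge0_integralZl_EFin ?powR_ge0//.
  - by rewrite lte_mul_pinfty ?lee_fin ?powR_ge0//; exact: integral_powR_lty.
  - by move=> r _; rewrite lee_fin powR_ge0.
  - by apply: measurable_funTS; apply/measurable_EFinP; exact: measurable_powR.
have D0 := @radial_measure_setC R m.+1.
have fin_Re := @gaussian_series_Lp _ _ _ _ _ P rad _ (iid_gaussian_Re g_gaussian g_indep)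
  _ mce _ (measurable_Re_series FS) (Re_series_lim FS me)
  _ _ _ p0 ms mD D0 s0 es sfin.
have fin_Im := @gaussian_series_Lp _ _ _ _ _ P rad _ (iid_gaussian_Im g_gaussian g_indep)
  _ mce _ (measurable_Im_series FS) (Im_series_lim FS me)
  _ _ _ p0 ms mD D0 s0 es sfin.
have key w : (\int[rad]_r (`|complex.Re (F (w, r))| `^ p)%:E < +oo)%E ->
    (\int[rad]_r (`|complex.Im (F (w, r))| `^ p)%:E < +oo)%E ->
    (Lnorm rad p%:E (fun r => (modulus (F (w, r)))%:E) < +oo)%E.
  move=> wR wI; apply/(Lnorm_modulus_lty rad _ p0).
  have mRw : measurable_fun setT (fun r => complex.Re (F (w, r))).
    exact: (measurable_fun_pair2 w (measurable_Re_series FS)).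
  have mIw : measurable_fun setT (fun r => complex.Im (F (w, r))).
    exact: (measurable_fun_pair2 w (measurable_Im_series FS)).
  pose q := 2 `^ p : R; have q0 : 0 <= q by exact: powR_ge0.
  pose u r := `|complex.Re (F (w, r))| `^ p.
  pose v r := `|complex.Im (F (w, r))| `^ p.
  have mu_ : measurable_fun setT u.
    by apply: (measurableT_comp (measurable_powR p)); exact: measurableT_comp.
  have mv : measurable_fun setT v.
    by apply: (measurableT_comp (measurable_powR p)); exact: measurableT_comp.
  have mF : measurable_fun setT (fun r => modulus (F (w, r))).
    exact: measurableT_comp measurable_modulus (measurable_fun_pair2 w FS.1).
  apply: (@le_lt_trans _ _ (\int[rad]_r ((q * u r)%:E + (q * v r)%:E)))%E.
    apply: (ge0_le_integral _ measurableT) => [r _|||r _].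
    - by rewrite lee_fin powR_ge0.
    - by apply/measurable_EFinP; exact: (measurableT_comp (measurable_powR p) mF).
    - by apply: emeasurable_funD; apply/measurable_EFinP; exact: measurable_funM.
    - by rewrite -EFinD lee_fin -mulrDr; exact: powR_modulus_le.
  have qu0 r : [set: R] r -> (0 <= (q * u r)%:E)%E.
    by move=> _; rewrite lee_fin mulr_ge0// powR_ge0.
  have qv0 r : [set: R] r -> (0 <= (q * v r)%:E)%E.
    by move=> _; rewrite lee_fin mulr_ge0// powR_ge0.
  rewrite ge0_integralD//; [|exact/measurable_EFinP/measurable_funM..].
  rewrite lte_add_pinfty//.
  - under eq_integral do rewrite EFinM.
    rewrite ge0_integralZl_EFin//; last exact/measurable_EFinP.
      by apply: (lte_mul_pinfty _ _ wR); rewrite ?lee_fin.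
    by move=> r _; rewrite lee_fin powR_ge0.
  - under eq_integral do rewrite EFinM.
    rewrite ge0_integralZl_EFin//; last exact/measurable_EFinP.
      by apply: (lte_mul_pinfty _ _ wI); rewrite ?lee_fin.
    by move=> r _; rewrite lee_fin powR_ge0.
have aeR := ae_Lp_section (measurable_Re_series FS) fin_Re.
have aeI := ae_Lp_section (measurable_Im_series FS) fin_Im.
exact: (filterS2 _ key aeR aeI).
Qed.

End random_series_norms.

(** * Supercritical exponents *)

Section elementary_sums.
Context {R : realType}.

(** Telescoping, as (k+1)^(m+1) - k^(m+1) <= (m+1) (k+1)^m. *)
Lemma exprn_le_sum_exprn (m N : nat) :
  (N%:R : R) ^+ m.+1 <= m.+1%:R * \sum_(n < N) n.+1%:R ^+ m.
Proof.
elim: N => [|N IH]; first by rewrite expr0n big_ord0 mulr0.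
rewrite big_ord_recr/= mulrDr; apply: le_trans (lerD IH (lexx _)).
rewrite -lerBlDl subrXX -natr1 addrAC subrr add0r mul1r.
rewrite -[m.+1 in leRHS]card_ord mulr_natl -sumr_const; apply: ler_sum => i _.
have im : (i <= m)%N by rewrite -ltnS.
rewrite /= -[in leRHS](subnK im) exprD ler_wpM2l ?exprn_ge0// lerXn2r ?nnegrE//.
by rewrite lerDl.
Qed.

End elementary_sums.

Section random_series_divergence.
Context dO (Omega : measurableType dO) (R : realType) (P : probability Omega R).
Variable m : nat.
Local Notation d := m.+3.
Local Notation rad := (@radial_measure R d).
Variables (g : nat -> {RV P >-> R[i]}) (c : nat -> R) (F : Omega * R -> R[i]).
Hypothesis g_gaussian : forall n, complex_normal 1 (g n).
Hypothesis g_indep : independent_RVs g.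
Hypothesis FS : is_random_series P d (fun n => g n) c F.
Hypothesis me : forall n, measurable_fun setT (@eigenfun R d n).
Let e n r := c n * @eigenfun R d n r.

Let mce n : measurable_fun setT (e n).
Proof. exact: measurable_funM. Qed.

Variables (alpha k C p : R).
Hypothesis alpha0 : 0 < alpha.
Hypothesis cn : forall n, alpha / n.+1%:R <= c n.
Hypothesis k0 : 0 < k.
Hypothesis C0 : 0 < C.
Hypothesis eigenfun_bounded :
  forall n, exists B : R, forall r, 0 < r -> `|eigenfun d n r| <= B.
Hypothesis eigenfun_ge : forall N, exists delta : R,
  [/\ 0 < delta, delta * N.+1%:R <= 1, 1 <= C * (delta * N.+1%:R) &
    forall n, (n <= N)%N -> exists q : R, [/\ 0 <= q, k * n.+1%:R ^+ m.+2 <= q ^+ 2 &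
      forall r, 0 < r <= delta -> q <= eigenfun d n r]].
Hypothesis p1 : 1 <= p.
Hypothesis pm : 2 * d%:R < p * m.+1%:R.

Let integrable_e delta n : delta <= 1 -> rad.-integrable `]0, delta]%classic (EFin \o e n).
Proof.
have [B eB] := eigenfun_bounded n => d1.
apply: (le_integrable _ (g := EFin \o cst (`|c n| * B))) => //.
- by apply/measurable_EFinP; apply: measurable_funTS.
- move=> r /=; rewrite in_itv/= => /andP[r0 _]; rewrite lee_fin.
  by rewrite /e normrM (le_trans _ (ler_norm _))// ler_wpM2l// eB.
- by apply: finite_measure_integrable_cst.
Qed.

(** With L = N + 1, D = (0, delta] of mass V and delta of order 1 / L, the n-th term of the
    series has an integral over D of square at least alpha^2 k n^(d-3) V^2 for n <= L, hence
    sigma^2 = kap L^(d-2) V^2 is allowed.  The choice lambda = (eta / 2) sigma / V makes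
    lambda V one half of eta sigma, and the other half remains for lambda^(1-p) M as soon
    as M <= lambda^p V, where lambda^p V is at least a constant times
    L^(p (d-2) / 2 - d). *)
Lemma random_series_not_Lp :
  ~ {ae P, forall w, (Lnorm rad p%:E (fun r => (modulus (F (w, r)))%:E) < +oo)%E}.
Proof.
have p0 : 0 < p by rewrite (lt_le_trans _ p1).
have main := @gaussian_series_not_Lp _ _ _ _ _ P rad _ (iid_gaussian_Re g_gaussian g_indep)
  _ mce _ (measurable_Re_series FS) (Re_series_lim FS me) p p1 _.
move=> ae_fin; apply: main; last first.
  have key w : (Lnorm rad p%:E (fun r => (modulus (F (w, r)))%:E) < +oo)%E ->
      (\int[rad]_r (`|complex.Re (F (w, r))| `^ p)%:E < +oo)%E.
    move=> /(Lnorm_modulus_lty rad _ p0); apply: le_lt_trans.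
    apply: (ge0_le_integral _ measurableT) => [r _|||r _].
    - by rewrite lee_fin powR_ge0.
    - apply/measurable_EFinP; apply: (measurableT_comp (measurable_powR p)).
      apply: measurableT_comp => //.
      exact: (measurable_fun_pair2 w (measurable_Re_series FS)).
    - apply/measurable_EFinP; apply: (measurableT_comp (measurable_powR p)).
      exact: measurableT_comp measurable_modulus (measurable_fun_pair2 w FS.1).
    - rewrite lee_fin; apply: ge0_ler_powR; rewrite ?nnegrE ?modulus_ge0 ?(ltW p0)//.
      exact: normr_Re_le_modulus.
  exact: (filterS key ae_fin).
move=> M eta M0 eta0.
pose kap : R := alpha ^+ 2 * k / m.+1%:R.
have kap0 : 0 < kap by rewrite divr_gt0// mulr_gt0// exprn_gt0.
pose gam : R := p * m.+1%:R / 2 - d%:R.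
have gam0 : 0 < gam.
  by rewrite subr_gt0 ltr_pdivlMr// mulrC.
pose cst : R := (eta / 2) `^ p * kap `^ (p / 2) / (C ^+ d * d%:R).
have cst0 : 0 < cst.
  by rewrite divr_gt0// mulr_gt0 ?powR_gt0 ?exprn_gt0// divr_gt0.
have [N NM] : exists N, M <= cst * N.+1%:R `^ gam.
  exists (Num.bound ((M / cst) `^ gam^-1)).
  rewrite -ler_pdivrMl// mulrC -[leLHS](@powRr1 _ (M / cst)); last by rewrite divr_ge0 ?ltW.
  rewrite -[X in _ `^ X <= _](mulVf (lt0r_neq0 gam0)) powRrM; apply: ge0_ler_powR.
  - exact: ltW.
  - by rewrite nnegrE powR_ge0.
  - by rewrite nnegrE.
  - apply: (@le_trans _ _ (Num.bound ((M / cst) `^ gam^-1))%:R); last by rewrite ler_nat.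
    by apply: ltW; apply: archi_boundP; exact: powR_ge0.
have [delta [d0 dL Cd qE]] := eigenfun_ge N.
have delta1 : delta <= 1.
  apply: le_trans dL; rewrite ler_peMr ?(ltW d0)// ler1n//.
pose V : R := delta ^+ d / d%:R.
have V0 : 0 < V by rewrite divr_gt0// exprn_gt0.
pose sig0 : R := Num.sqrt (kap * N.+1%:R ^+ m.+1).
have sig00 : 0 < sig0 by rewrite sqrtr_gt0 mulr_gt0// exprn_gt0.
have radD : rad `]0, delta]%classic = V%:E.
  by rewrite radial_measure_itv// (ltW d0).
exists `]0, delta]%classic, N.+1, (sig0 * V), (eta / 2 * sig0); split.
- exact: measurable_itv.
- by move=> n; exact: integrable_e.
- by split; apply: mulr_gt0 => //; exact: divr_gt0.
- rewrite exprMn sqr_sqrtr; last first.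
    by apply: mulr_ge0; [exact: ltW|exact: exprn_ge0].
  apply: (@le_trans _ _ (\sum_(n < N.+1) (alpha ^+ 2 * k * V ^+ 2) * n.+1%:R ^+ m)).
    rewrite -mulr_sumr /kap.
    have -> : alpha ^+ 2 * k / m.+1%:R * N.+1%:R ^+ m.+1 * V ^+ 2 =
        (alpha ^+ 2 * k * V ^+ 2) * (N.+1%:R ^+ m.+1 / m.+1%:R) :> R.
      by move: (N.+1%:R ^+ m.+1) (m.+1%:R^-1) => u v; ring.
    rewrite ler_wpM2l//; last by rewrite ler_pdivrMr// mulrC exprn_le_sum_exprn.
    by apply: mulr_ge0; [apply: mulr_ge0; [exact: sqr_ge0|exact: ltW]|exact: sqr_ge0].
  apply: ler_sum => n _; have [q [q0 kq qe]] := qE n (leq_ord n).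
  have n0 : 0 < n.+1%:R :> R by [].
  have low : alpha / n.+1%:R * q * V <= \int[rad]_(r in `]0, delta]%classic) e n r.
    have -> : V = fine (rad `]0, delta]%classic) by rewrite radD.
    rewrite -Rintegral_cst//; apply: le_Rintegral => //.
    - exact: finite_measure_integrable_cst.
    - exact: integrable_e.
    - move=> r /=; rewrite in_itv/= => r0; rewrite /e.
      apply: ler_pM => //; first by rewrite divr_ge0// ltW.
      exact: qe.
  have low0 : 0 <= alpha / n.+1%:R * q * V.
    by apply: mulr_ge0; [apply: mulr_ge0 => //; rewrite divr_ge0// ltW|exact: ltW].
  apply: (@le_trans _ _ ((alpha / n.+1%:R * q * V) ^+ 2)); last first.
    by rewrite ler_sqr ?nnegrE//; exact: le_trans low.
  have -> : alpha ^+ 2 * k * V ^+ 2 * n.+1%:R ^+ m =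
      (alpha / n.+1%:R * V) ^+ 2 * (k * n.+1%:R ^+ m.+2).
    have aux (u v : R) : u != 0 ->
        alpha ^+ 2 * k * V ^+ 2 * v = (alpha / u * V) ^+ 2 * (k * (u * (u * v))).
      by move=> u0; field.
    by rewrite [_ ^+ m.+2]exprS [_ ^+ m.+1]exprS; apply: aux; rewrite gt_eqF.
  have -> : (alpha / n.+1%:R * q * V) ^+ 2 = (alpha / n.+1%:R * V) ^+ 2 * q ^+ 2.
    by ring.
  by rewrite ler_wpM2l// sqr_ge0.
- have -> : fine (rad `]0, delta]%classic) = V by rewrite radD.
  set lam := eta / 2 * sig0.
  have lam0 : 0 < lam by apply: mulr_gt0 => //; exact: divr_gt0.
  suff Mlam : M <= lam `^ p * V.
    have -> : lam `^ (1 - p) = lam / lam `^ p.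
      by rewrite -powRN -[X in X * _]powRr1 ?ltW// -powRD// (gt_eqF lam0) implybT.
    have : lam / lam `^ p * M <= lam * V.
      rewrite -mulrA ler_wpM2l ?(ltW lam0)// ler_pdivrMl//.
      by rewrite powR_gt0.
    have -> : eta * (sig0 * V) = lam * V + lam * V by rewrite /lam; field.
    by move: (lam * V) => u; lra.
  apply: le_trans NM _.
  have L0 : 0 < N.+1%:R :> R by [].
  have sigp : sig0 `^ p = kap `^ (p / 2) * N.+1%:R `^ (p * m.+1%:R / 2).
    have Lm0 : 0 <= N.+1%:R ^+ m.+1 :> R by exact: exprn_ge0.
    rewrite /sig0 -(powR12_sqrt (mulr_ge0 (ltW kap0) Lm0)) -powRrM.
    rewrite (powRM _ (ltW kap0) Lm0) -[N.+1%:R ^+ _]powR_mulrn// -powRrM.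
    by congr (_ `^ _ * _ `^ _); [rewrite mulrC|rewrite mulrCA mulrC -mulrA mulrCA mulrA].
  rewrite /lam powRM ?(ltW sig00) ?divr_ge0 ?(ltW eta0)// sigp.
  have -> : cst * N.+1%:R `^ gam = (eta / 2) `^ p * (kap `^ (p / 2) *
     N.+1%:R `^ (p * m.+1%:R / 2)) * ((C * N.+1%:R) ^- d / d%:R).
    have -> : N.+1%:R `^ gam = N.+1%:R `^ (p * m.+1%:R / 2) / N.+1%:R ^+ d :> R.
      by rewrite /gam powRD ?(gt_eqF L0) ?implybT// powRN powR_mulrn// ltW.
    have aux (x y u v w z : R) :
        x * y / (u * w) * (z / v) = x * (y * z) * ((u * v)^-1 / w).
      by rewrite !invfM; ring.
    by rewrite /cst [(C * _) ^+ d]exprMn aux.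
  rewrite ler_wpM2l// ?mulr_ge0 ?powR_ge0//.
  rewrite /V ler_pM2r ?invr_gt0//.
  rewrite -exprVn lerXn2r ?nnegrE ?invr_ge0 ?mulr_ge0 ?(ltW C0) ?(ltW d0)//.
  by rewrite -div1r ler_pdivrMr ?mulr_gt0// mulrCA.
Qed.

End random_series_divergence.

(** * The critical exponent *)

Theorem theorem4 (R : realType) (d : nat) (hd : (2 <= d)%N)
  (c : nat -> R)
  (c_l2 : (Lnorm (@counting nat R) 2%:E (fun n => (c n)%:E) < +oo)%E)
  (c_bounds : exists alpha1 alpha2 : R,
    [/\ 0 < alpha1, alpha1 <= alpha2 &
        forall n, alpha1 / n.+1%:R <= c n <= alpha2 / n.+1%:R])
  (dO : measure_display) (Omega : measurableType dO) (P : probability Omega R)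
  (g : nat -> {RV P >-> R[i]})
  (g_gaussian : forall n, complex_normal 1 (g n))
  (g_indep : independent_RVs g)
  (F : Omega * R -> R[i])
  (F_series : is_random_series P d (fun n => g n) c F) :
  critical_exponent P d F =
  if (d == 2)%N then +oo%E else (2 * d%:R / (d%:R - 2))%:E.
Proof.
case: d hd F_series => [|[|m]] // _ FS.
have [alpha1 [alpha2 [alpha10 alpha12 cb]]] := c_bounds.
have alpha20 : 0 < alpha2 := lt_le_trans alpha10 alpha12.
have c_ge n : alpha1 / n.+1%:R <= c n by have /andP[] := cb n.
have c_le n : `|c n| <= alpha2 / n.+1%:R.
  have /andP[c1 c2] := cb n; rewrite ger0_norm//.
  by apply: le_trans c1; rewrite divr_ge0// ltW.
have [phi [chi [K [sol K0 JE]]]] := @besselJ_radial R m.+2 isT.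
have [C C0 Cb] := eigenfun_sum_le sol K0 JE.
have lower := eigenfun_ge_near0 sol K0 JE.
have bounded := eigenfun_bounded sol K0 JE.
have me := measurable_eigenfun sol JE.
have finite p : 2 <= p -> p * m%:R < 2 * m.+2%:R :> R ->
    (p%:E <= critical_exponent P m.+2 F)%E.
  move=> p2 pm; apply: ereal_sup_ubound; exists p => //; split => //.
  apply: (random_series_Lp_lty g_gaussian g_indep FS me alpha20 C0 c_le Cb) => //.
  exact: lt_le_trans p2.
case: m => [|m] in FS phi chi K sol K0 JE C C0 Cb lower bounded me finite *.
  apply/eqyP => A A0; apply: (@le_trans _ _ (Num.max 2 A)%:E).
    by rewrite lee_fin le_max lexx orbT.
  by apply: finite; rewrite ?le_max ?lexx// mulr0 mulr_gt0.
have -> : m.+3%:R - 2 = m.+1%:R :> R by rewrite -(natrB _ (isT : (2 <= m.+3)%N)).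
rewrite /=; set q : R := _ / _.
have m0 : 0 < m.+1%:R :> R by [].
have q2 : 2 < q by rewrite ltr_pdivlMr// ltr_pM2l// ltr_nat.
have [k [B [k0 B0 lowerN]]] := lower isT.
apply/eqP; rewrite eq_le; apply/andP; split.
  apply: ub_ereal_sup => _ [p [p2 fin] <-]; rewrite lee_fin leNgt; apply/negP => qp.
  apply: (random_series_not_Lp g_gaussian g_indep FS me alpha10 c_ge k0 B0 bounded lowerN _ _ fin).
    by apply: le_trans p2; rewrite ler1n.
  by rewrite -ltr_pdivrMr.
apply/lee_addgt0Pr => e e0; pose p := Num.max 2 (q - e).
have pq : p < q by rewrite gt_max q2/= ltrBlDr ltrDl.
apply: (@le_trans _ _ (p%:E + e%:E)%E).
  by rewrite -EFinD lee_fin -lerBlDr le_max lexx orbT.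
by apply: leeD => //; apply: finite; rewrite ?le_max ?lexx// -ltr_pdivlMr.
Qed.
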